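(* Let $\tau_0,\tau_1>0$, $n\ge1$, let $\lambda_i>0$ satisfy $\sum_{i=1}^n\lambda_i=1$, and let $\mu_i=\mathcal N(m_i,\Sigma_i)$ with $a_i>0$, $m_i\in\mathbb R^d$, $\Sigma_i\in\mathbb S_{++}^d$, $i=1,\dots,n$. With $\mathsf F,\mathsf Z,\Phi,\theta$ as in the context: the profiled shape objective $\Phi$ attains its global minimum on $\mathcal G_d^1$; equivalently, $\mathsf Z$ attains its global maximum on $\mathcal G_d^1$. In particular, the infimum $\inf_{b>0,\ \nu\in\mathcal G_d^1}\mathsf F(b,\nu)$ is attained, and its minimizer set is $$\operatorname*{argmin}_{b>0,\ \nu\in\mathcal G_d^1}\mathsf F(b,\nu)=\left\{\bigl(\mathsf Z(\nu)^{1/\theta},\nu\bigr):\nu\in\operatorname*{argmax}_{\mathcal G_d^1}\mathsf Z\right\}.$$ The maximizing shape set $\operatorname*{argmax}_{\mathcal G_d^1}\mathsf Z$ is compact in mean--covariance coordinates (i.e. as a subset of $\mathbb R^d\times\mathbb S_{++}^d$); consequently the set of minimizers of $\mathsf F$ displayed above is compact.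
   Context: $\mathbb S_{++}^d$ is the set of real symmetric positive-definite $d\times d$ matrices, and $\mathcal G_d^1=\{\mathcal N(m,\Sigma):m\in\mathbb R^d,\ \Sigma\in\mathbb S_{++}^d\}$, identified with $\mathbb R^d\times\mathbb S_{++}^d$ through $(m,\Sigma)$. For finite nonnegative Borel measures, $\mathrm{KL}(\rho\mid\eta)=\int(r\log r-r+1)\,d\eta$ if $\rho\ll\eta$ with $r=d\rho/d\eta$, and $+\infty$ otherwise. For finite nonnegative Borel measures $\alpha,\beta$ on $\mathbb R^d$, $$\mathsf U_{\tau_0,\tau_1}(\alpha,\beta)=\inf_{\gamma}\Big\{\int\|x-y\|^2\,d\gamma+\tau_0\mathrm{KL}(\gamma_0\mid\alpha)+\tau_1\mathrm{KL}(\gamma_1\mid\beta)\Big\},$$ the infimum being over finite nonnegative Borel measures $\gamma$ on $\mathbb R^d\times\mathbb R^d$ with first and second marginals $\gamma_0,\gamma_1$. Put $s=\tau_0+\tau_1$, $\theta=\tau_0/s$. For $\mu,\nu\in\mathcal G_d^1$, $$\mathsf A(\mu,\nu)=\inf_{p,q\in\mathcal P(\mathbb R^d)}\{W_2^2(p,q)+\tau_0\mathrm{KL}(p\mid\mu)+\tau_1\mathrm{KL}(q\mid\nu)\},$$ where $W_2^2(p,q)\in[0,\infty]$ is the infimum of $\int|x-y|^2d\pi$ over couplings $\pi$ of $p,q$. Set $\mathsf F(b,\nu)=\sum_{i=1}^n\lambda_i\,\mathsf U_{\tau_0,\tau_1}(a_i\mu_i,b\nu)$ for $b>0$; $A_i(\nu)=\mathsf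 A(\mu_i,\nu)$; $\mathsf Z(\nu)=\sum_{i=1}^n\lambda_i a_i^\theta e^{-A_i(\nu)/s}$; $\bar a=\sum_i\lambda_i a_i$; $\Phi(\nu)=\inf_{b>0}\mathsf F(b,\nu)$, which equals $\tau_0(\bar a-\mathsf Z(\nu)^{1/\theta})$. *)

(* Defs.v *)
From HB Require Import structures.
From mathcomp Require Import all_boot all_order all_algebra.
From mathcomp Require Import all_classical all_reals all_analysis.
From mathcomp Require Import measurable_realfun.

Set Implicit Arguments.
Unset Strict Implicit.
Unset Printing Implicit Defensive.

Import Order.TTheory GRing.Theory Num.Theory.
Import numFieldNormedType.Exports.

Local Open Scope classical_set_scope.
Local Open Scope ring_scope.

(* A point of R^d, as an element of a measurable space, is a [d.-tuple R]: the
   library's sigma-algebra on it is the one generated by the coordinates, which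
   is the Borel sigma-algebra of R^d. Likewise the product sigma-algebra on
   [d.-tuple R * d.-tuple R] is the Borel sigma-algebra of R^d x R^d. *)

Section lebesgue_cons.
Local Open Scope ereal_scope.
Context (R : realType) (d : nat).
Variable m : {sigma_finite_measure set (d.-tuple R) -> \bar R}.

Let consT (xy : measurableTypeR R * d.-tuple R) : d.+1.-tuple R :=
  [tuple of xy.1 :: xy.2].

Let measurable_consT : measurable_fun [set: measurableTypeR R * d.-tuple R] consT.
Proof.
by apply: measurable_cons => //; exact: measurable_fst.
Qed.

Definition lebesgue_cons (A : set (d.+1.-tuple R)) : \bar R :=
  (@lebesgue_measure R \x m) (consT @^-1` A).

Let lebesgue_cons0 : lebesgue_cons set0 = 0.
Proof. by rewrite /lebesgue_cons preimage_set0 measure0. Qed.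

Let lebesgue_cons_ge0 A : 0 <= lebesgue_cons A.
Proof. exact: measure_ge0. Qed.

Let lebesgue_cons_sigma_additive : semi_sigma_additive lebesgue_cons.
Proof.
move=> F mF tF mUF.
have := @measure_semi_sigma_additive _ _ _
  (pushforward (@lebesgue_measure R \x m) consT) F mF tF mUF.
exact.
Qed.

HB.instance Definition _ := isMeasure.Build _ _ _ lebesgue_cons
  lebesgue_cons0 lebesgue_cons_ge0 lebesgue_cons_sigma_additive.

Let sigma_finite_lebesgue_cons : sigma_finite setT lebesgue_cons.
Proof.
have /sigma_finiteP[F [TF ndF Foo]] := sigma_finiteT (@lebesgue_measure R).
have /sigma_finiteP[G [TG ndG Goo]] := sigma_finiteT m.
pose g (t : d.+1.-tuple R) : measurableTypeR R * d.-tuple R :=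
  (thead t, [tuple of behead t]).
have mg : measurable_fun setT g.
  by apply/measurable_fun_pair => /=;
    [exact: measurable_tnth|exact: measurable_behead].
have gK : cancel consT g.
  by move=> [x y]; congr pair => //=; apply/val_inj.
exists (fun n => g @^-1` (F n `*` G n)).
  rewrite -preimage_bigcup (_ : \bigcup_n _ = setT) ?preimage_setT//.
  rewrite -setXTT TF TG predeqE => -[x y]; split.
    by move=> [n _ []/= ? ?]; split; exists n.
  move=> [/= [n _ Fnx] [k _ Gky]]; exists (maxn n k) => //; split.
  - by move: x Fnx; exact/subsetPset/ndF/leq_maxl.
  - by move: y Gky; exact/subsetPset/ndG/leq_maxr.
move=> k; have [mF Fk] := Foo k; have [mG Gk] := Goo k; split.
  by rewrite -[X in measurable X]setTI; apply: mg => //; exact: measurableX.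
rewrite /lebesgue_cons (_ : consT @^-1` _ = F k `*` G k).
  by rewrite product_measure1E// lte_mul_pinfty// ge0_fin_numE.
by apply/seteqP; split => x; rewrite /preimage /mkset gK.
Qed.

HB.instance Definition _ :=
  Measure_isSigmaFinite.Build _ _ _ lebesgue_cons sigma_finite_lebesgue_cons.

End lebesgue_cons.

Fixpoint lebesgue_tuple (R : realType) (d : nat) :
    {sigma_finite_measure set (d.-tuple R) -> \bar R} :=
  match d with
  | 0%N => dirac [tuple]
  | d'.+1 => lebesgue_cons (lebesgue_tuple R d')
  end.

Section gaussian.
Context (R : realType) (d : nat).

Definition spd : set 'M[R]_d :=
  [set S | S^T = S /\ forall x : 'rV_d, x != 0 -> 0 < (x *m S *m x^T) 0 0].

Variables (m : 'rV[R]_d) (S : 'M[R]_d).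

Definition gauss_kernel (x : d.-tuple R) : R :=
  let v := \row_i tnth x i - m in
  expR (- (v *m invmx S *m v^T) 0 0 / 2).

Let measurable_gauss_kernel : measurable_fun setT gauss_kernel.
Proof.
have mv i : measurable_fun setT
    (fun x : d.-tuple R => (\row_i tnth x i - m) 0 i).
  under eq_fun do rewrite !mxE.
  by apply: measurable_funB => //; exact: measurable_tnth.
apply: measurableT_comp => //; apply: measurable_funM => //.
apply: measurableT_comp => //.
under eq_fun do rewrite mxE.
apply: measurable_sum => j; apply: measurable_funM; last first.
  by under eq_fun do rewrite mxE; exact: mv.
under eq_fun do rewrite mxE.
by apply: measurable_sum => k; apply: measurable_funM => //; exact: mv.
Qed.

Definition gauss_mass (A : set (d.-tuple R)) : \bar R :=
  (\int[lebesgue_tuple R d]_(x in A) (gauss_kernel x)%:E)%E.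

Let gauss_mass0 : gauss_mass set0 = 0%E.
Proof. exact: integral_set0. Qed.

Let gauss_mass_ge0 A : (0 <= gauss_mass A)%E.
Proof. by apply: integral_ge0 => x _; rewrite lee_fin expR_ge0. Qed.

Let gauss_mass_sigma_additive : semi_sigma_additive gauss_mass.
Proof.
move=> F mF tF mUF; rewrite /gauss_mass ge0_integral_bigcup//=.
- apply: is_cvg_ereal_nneg_natsum_cond => n _ _.
  by apply: integral_ge0 => x _; rewrite lee_fin expR_ge0.
- by apply/measurable_EFinP; exact: measurable_funS measurable_gauss_kernel.
- by move=> x _; rewrite lee_fin expR_ge0.
Qed.

HB.instance Definition _ := isMeasure.Build _ _ _ gauss_mass
  gauss_mass0 gauss_mass_ge0 gauss_mass_sigma_additive.

(* N(m, S), for S symmetric positive definite: the probability measure whose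
   Lebesgue density is proportional to exp (- (x - m) S^-1 (x - m)^T / 2). The
   default [dirac] of [mnormalize] is taken only if the total mass is 0 or
   +oo, which does not happen for such S. *)
Definition gaussian : probability (d.-tuple R) R :=
  mnormalize gauss_mass (dirac [tuple m 0 i | i < d]).

End gaussian.

Section kullback_leibler.
Context d (T : measurableType d) (R : realType).

Definition KL (rho eta : {finite_measure set T -> \bar R}) : \bar R :=
  if `[< rho `<< eta >] then
    (\int[eta]_x
       (let r := fine (Radon_Nikodym (charge_of_finite_measure rho) eta x) in
        r * ln r - r + 1)%:E)%E
  else +oo%E.

End kullback_leibler.

Section marginals.
Context d1 d2 (T1 : measurableType d1) (T2 : measurableType d2) (R : realType).
Variable gam : {finite_measure set (T1 * T2)%type -> \bar R}.

Definition marginal1 (A : set T1) : \bar R := gam (fst @^-1` A).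

Definition marginal2 (A : set T2) : \bar R := gam (snd @^-1` A).

Let marginal10 : marginal1 set0 = 0%E.
Proof. by rewrite /marginal1 preimage_set0 measure0. Qed.

Let marginal1_ge0 A : (0 <= marginal1 A)%E.
Proof. exact: measure_ge0. Qed.

Let marginal1_sigma_additive : semi_sigma_additive marginal1.
Proof.
move=> F mF tF mUF.
have := @measure_semi_sigma_additive _ _ _ (pushforward gam fst) F mF tF mUF.
exact.
Qed.

HB.instance Definition _ := isMeasure.Build _ _ _ marginal1
  marginal10 marginal1_ge0 marginal1_sigma_additive.

Let marginal1_fin : fin_num_fun marginal1.
Proof.
by move=> A mA; apply: fin_num_measure; rewrite -[X in measurable X]setTI;
  exact: measurable_fst.
Qed.

HB.instance Definition _ :=
  Measure_isFinite.Build _ _ _ marginal1 marginal1_fin.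

Let marginal20 : marginal2 set0 = 0%E.
Proof. by rewrite /marginal2 preimage_set0 measure0. Qed.

Let marginal2_ge0 A : (0 <= marginal2 A)%E.
Proof. exact: measure_ge0. Qed.

Let marginal2_sigma_additive : semi_sigma_additive marginal2.
Proof.
move=> F mF tF mUF.
have := @measure_semi_sigma_additive _ _ _ (pushforward gam snd) F mF tF mUF.
exact.
Qed.

HB.instance Definition _ := isMeasure.Build _ _ _ marginal2
  marginal20 marginal2_ge0 marginal2_sigma_additive.

Let marginal2_fin : fin_num_fun marginal2.
Proof.
by move=> A mA; apply: fin_num_measure; rewrite -[X in measurable X]setTI;
  exact: measurable_snd.
Qed.

HB.instance Definition _ :=
  Measure_isFinite.Build _ _ _ marginal2 marginal2_fin.

End marginals.

Section transport.
Context (R : realType) (d : nat).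
Local Notation X := (d.-tuple R).

Definition sqdist (x y : X) : R := \sum_(i < d) (tnth x i - tnth y i) ^+ 2.

Definition transport_cost (gam : {finite_measure set (X * X)%type -> \bar R})
    : \bar R :=
  (\int[gam]_xy (sqdist xy.1 xy.2)%:E)%E.

Definition coupling (p q : probability X R) : set (probability (X * X)%type R) :=
  [set pi | (forall A, measurable A -> marginal1 pi A = p A) /\
            (forall A, measurable A -> marginal2 pi A = q A)].

Definition W2sq (p q : probability X R) : \bar R :=
  ereal_inf [set transport_cost pi | pi in coupling p q].

Variables tau0 tau1 : R.

Definition UOT (al be : {finite_measure set X -> \bar R}) : \bar R :=
  ereal_inf (range (fun gam : {finite_measure set (X * X)%type -> \bar R} =>
    transport_cost gam + tau0%:E * KL (marginal1 gam) al
                       + tau1%:E * KL (marginal2 gam) be))%E.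

Definition shape_cost (mu nu : probability X R) : \bar R :=
  ereal_inf (range (fun pq : (probability X R * probability X R)%type =>
    W2sq pq.1 pq.2 + tau0%:E * KL pq.1 mu + tau1%:E * KL pq.2 nu))%E.

Variables (n : nat) (lambda a : 'I_n -> R) (mu : 'I_n -> probability X R).

(* Only used with [0 < c], where [`|c|] is [c]: the norm is there to get the
   nonnegative factor that [mscale] expects. *)
Definition scaled (c : R) (nu : probability X R)
  : {finite_measure set X -> \bar R} := mscale `|c|%:nng nu.

Definition barycenter_obj (b : R) (nu : probability X R) : \bar R :=
  (\sum_(i < n) (lambda i)%:E * UOT (scaled (a i) (mu i)) (scaled b nu))%E.

Definition profile_obj (nu : probability X R) : \bar R :=
  ereal_inf [set barycenter_obj b nu | b in [set b : R | 0 < b]].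

Definition mass_exponent : R := tau0 / (tau0 + tau1).

(* [expeR -oo = 0], so that an infinite [shape_cost] contributes 0. *)
Definition shape_score (nu : probability X R) : R :=
  \sum_(i < n) lambda i * a i `^ mass_exponent *
    fine (expeR (- (shape_cost (mu i) nu * ((tau0 + tau1)^-1)%:E))%E).

End transport.

(* G_d^1 in mean-covariance coordinates *)
Definition gauss_params (R : realType) (d : nat) : set ('rV[R]_d * 'M[R]_d) :=
  [set nu | spd nu.2].

Definition gaussian_of (R : realType) (d : nat) (nu : 'rV[R]_d * 'M[R]_d) :
  probability (d.-tuple R) R := gaussian nu.1 nu.2.

Section argext.
Context {disp : Order.disp_t} {T : Type} {Y : porderType disp}.

Definition argmin (D : set T) (f : T -> Y) : set T :=
  [set x | D x /\ forall y, D y -> (f x <= f y)%O].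

Definition argmax (D : set T) (f : T -> Y) : set T :=
  [set x | D x /\ forall y, D y -> (f y <= f x)%O].

End argext.

(* Main.v *)
(* Write [N(m, L^T L)] as the law of [m + z L] with [z] a standard normal row vector.
   Pushing transport plans through such affine maps turns A(mu_i, N(m, L^T L)) into a
   cost of (m, L) with fixed standard normal reference measures. This cost is defined
   for singular L too, and it is continuous and coercive in (m, L); hence Z, read in
   these coordinates, attains its maximum on a compact set.
   A singular L is never optimal. Choose unit vectors w, u with w L = 0 and L u^T = 0,
   and rotate so that w becomes the first basis vector e0 and e0 L_i is a positive
   multiple of u. Given the other coordinates, the optimal conditional law of the first
   coordinate of the source is an explicit normal law whose noise can be coupled with
   the first coordinate of the target; moving L in the direction w^T u then lowers all
   the costs at first order. So the maximizers are nonsingular and their image under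
   (m, L) |-> (m, L^T L) is the argmax of Z.
   Optimizing the total mass of a plan gives
   F(b, nu) = tau0 abar + tau1 b - s b^(1 - theta) Z(nu), and strict convexity of exp
   shows that its unique minimizer in b is Z(nu)^(1/theta). *)

Require Import Defs.
From HB Require Import structures.
From mathcomp Require Import all_boot all_order all_algebra.
From mathcomp Require Import all_classical all_reals all_analysis.
From mathcomp Require Import measurable_realfun.
From mathcomp Require Import ring lra.

Set Implicit Arguments.
Unset Strict Implicit.
Unset Printing Implicit Defensive.

Import Order.TTheory GRing.Theory Num.Theory.
Import numFieldNormedType.Exports.

Local Open Scope classical_set_scope.
Local Open Scope ring_scope.

(** * Integrals, densities and affine changes of variables *)

(** In factor coordinates the entropies of a plan do not depend on (m, L); only the quadratic cost
    does. So a plan can be kept while (m, L) moves, which gives continuity. Finite entropy relative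
    to a fixed Gaussian bounds second moments and forbids concentration near a hyperplane, which
    gives coercivity. The price is that a maximizer over all factors might be singular, that is, lie
    outside the admissible set. No optimal plan is used: every estimate is made on a plan optimal up
    to some h > 0, and h then tends to 0. A strict gain survives this only if its size does not
    depend on the plan, and Gibbs resampling ensures that. An arbitrary plan may carry no
    independent noise along u, but its resampling carries a normal noise of known deviation, without
    raising the sum of the cost and the entropies. The change of cost is at most (eps^2 - 2 c eps)
    M, where c comes from this deviation and M is the variance of a standard normal. The
    perturbation w^T u is determined by L alone, whereas c depends on i; the smallest c, capped by
    1, serves as common eps. *)

Section push_probability.
Context d d' (T : measurableType d) (T' : measurableType d') (R : realType).
Variables (P : probability T R) (f : T -> T').
Hypothesis mf : measurable_fun setT f.

Let mf_mixin := isMeasurableFun.Build _ _ _ _ _ mf.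
Let mf_pack : {mfun T >-> T'} := HB.pack f mf_mixin.

Definition push : probability T' R := distribution P mf_pack.

Lemma pushE A : push A = P (f @^-1` A).
Proof. by []. Qed.

Lemma ge0_integral_push (g : T' -> \bar R) :
  measurable_fun setT g -> (forall y, 0 <= g y)%E ->
  (\int[push]_y g y = \int[P]_x g (f x))%E.
Proof. by move=> mg g0; rewrite ge0_integral_pushforward. Qed.

End push_probability.

Section signed_comparison.
Local Open Scope ereal_scope.
Context d (T : measurableType d) (R : realType).
Variable mu : {measure set T -> \bar R}.

(** Moving the negative part of [h] to the left leaves only integrals of nonnegative functions, so
    those of [F] and [G] may be infinite. This is how tangent-line bounds for the entropy, whose
    correction term is signed, get integrated. *)
Lemma ge0_integral_le_addr (F G : T -> \bar R) (h : T -> R) :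
  measurable_fun setT F -> (forall x, 0 <= F x) ->
  measurable_fun setT G -> (forall x, 0 <= G x) ->
  mu.-integrable setT (EFin \o h) ->
  (forall x, F x <= G x + (h x)%:E) ->
  \int[mu]_x F x <= \int[mu]_x G x + \int[mu]_x (h x)%:E.
Proof.
move=> mF F0 mG G0 ih FGh.
have mh : measurable_fun setT (EFin \o h) := measurable_int _ ih.
have mhp := measurable_funepos mh; have mhn := measurable_funeneg mh.
have fhp := integrable_funepos measurableT ih.
have fhn := integrable_funeneg measurableT ih.
have hpE : \int[mu]_x ((EFin \o h)^\+ x) \is a fin_num.
  exact: integrable_fin_num fhp.
have hnE : \int[mu]_x ((EFin \o h)^\- x) \is a fin_num.
  exact: integrable_fin_num fhn.
rewrite [\int[mu]_x (h x)%:E]integralE -leeBlDr; last first.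
  by rewrite fin_numB hpE.
rewrite oppeB; last by rewrite fin_num_adde_defr.
rewrite addeCA addeC leeBlDr// addeC -!ge0_integralD//.
apply: ge0_le_integral => //.
- by move=> x _; rewrite adde_ge0// funeneg_ge0.
- exact: emeasurable_funD.
- exact: emeasurable_funD.
move=> x _; rewrite addeC [leRHS]addeC; move: (FGh x).
rewrite funeposE funenegE /= -!EFin_max.
case: (F x) (F0 x) => [r||] // _; case: (G x) (G0 x) => [s||] // _;
  rewrite ?addey ?leey// -?EFinD !lee_fin.
by rewrite /Num.max; do 2 case: ifPn => ?; lra.
Qed.

Lemma ge0_integral_ge_addr (F G : T -> \bar R) (h : T -> R) :
  measurable_fun setT F -> (forall x, 0 <= F x) ->
  measurable_fun setT G -> (forall x, 0 <= G x) ->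
  mu.-integrable setT (EFin \o h) ->
  (forall x, G x + (h x)%:E <= F x) ->
  \int[mu]_x G x + \int[mu]_x (h x)%:E <= \int[mu]_x F x.
Proof.
move=> mF F0 mG G0 ih GhF.
have ihN : mu.-integrable setT (EFin \o (- h)%R).
  have -> : EFin \o (- h)%R = -%E \o (EFin \o h) by [].
  exact: integrableN.
have hE : \int[mu]_x (h x)%:E \is a fin_num by exact: integrable_fin_num ih.
rewrite -leeBrDr//.
have -> : - (\int[mu]_x (h x)%:E) = \int[mu]_x ((- h)%R x)%:E.
  rewrite -integralN//=.
  by rewrite fin_num_adde_defl// fin_numN; exact/integrable_fin_num/integrable_funeneg.
apply: ge0_integral_le_addr => // x /=.
by have := GhF x; rewrite -leeBrDr.
Qed.

Lemma ge0_integral_eq_addr (F G : T -> \bar R) (h : T -> R) :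
  measurable_fun setT F -> (forall x, 0 <= F x) ->
  measurable_fun setT G -> (forall x, 0 <= G x) ->
  mu.-integrable setT (EFin \o h) ->
  (forall x, F x = G x + (h x)%:E) ->
  \int[mu]_x F x = \int[mu]_x G x + \int[mu]_x (h x)%:E.
Proof.
move=> mF F0 mG G0 ih FGh; apply/le_anti/andP; split.
- by apply: ge0_integral_le_addr => // x; rewrite FGh.
- by apply: ge0_integral_ge_addr => // x; rewrite FGh.
Qed.

End signed_comparison.

Section density.
Local Open Scope ereal_scope.
Context d (T : measurableType d) (R : realType).

(** A version of the density that is real and nonnegative everywhere, whereas [Radon_Nikodym] takes
    extended values and is controlled only almost everywhere. *)
Definition has_density (rho eta : set T -> \bar R) (r : T -> R) :=
  [/\ measurable_fun setT r, (forall x, 0 <= r x)%R &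
      forall A, measurable A -> rho A = \int[eta]_(x in A) (r x)%:E].

Lemma has_density_dominates (rho : {finite_measure set T -> \bar R})
    (eta : {measure set T -> \bar R}) r :
  has_density rho eta r -> rho `<< eta.
Proof.
move=> [mr r0 rhoE]; apply/null_content_dominatesP => A mA etaA.
rewrite rhoE//.
rewrite (@eq_integral _ _ _ eta A (abse \o (EFin \o r))); last first.
  by move=> x _ /=; rewrite ger0_norm.
apply: integral_abs_eq0 => //.
by apply/measurable_EFinP; exact: measurable_funTS.
Qed.

Lemma dominates_density (rho : {finite_measure set T -> \bar R})
    (eta : {sigma_finite_measure set T -> \bar R}) :
  rho `<< eta -> exists r, has_density rho eta r.
Proof.
move=> re; pose f := Radon_Nikodym_SigmaFinite.f rho eta.
have f0 x : 0 <= f x by exact: Radon_Nikodym_SigmaFinite.f_ge0.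
have ff x : f x \is a fin_num by exact: Radon_Nikodym_SigmaFinite.f_fin_num.
exists (fine \o f); split.
- apply: measurableT_comp => //; apply: measurable_int.
  exact: (Radon_Nikodym_SigmaFinite.f_integrable re).
- by move=> x; rewrite fine_ge0.
- move=> A mA; rewrite (Radon_Nikodym_SigmaFinite.f_integral re)//.
  by apply: eq_integral => x _ /=; rewrite fineK.
Qed.

Lemma has_density_integrable (rho : {finite_measure set T -> \bar R})
    (eta : {measure set T -> \bar R}) r :
  has_density rho eta r -> eta.-integrable setT (EFin \o r).
Proof.
move=> [mr r0 rhoE]; apply/integrableP; split; first exact/measurable_EFinP.
under eq_integral do rewrite /= ger0_norm//.
by rewrite -rhoE// ltey_eq fin_num_measure.
Qed.

Lemma has_density_integral (rho : {finite_measure set T -> \bar R})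
    (eta : {sigma_finite_measure set T -> \bar R}) r (f : T -> \bar R) :
  has_density rho eta r -> measurable_fun setT f -> (forall x, 0 <= f x) ->
  \int[rho]_x f x = \int[eta]_x (f x * (r x)%:E).
Proof.
move=> rr mf f0; have re := has_density_dominates rr.
have ir := has_density_integrable rr; have [mr r0 rhoE] := rr.
rewrite -(Radon_Nikodym_SigmaFinite.change_of_variables re)//.
have irn := Radon_Nikodym_SigmaFinite.f_integrable re.
apply: ge0_ae_eq_integral => //.
- by apply: emeasurable_funM => //; exact: measurable_int irn.
- by apply: emeasurable_funM => //; exact: measurable_int ir.
- by move=> x _; rewrite mule_ge0// Radon_Nikodym_SigmaFinite.f_ge0.
- by move=> x _; rewrite mule_ge0// lee_fin.
apply: ae_eqe_mul2l; apply: integral_ae_eq => //.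
- exact: measurable_int ir.
- move=> A _ mA.
  by rewrite -(Radon_Nikodym_SigmaFinite.f_integral re)// rhoE.
Qed.

Lemma has_density_ext (rho rho' : set T -> \bar R)
   (eta eta' : {measure set T -> \bar R}) r :
  (forall A, measurable A -> rho A = rho' A) ->
  (forall A, measurable A -> eta A = eta' A) ->
  has_density rho eta r -> has_density rho' eta' r.
Proof.
move=> rhoE etaE [mr r0 rE]; split => // A mA; rewrite -rhoE// rE//.
by apply: eq_measure_integral => B mB _; exact: etaE.
Qed.

End density.

(** * Lebesgue measure under affine maps *)

Section affine_line.
Local Open Scope ereal_scope.
Context {R : realType}.
Local Notation leb := (@lebesgue_measure R).

Lemma measurable_affine (a b : R) :
  measurable_fun setT (fun x : measurableTypeR R => a * x + b : measurableTypeR R)%R.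
Proof.
by apply: measurable_funD => //; apply: measurable_funM.
Qed.

Let lebesgue_affine_gt0 (a b : R) (A : set (measurableTypeR R)) : (0 < a)%R ->
  measurable A ->
  leb A = a%:E * leb ((fun x => a * x + b)%R @^-1` A).
Proof.
move=> a0 mA.
have a0' : (0 <= a)%R := ltW a0.
pose k : {nonneg R} := NngNum a0'.
have mf := @measurable_affine a b.
rewrite (_ : _ * _ = mscale k (pushforward leb (fun x : measurableTypeR R =>
  a * x + b : measurableTypeR R)%R) A)//.
apply: lebesgue_measure_unique => //.
move=> _ [[l r]] _ <-.
change (leb `]l, r] =
  a%:E * leb ((fun x : measurableTypeR R => a * x + b)%R @^-1` `]l, r])).
have -> : (fun x : measurableTypeR R => a * x + b)%R @^-1` `]l, r] =
    (`](l - b) / a, (r - b) / a]%classic : set R)%R.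
  apply/seteqP; split => x /=; rewrite !in_itv/= ltr_pdivrMr// ler_pdivlMr//;
    by rewrite ltrBlDr lerBrDr mulrC.
rewrite !lebesgue_measure_itv/= !lte_fin ltr_pM2r ?invr_gt0// ltrD2r.
case: ifPn => // _; last by rewrite mule0.
rewrite -!EFinB -EFinM -mulrBl; congr (_%:E).
by rewrite mulrCA divff ?gt_eqF// mulr1; ring.
Qed.

Lemma ge0_integral_affine (a b : R) (f : measurableTypeR R -> \bar R) : a != 0%R ->
  measurable_fun setT f -> (forall x, 0 <= f x) ->
  \int[leb]_x f x = `|a|%:E * \int[leb]_x f (a * x + b)%R.
Proof.
have pos (c : R) (g : measurableTypeR R -> \bar R) : (0 < c)%R ->
    measurable_fun setT g -> (forall x, 0 <= g x) ->
    \int[leb]_x g x = c%:E * \int[leb]_x g (c * x + b)%R.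
  move=> c0 mg g0; have c0' : (0 <= c)%R := ltW c0.
  have mf := measurable_affine c b.
  rewrite -[X in X%:E]/((NngNum c0')%:num).
  rewrite -(@ge0_integral_pushforward _ _ _ _ _ _ mf leb setT g)//.
  rewrite -ge0_integral_mscale//.
  by apply: eq_measure_integral => A mA _; exact: lebesgue_affine_gt0.
move=> a0 mf f0; have [a_lt0|a_gt0|aE] := ltgtP a 0%R.
- have mg : measurable_fun setT (fun x : measurableTypeR R => f (a * x + b)%R).
    exact: (measurableT_comp mf (measurable_affine a b)).
  rewrite ltr0_norm// (pos (- a)%R)//; last by rewrite oppr_gt0.
  congr (_ * _).
  rewrite (eq_measure_integral (pushforward leb (-%R : measurableTypeR R -> measurableTypeR R))).
    rewrite ge0_integral_pushforward//.
      by apply: eq_integral => x _ /=; rewrite mulrNN.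
    by apply: (measurableT_comp mf); exact: measurable_affine.
  by move=> A mA _; exact/esym/lebesgue_measureN.
- by rewrite gtr0_norm//; exact: pos.
- by rewrite aE eqxx in a0.
Qed.

End affine_line.

Section tuple_coordinates.
Context {R : realType}.

Definition tcons d (t : measurableTypeR R) (y : d.-tuple R) : d.+1.-tuple R :=
  [tuple of t :: y].

Definition tbehead d (x : d.+1.-tuple R) : d.-tuple R := [tuple of behead x].

Lemma tbehead_tcons d t (y : d.-tuple R) : tbehead (tcons t y) = y.
Proof. exact/val_inj. Qed.

Lemma thead_tcons d t (y : d.-tuple R) : thead (tcons t y) = t.
Proof. by []. Qed.

Lemma tcons_thead d (x : d.+1.-tuple R) : tcons (thead x) (tbehead x) = x.
Proof. by rewrite [RHS]tuple_eta; apply/val_inj. Qed.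

Lemma measurable_tcons d :
  measurable_fun setT (fun xy : measurableTypeR R * d.-tuple R => tcons xy.1 xy.2).
Proof. by apply: measurable_cons => //; exact: measurable_fst. Qed.

Lemma measurable_tcons_comp d d' (T : measurableType d')
    (f : T -> measurableTypeR R) (g : T -> d.-tuple R) :
  measurable_fun setT f -> measurable_fun setT g ->
  measurable_fun setT (fun x => tcons (f x) (g x)).
Proof. by move=> mf mg; apply: measurable_cons. Qed.

Lemma measurable_thead d :
  measurable_fun setT (fun x : d.+1.-tuple R => thead x : measurableTypeR R).
Proof. exact: measurable_tnth. Qed.

Lemma measurable_tbehead d : measurable_fun setT (@tbehead d).
Proof. exact: measurable_behead. Qed.

Definition rv d (x : d.-tuple R) : 'rV[R]_d := \row_i tnth x i.

Definition tv d (v : 'rV[R]_d) : d.-tuple R := [tuple v 0 i | i < d].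

Lemma rvK d : cancel (@rv d) (@tv d).
Proof. by move=> x; apply: eq_from_tnth => i; rewrite tnth_mktuple mxE. Qed.

Lemma tvK d : cancel (@tv d) (@rv d).
Proof. by move=> v; apply/rowP => i; rewrite mxE tnth_mktuple. Qed.

Lemma rv_tcons d t (y : d.-tuple R) :
  rv (tcons t y) = row_mx (t%:M : 'rV_1) (rv y) :> 'rV_(1 + d).
Proof.
apply/rowP => i; rewrite !mxE; case: splitP => j ij.
  by rewrite !mxE ord1 eqxx mulr1n (_ : i = ord0)//; apply/val_inj; rewrite /= ij ord1.
rewrite !mxE (_ : i = lift ord0 j) ?tnthS//.
by apply/val_inj; rewrite /= ij.
Qed.

Lemma measurable_rv d' (T : measurableType d') d (f : T -> d.-tuple R) i :
  measurable_fun setT f -> measurable_fun setT (fun x => rv (f x) 0 i).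
Proof.
move=> mf; under eq_fun do rewrite mxE.
exact: (measurableT_comp (measurable_tnth i)).
Qed.

Lemma measurable_tv d' (T : measurableType d') d (f : T -> 'rV[R]_d) :
  (forall i, measurable_fun setT (fun x => f x 0 i)) ->
  measurable_fun setT (fun x => tv (f x)).
Proof.
move=> mf; apply/measurable_fun_tnthP => i.
by rewrite (_ : _ \o _ = fun x => f x 0 i)//; apply/funext => x /=; rewrite tnth_mktuple.
Qed.

Lemma measurable_mulmx d' (T : measurableType d') p q (f : T -> 'rV[R]_p)
    (M : 'M[R]_(p, q)) :
  (forall i, measurable_fun setT (fun x => f x 0 i)) ->
  forall j, measurable_fun setT (fun x => (f x *m M) 0 j).
Proof.
move=> mf j; under eq_fun do rewrite mxE.
by apply: measurable_sum => k; exact: measurable_funM.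
Qed.

End tuple_coordinates.

Section lebesgue_tuple_change_of_variables.
Local Open Scope ereal_scope.
Context {R : realType}.
Local Notation leb := (@lebesgue_measure R).

Section cons.
Variables (d : nat) (f : d.+1.-tuple R -> \bar R).
Hypotheses (mf : measurable_fun setT f) (f0 : forall x, 0 <= f x).

Let mg : measurable_fun setT
  (fun xy : measurableTypeR R * d.-tuple R => f (tcons xy.1 xy.2)).
Proof. exact: (measurableT_comp mf (@measurable_tcons R d)). Qed.

Let integral_prod :
  \int[lebesgue_tuple R d.+1]_x f x =
  \int[leb \x lebesgue_tuple R d]_xy f (tcons xy.1 xy.2).
Proof.
by rewrite -(@ge0_integral_pushforward _ _ _ _ _ _ (@measurable_tcons R d) _ setT f).
Qed.

Lemma integral_lebesgue_tuple1 : \int[lebesgue_tuple R d.+1]_x f x =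
  \int[leb]_t \int[lebesgue_tuple R d]_y f (tcons t y).
Proof. by rewrite integral_prod fubini_tonelli1. Qed.

Lemma integral_lebesgue_tuple2 : \int[lebesgue_tuple R d.+1]_x f x =
  \int[lebesgue_tuple R d]_y \int[leb]_t f (tcons t y).
Proof. by rewrite integral_prod fubini_tonelli2. Qed.

End cons.

Lemma integral_lebesgue_tuple0 (f : 0.-tuple R -> \bar R) :
  measurable_fun setT f ->
  \int[lebesgue_tuple R 0]_x f x = f [tuple].
Proof. by move=> mf; rewrite integral_dirac// diracT mul1e. Qed.

Lemma measurable_addv d' (T : measurableType d') d (f g : T -> 'rV[R]_d) :
  (forall i, measurable_fun setT (fun x => f x 0%R i)) ->
  (forall i, measurable_fun setT (fun x => g x 0%R i)) ->
  forall i, measurable_fun setT (fun x => (f x + g x)%R 0%R i).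
Proof.
by move=> mf mg i; under eq_fun do rewrite mxE; exact: measurable_funD.
Qed.

Lemma lebesgue_tuple_translation d (b : 'rV[R]_d) (f : d.-tuple R -> \bar R) :
  measurable_fun setT f -> (forall x, 0 <= f x) ->
  \int[lebesgue_tuple R d]_x f x =
  \int[lebesgue_tuple R d]_x f (tv (b + rv x)%R).
Proof.
elim: d b f => [|d IH] b f mf f0.
  by apply: eq_integral => x _; rewrite (tuple0 x) [in RHS](tuple0 (tv _)).
have mt : measurable_fun setT (fun x : d.+1.-tuple R => tv (b + rv x)%R).
  apply: measurable_tv; apply: measurable_addv => // i; exact: measurable_rv.
rewrite integral_lebesgue_tuple1// integral_lebesgue_tuple1//; last first.
  exact: (measurableT_comp mf).
have mfc : measurable_fun setT
    (fun xy : measurableTypeR R * d.-tuple R => f (tcons xy.1 xy.2)).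
  exact: (measurableT_comp mf (@measurable_tcons R d)).
rewrite (@ge0_integral_affine R 1 (b 0 0)%R) ?oner_eq0//; last 2 first.
- exact: (@measurable_fun_fubini_tonelli_F _ _ _ _ R (lebesgue_tuple R d) _ mfc).
- by move=> x; exact: integral_ge0.
rewrite normr1 mul1e; apply: eq_integral => t _.
rewrite (IH (\row_i b 0 (lift 0 i))%R)//; last first.
  by apply: (measurableT_comp mf); exact: measurable_tcons_comp.
apply: eq_integral => y _; congr f; apply: eq_from_tnth => i.
rewrite tnth_mktuple !mxE; case: (unliftP ord0 i) => [j ->|->].
  by rewrite !tnthS tnth_mktuple !mxE.
by rewrite /= !tnth0 mul1r addrC.
Qed.

End lebesgue_tuple_change_of_variables.

Section lebesgue_tuple_linear.
Local Open Scope ereal_scope.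
Context {R : realType}.
Local Notation leb := (@lebesgue_measure R).

Lemma measurable_tv_mulmx d' (T : measurableType d') p q (f : T -> p.-tuple R)
    (M : 'M[R]_(p, q)) :
  measurable_fun setT f -> measurable_fun setT (fun x => tv (rv (f x) *m M)%R).
Proof.
move=> mf; apply: measurable_tv; apply: measurable_mulmx => i.
exact: measurable_rv.
Qed.

Lemma measurable_tv_affine d' (T : measurableType d') p q (f : T -> p.-tuple R)
    (m : 'rV[R]_q) (M : 'M[R]_(p, q)) :
  measurable_fun setT f ->
  measurable_fun setT (fun x => tv (m + rv (f x) *m M)%R).
Proof.
move=> mf; apply: measurable_tv; apply: measurable_addv; first by move=> i.
by apply: measurable_mulmx => i; exact: measurable_rv.
Qed.

Lemma tv_row_mx d (s : 'M[R]_1) (v : 'rV[R]_d) :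
  tv (row_mx s v : 'rV_d.+1) = tcons (s 0%R 0%R) (tv v).
Proof.
apply: (can_inj (@rvK R d.+1)); rewrite tvK rv_tcons tvK.
by rewrite -mx11_scalar.
Qed.

(** The constant is the inverse of the absolute value of the determinant. It is left abstract
    because it cancels in the normalization of the Gaussian. *)
Definition scales_lebesgue d (M : 'M[R]_d) := exists2 c : R, (0 < c)%R &
  forall f : d.-tuple R -> \bar R, measurable_fun setT f -> (forall x, 0 <= f x) ->
  \int[lebesgue_tuple R d]_x f (tv (rv x *m M)%R) =
  c%:E * \int[lebesgue_tuple R d]_x f x.

(** Translating the first coordinate by [a^-1 * (y c)] removes the block [c] and turns [D] into its
    Schur complement. What remains is, for each [t], a linear change and a translation in [y],
    followed by a dilation in [t]. *)
Lemma scales_lebesgue_block d (a : R) (b : 'rV[R]_d) (c : 'cV[R]_d) (D : 'M[R]_d) :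
  a != 0%R -> scales_lebesgue (D - a^-1 *: (c *m b))%R ->
  scales_lebesgue (block_mx a%:M b c D : 'M[R]_(1 + d))%R.
Proof.
move=> a0; set D' := (D - _)%R => -[k k0 kE].
exists (k / `|a|)%R; first by rewrite divr_gt0// normr_gt0.
move=> f mf f0.
have mfc : measurable_fun setT
    (fun xy : measurableTypeR R * d.-tuple R => f (tcons xy.1 xy.2)).
  exact: (measurableT_comp mf (@measurable_tcons R d)).
pose G (ty : measurableTypeR R * d.-tuple R) :=
  f (tcons (ty.1 * a)%R (tv (ty.1 *: b + rv ty.2 *m D')%R)).
have mG : measurable_fun setT G.
  apply: (measurableT_comp mf); apply: measurable_tcons_comp.
    exact: (measurable_funM measurable_fst).
  apply: measurable_tv; apply: measurable_addv => i; last first.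
    by apply: measurable_mulmx => j; apply: measurable_rv; exact: measurable_snd.
  under eq_fun do rewrite mxE.
  exact: (measurable_funM measurable_fst).
have G0 x : 0 <= G x by exact: f0.
rewrite integral_lebesgue_tuple2//; last first.
  by apply: (measurableT_comp mf); exact: measurable_tv_mulmx.
transitivity (\int[lebesgue_tuple R d]_y \int[leb]_t G (t, y)).
  apply: eq_integral => y _.
  rewrite [RHS](@ge0_integral_affine R 1 (a^-1 * (rv y *m c) 0 0)%R) ?oner_eq0//; last first.
    have mp : measurable_fun setT (fun t : measurableTypeR R => (t, y)).
      exact: measurable_fun_pair.
    exact: (measurableT_comp mG mp).
  rewrite normr1 mul1e; apply: eq_integral => t _; rewrite /G/=; congr f.
  rewrite rv_tcons mul_row_block tv_row_mx mul1r; congr (tcons _ (tv _)).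
    by rewrite -scalar_mxM !mxE eqxx mulr1n mulrDl mulrAC mulVf// mul1r.
  rewrite mul_scalar_mx scalerDl /D' mulmxBr -scalemxAr mulmxA.
  rewrite [X in (_ *: (X *m b))%R]mx11_scalar mul_scalar_mx scalerA.
  by rewrite -addrA; congr (_ + _)%R; rewrite addrC subrK.
rewrite -[LHS](@fubini_tonelli2 _ _ _ _ R leb (lebesgue_tuple R d) G)//.
rewrite fubini_tonelli1// [in RHS]integral_lebesgue_tuple1//.
rewrite [in RHS](@ge0_integral_affine R a 0%R)//; last 2 first.
- exact: (@measurable_fun_fubini_tonelli_F _ _ _ _ R (lebesgue_tuple R d) _ mfc).
- by move=> x; exact: integral_ge0.
rewrite muleA -EFinM divfK ?normr_eq0//.
rewrite -ge0_integralZl_EFin//; last 3 first.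
- by move=> x _; exact: integral_ge0.
- apply: (measurableT_comp (f := fun t => \int[lebesgue_tuple R d]_y f (tcons t y))).
    exact: (@measurable_fun_fubini_tonelli_F _ _ _ _ R (lebesgue_tuple R d) _ mfc).
  exact: measurable_affine.
- exact: ltW.
apply: eq_integral => t _; rewrite /fubini_F /G/=.
have mft (u : R) : measurable_fun setT (fun y : d.-tuple R => f (tcons u y)).
  by apply: (measurableT_comp mf); exact: measurable_tcons_comp.
under eq_integral do rewrite -[(rv _ *m D')%R]tvK.
rewrite (kE (fun y => f (tcons (t * a)%R (tv (t *: b + rv y)%R))))//; last first.
  apply: (measurableT_comp mf); apply: measurable_tcons_comp => //.
  apply: measurable_tv; apply: measurable_addv => // i.
  exact: measurable_rv.
by rewrite addr0 mulrC -(@lebesgue_tuple_translation R d (t *: b)%R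
    (fun y => f (tcons (a * t)%R y))).
Qed.

End lebesgue_tuple_linear.

Section lebesgue_tuple_unitmx.
Context {R : realType}.

Lemma scales_lebesgue1 d : scales_lebesgue (1%:M : 'M[R]_d).
Proof.
exists 1%R => // f mf f0; rewrite mul1e; apply: eq_integral => x _.
by rewrite mulmx1 rvK.
Qed.

Lemma unitmx_schur d (a : R) (b : 'rV[R]_d) (c : 'cV[R]_d) (D : 'M[R]_d) :
  a != 0%R -> (block_mx a%:M b c D)%R \in unitmx ->
  (D - a^-1 *: (c *m b))%R \in unitmx.
Proof.
move=> a0; set D' := (D - _)%R.
have -> : (block_mx a%:M b c D =
    block_mx 1%:M 0 (a^-1 *: c) 1%:M *m block_mx a%:M b 0 D')%R.
  rewrite mulmx_block !mul1mx !mul0mx !addr0; congr block_mx.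
    by rewrite -scalemxAl mul_mx_scalar scalerA mulVf// scale1r.
  by rewrite -scalemxAl /D' addrC subrK.
by rewrite unitmx_mul unitmxE det_lblock det_scalar1 mul1r det1 unitr1/=
  unitmxE det_ublock unitrM => /andP[].
Qed.

(** Gaussian elimination: the Schur complement lowers the dimension, and a shear produces a pivot
    when the corner entry vanishes. *)
Lemma scales_lebesgue_unitmx d (M : 'M[R]_d) : M \in unitmx -> scales_lebesgue M.
Proof.
elim: d M => [|d IH] M uM.
  exists 1%R => // f mf f0; rewrite mul1e; apply: eq_integral => x _.
  by rewrite (tuple0 x) [in LHS](tuple0 (tv _)).
have pivot (N : 'M[R]_(1 + d)) : N \in unitmx -> N 0%R 0%R != 0%R ->
    scales_lebesgue N.
  move=> uN N0; have NE : (N = block_mx (N 0 0)%:M (ursubmx N) (dlsubmx N) (drsubmx N))%R.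
    rewrite -[LHS]submxK; congr block_mx; rewrite [LHS]mx11_scalar !mxE.
    by congr ((N _ _)%:M); exact/val_inj.
  rewrite NE; apply: scales_lebesgue_block => //.
  by apply: IH; apply: unitmx_schur => //; rewrite -NE.
have [M0|] := eqVneq (M 0%R 0%R) 0%R; last exact: pivot.
have [k Mk] : exists k : 'I_d, M (rshift 1 k) 0%R != 0%R.
  apply: contrapT => /forallNP M0k.
  have : col 0 (M : 'M[R]_(1 + d)) = 0%R.
    apply/colP => i; rewrite !mxE; case: (split_ordP i) => j ->.
      by rewrite ord1 -[RHS]M0; congr (M _ _); exact/val_inj.
    by have /negP/negPn/eqP := M0k j.
  move=> /(congr1 (mulmx (invmx M))); rewrite mulmx0 colE mulmxA mulVmx// mul1mx.
  by move=> /colP/(_ 0%R)/eqP; rewrite !mxE/= oner_eq0.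
(* Left multiplication by [S] adds a row with nonzero first entry to row 0. Both [S] and [S *m M]
   scale Lebesgue measure, hence so does [M], by the ratio of the constants. *)
pose S : 'M[R]_(1 + d) := block_mx (1%R)%:M (delta_mx 0%R k) 0%R (1%:M).
have [s s0 sE] : scales_lebesgue S.
  apply: scales_lebesgue_block; rewrite ?oner_eq0// mul0mx scaler0 subr0.
  exact: scales_lebesgue1.
have uS : S \in unitmx by rewrite unitmxE det_ublock !det1 mulr1 unitr1.
have [t t0 tE] : scales_lebesgue (S *m M)%R.
  apply: pivot; first by rewrite unitmx_mul uS.
  suff -> : (S *m M) 0%R 0%R = M (rshift 1 k) 0%R by [].
  rewrite mxE (@big_split_ord _ _ _ 1 d) big_ord1 /=.
  rewrite (_ : lshift d 0 = 0) ?M0 ?mulr0 ?add0r; last exact/val_inj.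
  have S0 j : S 0 (rshift 1 j) = (j == k)%:R.
    rewrite [X in S X _](_ : _ = @lshift 1 d 0); last exact/val_inj.
    by rewrite block_mxEur mxE eqxx.
  rewrite (bigD1 k)//= big1 ?addr0 => [|j jk]; first by rewrite S0 eqxx mul1r.
  by rewrite S0 (negbTE jk) mul0r.
exists (t / s)%R; first by rewrite divr_gt0.
move=> f mf f0.
have mg : measurable_fun setT (fun x => f (tv (rv x *m M))).
  by apply: (measurableT_comp mf); exact: measurable_tv_mulmx.
have := sE _ mg (fun x => f0 _).
under eq_integral do rewrite tvK -mulmxA.
rewrite tE// => /(congr1 (mule (s^-1)%:E)).
rewrite !muleA -!EFinM mulVf ?gt_eqF// mul1e => <-.
by rewrite mulrC.
Qed.

End lebesgue_tuple_unitmx.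

(** * Gaussian laws as affine images of the standard normal law *)

Section gaussian_affine.
Context {R : realType}.
Local Notation leb := (@lebesgue_measure R).
Local Notation N01 := (normal_prob (0 : R) 1 : probability (measurableTypeR R) R).

Definition stdgauss (d : nat) : probability (d.-tuple R) R :=
  gaussian (0 : 'rV[R]_d) 1%:M.

Lemma measurable_gauss_kernel d (m : 'rV[R]_d) (S : 'M[R]_d) :
  measurable_fun setT (gauss_kernel m S).
Proof.
have mv i : measurable_fun setT (fun x : d.-tuple R => (rv x - m) 0 i).
  by apply: measurable_addv => // j; exact: measurable_rv.
apply: measurableT_comp => //; apply: measurable_funM => //.
apply: measurableT_comp => //; under eq_fun do rewrite mxE.
apply: measurable_sum => j; apply: measurable_funM.
  by apply: measurable_mulmx => i; exact: mv.
by under eq_fun do rewrite mxE; exact: mv.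
Qed.

Lemma gauss_kernel_ge0 d (m : 'rV[R]_d) (S : 'M[R]_d) x : 0 <= gauss_kernel m S x.
Proof. exact: expR_ge0. Qed.

Lemma gauss_kernel_affine d (m : 'rV[R]_d) (L : 'M[R]_d) z : L \in unitmx ->
  gauss_kernel m (L^T *m L) (tv (m + rv z *m L)) = gauss_kernel 0 1%:M z.
Proof.
move=> uL; rewrite /gauss_kernel -!/(rv _) tvK subr0 addrC addKr.
have uLT : L^T \in unitmx by rewrite unitmx_tr.
have -> : invmx (L^T *m L) = invmx L *m invmx L^T.
  apply: (can_inj (mulmxK (_ : L^T *m L \in unitmx))).
    by rewrite unitmx_mul uLT.
  rewrite mulVmx ?unitmx_mul ?uLT// mulmxA -(mulmxA _ (invmx _)) mulVmx//.
  by rewrite mulmx1 mulVmx.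
by rewrite trmx_mul !mulmxA mulmxK// -(mulmxA (rv z)) mulVmx// invmx1.
Qed.

Lemma stdgauss_kernel_tcons d (t : R) (y : d.-tuple R) :
  gauss_kernel 0 1%:M (tcons t y) = expR (- t ^+ 2 / 2) * gauss_kernel 0 1%:M y.
Proof.
rewrite /gauss_kernel -!/(rv _) !subr0 !invmx1 !mulmx1 -expRD; congr expR.
rewrite rv_tcons (@tr_row_mx _ 1 1 d) (@mul_row_col _ 1 1 d 1) mxE tr_scalar_mx -scalar_mxM.
by rewrite !mxE eqxx mulr1n expr2 opprD mulrDl.
Qed.

Lemma normal_pdf01E (t : R) :
  normal_pdf 0 1 t = normal_peak 1 * expR (- t ^+ 2 / 2).
Proof. by rewrite normal_pdfE ?oner_eq0// /normal_fun subr0 expr1n. Qed.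

Lemma has_density_normal : has_density N01 leb (normal_pdf (0 : R) 1).
Proof.
by split => //; [exact: measurable_normal_pdf|move=> x; exact: normal_pdf_ge0].
Qed.

Lemma integral_expR_half :
  (\int[leb]_t (expR (- t ^+ 2 / 2))%:E = (normal_peak (1 : R))^-1%:E)%E.
Proof.
have p0 : 0 < normal_peak (1 : R) by rewrite normal_peak_gt0 ?oner_eq0.
have := integral_normal_pdf (0 : R) 1; under eq_integral do rewrite normal_pdf01E EFinM.
rewrite ge0_integralZl_EFin//; last 2 first.
- apply/measurable_EFinP; apply: measurableT_comp => //.
  by apply: measurable_funM => //; apply: measurableT_comp => //; exact: measurable_funX.
- exact: ltW.
move=> /(congr1 (mule (normal_peak 1)^-1%:E)).
by rewrite muleA -EFinM mulVf ?gt_eqF// mul1e mule1.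
Qed.

(** This is $(2\pi)^{d/2}$, the mass of the unnormalized standard kernel. *)
Definition stdmass d : R := (normal_peak (1 : R))^-1 ^+ d.

Lemma stdmass_gt0 d : 0 < stdmass d.
Proof. by rewrite exprn_gt0// invr_gt0 normal_peak_gt0 ?oner_eq0. Qed.

Lemma integral_stdgauss_kernel d :
  (\int[lebesgue_tuple R d]_x (gauss_kernel 0 1%:M x)%:E = (stdmass d)%:E)%E.
Proof.
elim: d => [|d IH].
  rewrite integral_lebesgue_tuple0; last first.
    by apply/measurable_EFinP; exact: measurable_gauss_kernel.
  by rewrite /gauss_kernel mxE big_ord0 oppr0 mul0r expR0.
rewrite integral_lebesgue_tuple1; last 2 first.
- by apply/measurable_EFinP; exact: measurable_gauss_kernel.
- by move=> x; rewrite lee_fin gauss_kernel_ge0.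
rewrite (eq_integral (fun t : measurableTypeR R => (expR (- t ^+ 2 / 2))%:E *
  (stdmass d)%:E)%E); last first.
  move=> t _; rewrite -IH -ge0_integralZl_EFin ?expR_ge0//; last 2 first.
  - by move=> x _; rewrite lee_fin gauss_kernel_ge0.
  - by apply/measurable_EFinP; exact: measurable_gauss_kernel.
  by apply: eq_integral => y _; rewrite stdgauss_kernel_tcons EFinM.
rewrite ge0_integralZr//; last 2 first.
- apply/measurable_EFinP; apply: measurableT_comp => //.
  by apply: measurable_funM => //; apply: measurableT_comp => //; exact: measurable_funX.
- by rewrite lee_fin ltW// stdmass_gt0.
by rewrite integral_expR_half -EFinM /stdmass exprS.
Qed.

(** A kernel of finite positive mass [c] keeps [mnormalize] away from its default value. *)
Lemma gaussian_has_density d (m : 'rV[R]_d) (S : 'M[R]_d) (c : R) : 0 < c ->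
  (\int[lebesgue_tuple R d]_x (gauss_kernel m S x)%:E = c%:E)%E ->
  has_density (gaussian m S) (lebesgue_tuple R d)
    (fun x => c^-1 * gauss_kernel m S x).
Proof.
move=> c0 cE; split.
- by apply: measurable_funM => //; exact: measurable_gauss_kernel.
- by move=> x; rewrite mulr_ge0 ?gauss_kernel_ge0// invr_ge0 ltW.
move=> A mA; rewrite /gaussian /= /mnormalize.
rewrite [X in X == 0%E](_ : _ = c%:E); last exact: cE.
rewrite [X in X == +oo%E](_ : _ = c%:E); last exact: cE.
rewrite [X in fine X](_ : _ = c%:E); last exact: cE.
rewrite eqe gt_eqF//= muleC; under [RHS]eq_integral do rewrite EFinM.
rewrite ge0_integralZl_EFin//.
- by move=> x _; rewrite lee_fin gauss_kernel_ge0.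
- by apply/measurable_EFinP/measurable_funTS; exact: measurable_gauss_kernel.
- by rewrite invr_ge0 ltW.
Qed.

Lemma stdgauss_density d : has_density (stdgauss d) (lebesgue_tuple R d)
  (fun x => (stdmass d)^-1 * gauss_kernel 0 1%:M x).
Proof.
apply: gaussian_has_density; first exact: stdmass_gt0.
exact: integral_stdgauss_kernel.
Qed.

(** The affine map pulls the kernel of N(m, L^T L) back to the standard kernel. The Jacobian
    constant appears both in the integral and in the total mass of the kernel, so it cancels. *)
Lemma ge0_integral_gaussian d (m : 'rV[R]_d) (L : 'M[R]_d)
    (f : d.-tuple R -> \bar R) : L \in unitmx ->
  measurable_fun setT f -> (forall x, 0 <= f x)%E ->
  (\int[gaussian m (L^T *m L)]_x f x =
   \int[stdgauss d]_z f (tv (m + rv z *m L)))%E.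
Proof.
move=> uL mf f0; have [c c0 cE] := scales_lebesgue_unitmx uL.
have affE (g : d.-tuple R -> \bar R) : measurable_fun setT g ->
    (forall x, 0 <= g x)%E ->
    (\int[lebesgue_tuple R d]_z g (tv (m + rv z *m L)) =
     c%:E * \int[lebesgue_tuple R d]_x g x)%E.
  move=> mg g0; rewrite (lebesgue_tuple_translation m mg g0) -cE//.
    by apply: eq_integral => z _; rewrite tvK.
  apply: (measurableT_comp mg); apply: measurable_tv; apply: measurable_addv => // i.
  exact: measurable_rv.
have mk (S : 'M[R]_d) (v : 'rV[R]_d) : measurable_fun setT (EFin \o gauss_kernel v S).
  by apply/measurable_EFinP; exact: measurable_gauss_kernel.
have kE : (\int[lebesgue_tuple R d]_x (gauss_kernel m (L^T *m L) x)%:E =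
    (c^-1 * stdmass d)%:E)%E.
  have := affE _ (mk (L^T *m L) m) (fun x => gauss_kernel_ge0 m _ x).
  under eq_integral do rewrite /= gauss_kernel_affine//.
  rewrite integral_stdgauss_kernel => /(congr1 (mule c^-1%:E)) /=.
  by rewrite muleA -!EFinM mulVf ?gt_eqF// mul1e => <-.
have c1 : 0 < c^-1 * stdmass d by rewrite mulr_gt0 ?stdmass_gt0// invr_gt0.
rewrite [LHS](has_density_integral (gaussian_has_density c1 kE) mf f0).
have mfa : measurable_fun setT (fun z => f (tv (m + rv z *m L))).
  by apply: (measurableT_comp mf); exact: measurable_tv_affine.
rewrite [RHS](has_density_integral (stdgauss_density d) mfa (fun x => f0 _)).
set h := (fun x => (f x * (gauss_kernel m (L^T *m L) x)%:E)%E).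
have mh : measurable_fun setT h.
  by apply: emeasurable_funM => //; exact: mk.
have h0 x : (0 <= h x)%E by rewrite mule_ge0// lee_fin gauss_kernel_ge0.
transitivity ((c / stdmass d)%:E * \int[lebesgue_tuple R d]_x h x)%E.
  rewrite -ge0_integralZl_EFin//; last first.
    by rewrite divr_ge0 ?(ltW (stdmass_gt0 d))// ltW.
  by apply: eq_integral => x _; rewrite /h EFinM muleCA invfM invrK.
rewrite mulrC EFinM -muleA -affE// -ge0_integralZl_EFin//; last 2 first.
- by apply: (measurableT_comp mh); exact: measurable_tv_affine.
- by rewrite invr_ge0 (ltW (stdmass_gt0 d)).
by apply: eq_integral => x _; rewrite /h EFinM muleCA gauss_kernel_affine.
Qed.

Lemma ge0_integral_stdgauss_tcons d (f : d.+1.-tuple R -> \bar R) :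
  measurable_fun setT f -> (forall x, 0 <= f x)%E ->
  (\int[stdgauss d.+1]_x f x =
   \int[N01]_t \int[stdgauss d]_y f (tcons t y))%E.
Proof.
move=> mf f0; rewrite [LHS](has_density_integral (stdgauss_density d.+1) mf f0).
have mfc : measurable_fun setT
    (fun xy : measurableTypeR R * d.-tuple R => f (tcons xy.1 xy.2)).
  exact: (measurableT_comp mf (@measurable_tcons R d)).
rewrite [RHS](has_density_integral has_density_normal); last 2 first.
- exact: (@measurable_fun_fubini_tonelli_F _ _ _ _ R (stdgauss d) _ mfc).
- by move=> t; exact: integral_ge0.
rewrite integral_lebesgue_tuple1//; last 2 first.
- apply: emeasurable_funM => //; apply/measurable_EFinP; apply: measurable_funM => //.
  exact: measurable_gauss_kernel.
- move=> x; rewrite mule_ge0// lee_fin mulr_ge0 ?gauss_kernel_ge0//.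
  by rewrite invr_ge0 (ltW (stdmass_gt0 _)).
apply: eq_integral => t _.
have mft : measurable_fun setT (fun y : d.-tuple R => f (tcons t y)).
  by apply: (measurableT_comp mf); exact: measurable_tcons_comp.
rewrite [in RHS](has_density_integral (stdgauss_density d) mft (fun x => f0 _)).
rewrite muleC -ge0_integralZl_EFin ?normal_pdf_ge0//; last 2 first.
- move=> y _; rewrite mule_ge0// lee_fin mulr_ge0 ?gauss_kernel_ge0//.
  by rewrite invr_ge0 (ltW (stdmass_gt0 _)).
- apply: emeasurable_funM => //; apply/measurable_EFinP; apply: measurable_funM => //.
  exact: measurable_gauss_kernel.
apply: eq_integral => y _; rewrite muleCA -EFinM; congr (_ * _%:E)%E.
rewrite stdgauss_kernel_tcons normal_pdf01E mulrACA; congr (_ * _).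
by rewrite /stdmass exprS invfM invrK.
Qed.

End gaussian_affine.

Section measure_equality.
Context d (T : measurableType d) (R : realType).

Lemma eq_measure_ge0_integral (P Q : {measure set T -> \bar R}) :
  (forall f : T -> \bar R, measurable_fun setT f -> (forall x, 0 <= f x)%E ->
    \int[P]_x f x = \int[Q]_x f x)%E ->
  forall A, measurable A -> P A = Q A.
Proof.
move=> PQ A mA.
have := PQ (fun x => (\1_A x)%:E); rewrite !integral_indic// !setIT; apply.
  by apply/measurable_EFinP.
by move=> x; rewrite lee_fin.
Qed.

End measure_equality.

Section gaussian_push.
Context {R : realType}.
Local Notation N01 := (normal_prob (0 : R) 1 : probability (measurableTypeR R) R).

Definition affine d (m : 'rV[R]_d) (L : 'M[R]_d) (z : d.-tuple R) : d.-tuple R :=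
  tv (m + rv z *m L).

Lemma measurable_affine_tuple d (m : 'rV[R]_d) (L : 'M[R]_d) :
  measurable_fun setT (affine m L).
Proof. exact: measurable_tv_affine. Qed.

Lemma gaussian_push d (m : 'rV[R]_d) (L : 'M[R]_d) : L \in unitmx ->
  forall A, measurable A ->
  gaussian m (L^T *m L) A = push (stdgauss d) (measurable_affine_tuple m L) A.
Proof.
move=> uL; apply: eq_measure_ge0_integral => f mf f0.
by rewrite [RHS](ge0_integral_push _ _ mf f0) [LHS](ge0_integral_gaussian _ uL mf f0).
Qed.

Lemma stdgauss_orthogonal d (U : 'M[R]_d) : U^T *m U = 1%:M ->
  forall A, measurable A ->
  stdgauss d A = push (stdgauss d) (measurable_affine_tuple 0 U) A.
Proof.
move=> UU A mA; have [_ uU] := mulmx1_unit UU.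
by rewrite -(gaussian_push 0 uU mA) UU.
Qed.

Lemma stdgauss_tcons d A : measurable A ->
  stdgauss d.+1 A = push (N01 \x stdgauss d)%E (@measurable_tcons R d) A.
Proof.
apply: eq_measure_ge0_integral => f mf f0.
rewrite [RHS](ge0_integral_push _ _ mf f0) [LHS](ge0_integral_stdgauss_tcons mf f0).
rewrite [RHS]fubini_tonelli1//.
exact: (measurableT_comp mf (@measurable_tcons R d)).
Qed.

End gaussian_push.

(** * Relative entropy *)

Section relative_entropy_function.
Context {R : realType}.

Definition kl_fun (r : R) : R := r * ln r - r + 1.

(** Convexity: the graph lies above its tangent at [p], of slope [ln p]. For [r > 0] it reduces to
    [ln x <= x - 1] at [x = p / r]; at [r = 0] the product [r * ln r] vanishes and
    [kl_fun 0 = 1]. *)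
Lemma kl_fun_tangent (p r : R) : 0 < p -> 0 <= r ->
  kl_fun p + (r - p) * ln p <= kl_fun r.
Proof.
move=> p0; rewrite le_eqVlt /kl_fun => /predU1P[<-|r0]; first by rewrite mul0r; lra.
suff : r - p <= r * (ln r - ln p) by lra.
have -> : ln r - ln p = - ln (p / r) by rewrite ln_div// ?posrE//; lra.
have := @le_ln1Dx R (p / r - 1); rewrite [1 + _]addrC subrK => H.
have {}H : ln (p / r) <= p / r - 1 by apply: H; rewrite ltrBDr addrC subrr divr_gt0.
have : r * ln (p / r) <= r * (p / r - 1) by rewrite ler_pM2l.
by rewrite mulrBr mulrCA divff ?gt_eqF//; lra.
Qed.

Lemma kl_fun_ge0 (r : R) : 0 <= r -> 0 <= kl_fun r.
Proof.
move=> r0; have := kl_fun_tangent ltr01 r0.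
by rewrite ln1 /kl_fun ln1; lra.
Qed.

Lemma kl_funM (c r : R) : 0 < c -> 0 <= r ->
  kl_fun (c * r) = c * kl_fun r + (c * ln c * r + (1 - c)).
Proof.
move=> c0; rewrite le_eqVlt /kl_fun => /predU1P[<-|r0]; first by ring.
by rewrite lnM ?posrE//; ring.
Qed.

(** The tangent at [expR h], read as Young's inequality for [kl_fun] and its convex conjugate. *)
Lemma kl_fun_young (r h : R) : 0 <= r -> r * h <= kl_fun r + expR h - 1.
Proof.
move=> r0; have := kl_fun_tangent (expR_gt0 h) r0.
by rewrite {1}/kl_fun expRK; lra.
Qed.

Lemma measurable_kl_fun d (T : measurableType d) (r : T -> R) :
  measurable_fun setT r -> measurable_fun setT (fun x => kl_fun (r x)).
Proof.
move=> mr; apply: measurable_funD => //; apply: measurable_funB => //.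
by apply: measurable_funM => //; exact: (measurableT_comp (@measurable_ln R)).
Qed.

End relative_entropy_function.

Lemma integral_cst_probability d (T : measurableType d) (R : realType)
  (P : probability T R) (c : \bar R) : (\int[P]_x c = c)%E.
Proof.
rewrite -[RHS]mule1 -(probability_setT P); exact: integral_cst.
Qed.

Section KL_theory.
Local Open Scope ereal_scope.
Context d (T : measurableType d) (R : realType).
Implicit Types (rho eta : {finite_measure set T -> \bar R}).

(** Two densities with the same integrals over measurable sets agree almost everywhere, so any
    version computes the divergence. *)
Lemma KLE rho eta r : has_density rho eta r ->
  KL rho eta = \int[eta]_x (kl_fun (r x))%:E.
Proof.
move=> rr; have re := has_density_dominates rr; have [mr r0 rhoE] := rr.
rewrite /KL; case: asboolP => // _.
have RNi := Radon_Nikodym_integrable (nu := charge_of_finite_measure rho) re.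
have mRN : measurable_fun setT
    (fine \o Radon_Nikodym (charge_of_finite_measure rho) eta).
  by apply: measurableT_comp => //; exact: measurable_int RNi.
apply: ae_eq_integral => //.
- by apply/measurable_EFinP; exact: (measurable_kl_fun mRN).
- by apply/measurable_EFinP; exact: measurable_kl_fun.
have : ae_eq eta setT (Radon_Nikodym (charge_of_finite_measure rho) eta)
    (EFin \o r).
  apply: integral_ae_eq => //.
    by apply/measurable_EFinP.
  move=> A _ mA; rewrite -Radon_Nikodym_integral//=.
  exact: rhoE.
by apply: filterS => x /(_ Logic.I) /= -> _.
Qed.

Lemma KL_finite_density rho eta : KL rho eta != +oo ->
  exists r, has_density rho eta r.
Proof.
by rewrite /KL; case: asboolP => // re _; exact: dominates_density.
Qed.

Lemma KL_ge0 rho eta : 0 <= KL rho eta.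
Proof.
have [->|/KL_finite_density[r rr]] := eqVneq (KL rho eta) +oo; first exact: leey.
rewrite (KLE rr); apply: integral_ge0 => x _; rewrite lee_fin kl_fun_ge0//.
by case: rr.
Qed.

Lemma KL_ext rho rho' eta eta' :
  (forall A, measurable A -> rho A = rho' A) ->
  (forall A, measurable A -> eta A = eta' A) ->
  KL rho eta = KL rho' eta'.
Proof.
move=> rhoE etaE.
have [+|/KL_finite_density[r rr]] := eqVneq (KL rho eta) +oo; last first.
  rewrite (KLE rr) (KLE (has_density_ext rhoE etaE rr)).
  by apply: eq_measure_integral => A mA _; exact: etaE.
have [-> //|/KL_finite_density[r rr]] := eqVneq (KL rho' eta') +oo.
have rr' : has_density rho eta r.
  by apply: has_density_ext rr => A mA; [exact/esym/rhoE|exact/esym/etaE].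
move=> _; rewrite (KLE rr) (KLE rr').
by apply: eq_measure_integral => A mA _; exact: etaE.
Qed.

Lemma has_density_scale (P Q : probability T R) rho eta (t a : R) r :
  (0 < a)%R -> (0 <= t)%R ->
  (forall A, measurable A -> rho A = t%:E * P A) ->
  (forall A, measurable A -> eta A = a%:E * Q A) ->
  has_density P Q r -> has_density rho eta (fun x => t / a * r x)%R.
Proof.
move=> a0 t0 rhoE etaE [mr r0 PE]; split.
- exact: measurable_funM.
- by move=> x; rewrite mulr_ge0// divr_ge0// ltW.
move=> A mA; rewrite rhoE// PE//.
have ha : (0 <= a)%R := ltW a0.
rewrite [in RHS](eq_measure_integral (mscale (NngNum ha) Q)); last first.
  by move=> B mB _; exact: etaE.
rewrite ge0_integral_mscale//; last 2 first.
- by apply/measurable_EFinP/measurable_funTS; exact: measurable_funM.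
- by move=> x _; rewrite lee_fin mulr_ge0// divr_ge0// ltW.
rewrite -!ge0_integralZl_EFin//.
- by apply: eq_integral => x _; rewrite -!EFinM mulrA mulrCA divff ?gt_eqF// mulr1.
- by move=> x _; rewrite lee_fin mulr_ge0// divr_ge0// ltW.
- by apply/measurable_EFinP/measurable_funTS; exact: measurable_funM.
- by move=> x _; rewrite lee_fin.
- by apply/measurable_EFinP/measurable_funTS.
Qed.

Lemma has_density_integral1 (P Q : probability T R) r :
  has_density P Q r -> \int[Q]_x (r x)%:E = 1.
Proof. by move=> [_ _ PE]; rewrite -PE// probability_setT. Qed.

Lemma ge0_integral_scale (Q : probability T R) eta (a : R) (f : T -> \bar R) :
  (0 <= a)%R -> (forall A, measurable A -> eta A = a%:E * Q A) ->
  measurable_fun setT f -> (forall x, 0 <= f x) ->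
  \int[eta]_x f x = a%:E * \int[Q]_x f x.
Proof.
move=> a0 etaE mf f0; rewrite (eq_measure_integral (mscale (NngNum a0) Q)).
  by rewrite ge0_integral_mscale.
by move=> A mA _; exact: etaE.
Qed.

Lemma KL_scale (P Q : probability T R) rho eta (t a : R) :
  (0 < a)%R -> (0 <= t)%R ->
  (forall A, measurable A -> rho A = t%:E * P A) ->
  (forall A, measurable A -> eta A = a%:E * Q A) ->
  KL rho eta = t%:E * KL P Q + (t * ln (t / a) - t + a)%:E.
Proof.
(* For [t = 0] the measure [rho] is null whatever [P] is; the convention [0 * +oo = 0] makes the
   formula hold even if [KL P Q] is infinite. *)
move=> a0 + rhoE etaE; rewrite le_eqVlt => /predU1P[tE|t0].
  have rr : has_density rho eta (cst 0%R).
    by split => // A mA; rewrite rhoE// -tE mul0e integral0.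
  rewrite (KLE rr) -tE !mul0e !add0e mul0r subr0 add0r.
  under eq_integral do rewrite /kl_fun mul0r subr0 add0r.
  rewrite integral_cst// mul1e; apply: (etrans (etaE _ measurableT)).
  by rewrite probability_setT mule1.
have ta0 : (0 < t / a)%R by rewrite divr_gt0.
have [PQ|nPQ] := pselect (P `<< Q); last first.
  have -> : KL P Q = +oo by rewrite /KL; case: asboolP.
  rewrite gt0_muley ?lte_fin// addye// /KL; case: asboolP => // re; case: nPQ.
  apply/null_content_dominatesP => A mA QA.
  have etaA : eta A = 0 by rewrite (etaE _ mA) QA mule0.
  move/null_content_dominatesP : re => /(_ A mA etaA) rhoA.
  have /eqP := etrans (esym (rhoE A mA)) rhoA.
  by rewrite mule_eq0 eqe gt_eqF//= => /eqP.
have [r rr] := dominates_density PQ; have [mr r0 PE] := rr.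
rewrite (KLE rr) (KLE (has_density_scale a0 (ltW t0) rhoE etaE rr)).
have mk := measurable_kl_fun mr.
have k0 x : (0 <= kl_fun (r x))%R by exact: kl_fun_ge0.
rewrite (ge0_integral_scale (ltW a0) etaE); last 2 first.
- apply/measurable_EFinP/measurable_kl_fun; exact: measurable_funM.
- by move=> x; rewrite lee_fin kl_fun_ge0// mulr_ge0// ltW.
pose h x := ((t / a * ln (t / a)) * r x + (1 - t / a))%R.
have ir : Q.-integrable setT (fun x => (t / a * ln (t / a))%:E * (r x)%:E).
  by apply: integrableZl => //; exact: has_density_integrable rr.
have i1 : Q.-integrable setT (EFin \o cst (1 - t / a)%R).
  exact: finite_measure_integrable_cst.
have ih : Q.-integrable setT (EFin \o h).
  have -> : EFin \o h = (fun x => (t / a * ln (t / a))%:E * (r x)%:E)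
    \+ (EFin \o cst (1 - t / a)%R).
    by apply/funext => x; rewrite /= /h EFinD EFinM.
  exact: integrableD.
have hE : \int[Q]_x (h x)%:E = (t / a * ln (t / a) + (1 - t / a))%:E.
  under eq_integral do rewrite /h EFinD EFinM.
  rewrite integralD// integralZl//; last exact: has_density_integrable rr.
  rewrite (has_density_integral1 rr) mule1.
  rewrite (integral_cst_probability Q).
  by rewrite EFinD.
rewrite (@ge0_integral_eq_addr _ _ _ Q _ (fun x => (t / a)%:E * (kl_fun (r x))%:E) h)//.
- rewrite hE ge0_integralZl_EFin//; last 3 first.
  + by move=> x _; rewrite lee_fin.
  + by apply/measurable_EFinP.
  + exact: ltW.
  have I0 : 0 <= \int[Q]_x (kl_fun (r x))%:E.
    by apply: integral_ge0 => x _; rewrite lee_fin.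
  rewrite muleDr// ?fin_num_adde_defl// muleA -EFinM mulrCA divff ?gt_eqF// mulr1.
  by rewrite -EFinM; congr (_ + _%:E); field; rewrite gt_eqF.
- apply/measurable_EFinP/measurable_kl_fun; exact: measurable_funM.
- by move=> x; rewrite lee_fin kl_fun_ge0// mulr_ge0// ltW.
- by apply/measurable_EFinP; exact: measurable_funM.
- by move=> x; rewrite -EFinM lee_fin mulr_ge0// ltW.
- by move=> x; rewrite -EFinM -EFinD /h kl_funM.
Qed.

End KL_theory.

Section KL_young.
Local Open Scope ereal_scope.
Context d (T : measurableType d) (R : realType).
Variables (P Q : probability T R).

Lemma KL_self : KL P P = 0.
Proof.
have PP : has_density P P (cst 1%R).
  by split => // A mA; exact: esym (etrans (integral_cst P mA 1) (mul1e _)).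
rewrite (KLE PP) -[RHS](integral_cst_probability P).
by apply: eq_integral => x _; rewrite /kl_fun ln1 mulr0 sub0r addNr.
Qed.

(** A linearized Donsker-Varadhan bound: [kl_fun_young] with exponent [g - h], integrated. Keeping
    [g] and [h] apart and nonnegative gives every integral a meaning in [0, +oo]. Taking [h = 0]
    bounds moments by entropy; taking [g] constant gives a lower bound on the integral of [h]. *)
Lemma KL_young (g h : T -> R) :
  measurable_fun setT g -> (forall x, 0 <= g x)%R ->
  measurable_fun setT h -> (forall x, 0 <= h x)%R ->
  \int[P]_x (g x)%:E <=
  KL P Q + \int[P]_x (h x)%:E + \int[Q]_x (expR (g x - h x))%:E.
Proof.
move=> mg g0 mh h0.
have e0 : 0 <= \int[Q]_x (expR (g x - h x))%:E.
  by apply: integral_ge0 => x _; rewrite lee_fin expR_ge0.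
have hP0 : 0 <= \int[P]_x (h x)%:E.
  by apply: integral_ge0 => x _; rewrite lee_fin.
have [->|/KL_finite_density[r rr]] := eqVneq (KL P Q) +oo.
  have nN (x : \bar R) : 0 <= x -> x != -oo by case: x.
  by rewrite !addye ?nN// leey.
have [mr r0 _] := rr.
rewrite (KLE rr) !(has_density_integral rr)//; last 2 first.
- by apply/measurable_EFinP.
- by apply/measurable_EFinP.
have mk : measurable_fun setT (fun x => (kl_fun (r x))%:E).
  by apply/measurable_EFinP; exact: measurable_kl_fun.
have mhr : measurable_fun setT (fun x => (h x)%:E * (r x)%:E).
  by apply: emeasurable_funM; exact/measurable_EFinP.
have me : measurable_fun setT (fun x => (expR (g x - h x))%:E).
  apply/measurable_EFinP; apply: measurableT_comp => //.
  exact: measurable_funB.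
have k0 x : 0 <= (kl_fun (r x))%:E by rewrite lee_fin kl_fun_ge0.
have hr0 x : 0 <= (h x)%:E * (r x)%:E by rewrite mule_ge0 ?lee_fin.
rewrite -!ge0_integralD//; last 2 first.
- by move=> x _; rewrite adde_ge0.
- exact: emeasurable_funD.
apply: ge0_le_integral => //.
- by move=> x _; rewrite mule_ge0 ?lee_fin.
- by apply: emeasurable_funM; exact/measurable_EFinP.
- by apply: emeasurable_funD => //; exact: emeasurable_funD.
move=> x _; rewrite -!EFinM -!EFinD lee_fin.
by have := kl_fun_young (g x - h x) (r0 x); lra.
Qed.

End KL_young.

Section KL_push.
Local Open Scope ereal_scope.
Context d d' (T : measurableType d) (T' : measurableType d') (R : realType).

Lemma has_density_push (P Q : probability T R) (f : T -> T') (g : T' -> T)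
    (mf : measurable_fun setT f) (mg : measurable_fun setT g) r :
  cancel f g -> has_density P Q r ->
  has_density (push P mf) (push Q mf) (r \o g).
Proof.
move=> fK [mr r0 PE]; split => //; first exact: measurableT_comp.
  by move=> x /=.
move=> A mA; have mfA : measurable (f @^-1` A).
  by rewrite -[X in measurable X]setTI; exact: mf.
rewrite pushE PE// /push /distribution ge0_integral_pushforward//=.
- by apply: eq_integral => x _ /=; rewrite fK.
- by apply/measurable_EFinP/measurable_funTS; exact: measurableT_comp.
- by move=> x _ /=; rewrite lee_fin.
Qed.

(** Since [g] undoes [f], no information is lost: a density [r] becomes [r \o g], and absolute
    continuity can be pulled back. *)
Lemma KL_push (P Q : probability T R) (f : T -> T') (g : T' -> T)
    (mf : measurable_fun setT f) (mg : measurable_fun setT g) :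
  cancel f g -> KL (push P mf) (push Q mf) = KL P Q.
Proof.
move=> fK; have [PQ|nPQ] := pselect (P `<< Q); last first.
  have -> : KL P Q = +oo by rewrite /KL; case: asboolP.
  rewrite /KL; case: asboolP => // re; case: nPQ.
  apply/null_content_dominatesP => A mA QA.
  have mgA : measurable (g @^-1` A).
    by rewrite -[X in measurable X]setTI; exact: mg.
  have E : f @^-1` (g @^-1` A) = A.
    by apply/seteqP; split => x; rewrite /preimage/= fK.
  have QgA : push Q mf (g @^-1` A) = 0 by rewrite -QA -[in RHS]E.
  move/null_content_dominatesP : re => /(_ _ mgA QgA) PgA.
  by rewrite -PgA -[in LHS]E.
have [r rr] := dominates_density PQ.
rewrite (KLE rr) (KLE (has_density_push mf mg fK rr)).
rewrite [LHS](ge0_integral_push Q mf).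
- by apply: eq_integral => x _ /=; rewrite fK.
- by apply/measurable_EFinP; apply: measurable_kl_fun; apply: measurableT_comp => //; case: rr.
- by move=> x; rewrite lee_fin kl_fun_ge0//=; case: rr.
Qed.

End KL_push.

(** * Unbalanced transport *)

Section unbalanced_cost.
Local Open Scope ereal_scope.
Context {R : realType} (tau0 tau1 : R).
Context d1 d2 (X : measurableType d1) (Y : measurableType d2).
Implicit Types (c : X * Y -> R) (mu : {finite_measure set X -> \bar R})
  (nu : {finite_measure set Y -> \bar R}).

Definition ucost c mu nu (g : {finite_measure set (X * Y)%type -> \bar R}) : \bar R :=
  \int[g]_xy (c xy)%:E + tau0%:E * KL (marginal1 g) mu
                       + tau1%:E * KL (marginal2 g) nu.

(** Plans of mass one only; the total mass is optimized separately. *)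
Definition ucost_inf c mu nu : \bar R :=
  ereal_inf (range (fun g : probability (X * Y)%type R => ucost c mu nu g)).

Lemma ucost_ext c mu mu' nu nu' (g g' : {finite_measure set (X * Y)%type -> \bar R}) :
  (forall A, measurable A -> mu A = mu' A) ->
  (forall A, measurable A -> nu A = nu' A) ->
  (forall A, measurable A -> g A = g' A) ->
  ucost c mu nu g = ucost c mu' nu' g'.
Proof.
move=> muE nuE gE; rewrite /ucost; congr (_ + _ * _ + _ * _).
- by apply: eq_measure_integral => A mA _; exact: gE.
- apply: KL_ext => // A mA; apply: gE.
  by rewrite -[X in measurable X]setTI; exact: measurable_fst.
- apply: KL_ext => // A mA; apply: gE.
  by rewrite -[X in measurable X]setTI; exact: measurable_snd.
Qed.

Lemma ucost_inf_ext c mu mu' nu nu' :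
  (forall A, measurable A -> mu A = mu' A) ->
  (forall A, measurable A -> nu A = nu' A) ->
  ucost_inf c mu nu = ucost_inf c mu' nu'.
Proof.
move=> muE nuE; congr ereal_inf; congr (_ @` _); apply/funext => g.
exact: ucost_ext.
Qed.

Hypotheses (tau0_ge0 : (0 <= tau0)%R) (tau1_ge0 : (0 <= tau1)%R).

Lemma ucost_ge0 c mu nu (g : {finite_measure set (X * Y)%type -> \bar R}) :
  (forall xy, 0 <= c xy)%R -> 0 <= ucost c mu nu g.
Proof.
move=> c0; apply: adde_ge0; last by rewrite mule_ge0 ?lee_fin ?KL_ge0.
apply: adde_ge0; last by rewrite mule_ge0 ?lee_fin ?KL_ge0.
by apply: integral_ge0 => x _; rewrite lee_fin.
Qed.

Lemma ucost_inf_ge0 c mu nu : (forall xy, 0 <= c xy)%R -> 0 <= ucost_inf c mu nu.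
Proof. by move=> c0; apply: le_ereal_inf_tmp => _ [g _ <-]; exact: ucost_ge0. Qed.

Lemma ucost_inf_le c mu nu (g : probability (X * Y)%type R) :
  ucost_inf c mu nu <= ucost c mu nu g.
Proof. by apply: ereal_inf_lbound; exists g. Qed.

End unbalanced_cost.

Section probability_cost.
Local Open Scope ereal_scope.
Context {R : realType} (tau0 tau1 : R).
Context d1 d2 (X : measurableType d1) (Y : measurableType d2).
Implicit Types (c : X * Y -> R) (mu : probability X R) (nu : probability Y R).

Lemma ucost_probability c mu nu (g : probability (X * Y)%type R) :
  ucost tau0 tau1 c mu nu g =
  \int[g]_xy (c xy)%:E + tau0%:E * KL (push g measurable_fst) mu
                       + tau1%:E * KL (push g measurable_snd) nu.
Proof.
have E1 : KL (marginal1 g) mu = KL (push g measurable_fst) mu by exact: KL_ext.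
have E2 : KL (marginal2 g) nu = KL (push g measurable_snd) nu by exact: KL_ext.
by rewrite /ucost E1 E2.
Qed.

End probability_cost.

Section unbalanced_cost_push.
Local Open Scope ereal_scope.
Context {R : realType} (tau0 tau1 : R).
Context d1 d2 d1' d2' (X : measurableType d1) (Y : measurableType d2)
  (X' : measurableType d1') (Y' : measurableType d2').
Variables (f : X -> X') (f' : X' -> X) (g : Y -> Y') (g' : Y' -> Y).
Hypotheses (mf : measurable_fun setT f) (mf' : measurable_fun setT f').
Hypotheses (mg : measurable_fun setT g) (mg' : measurable_fun setT g').
Hypotheses (fK : cancel f f') (gK : cancel g g').

Lemma measurable_map_pair : measurable_fun setT (fun xy : X * Y => (f xy.1, g xy.2)).
Proof.
apply: measurable_fun_pair.
- exact: (measurableT_comp mf measurable_fst).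
- exact: (measurableT_comp mg measurable_snd).
Qed.

Lemma ucost_push (c : X' * Y' -> R) (mu : probability X R) (nu : probability Y R)
    (p : probability (X * Y)%type R) :
  measurable_fun setT c -> (forall xy, 0 <= c xy)%R ->
  ucost tau0 tau1 c (push mu mf) (push nu mg) (push p measurable_map_pair) =
  ucost tau0 tau1 (fun xy => c (f xy.1, g xy.2)) mu nu p.
Proof.
move=> mc c0; rewrite !ucost_probability; congr (_ + _ * _ + _ * _).
- rewrite [LHS](ge0_integral_push p measurable_map_pair)//.
  exact/measurable_EFinP.
- rewrite -(KL_push (push p measurable_fst) mu mf mf' fK); exact: KL_ext.
- rewrite -(KL_push (push p measurable_snd) nu mg mg' gK); exact: KL_ext.
Qed.

Lemma ucost_inf_push_le (c : X' * Y' -> R) (mu : probability X R) (nu : probability Y R) :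
  measurable_fun setT c -> (forall xy, 0 <= c xy)%R ->
  ucost_inf tau0 tau1 c (push mu mf) (push nu mg) <=
  ucost_inf tau0 tau1 (fun xy => c (f xy.1, g xy.2)) mu nu.
Proof.
move=> mc c0; apply: le_ereal_inf_tmp => _ [p _ <-].
by rewrite -ucost_push//; exact: ucost_inf_le.
Qed.

End unbalanced_cost_push.

Section unbalanced_cost_push_eq.
Local Open Scope ereal_scope.
Context {R : realType} (tau0 tau1 : R).
Context d1 d2 d1' d2' (X : measurableType d1) (Y : measurableType d2)
  (X' : measurableType d1') (Y' : measurableType d2').
Variables (f : X -> X') (f' : X' -> X) (g : Y -> Y') (g' : Y' -> Y).
Hypotheses (mf : measurable_fun setT f) (mf' : measurable_fun setT f').
Hypotheses (mg : measurable_fun setT g) (mg' : measurable_fun setT g').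
Hypotheses (fK : cancel f f') (gK : cancel g g').
Hypotheses (fK' : cancel f' f) (gK' : cancel g' g).

Lemma ucost_inf_push (c : X' * Y' -> R) (mu : probability X R) (nu : probability Y R) :
  measurable_fun setT c -> (forall xy, 0 <= c xy)%R ->
  ucost_inf tau0 tau1 c (push mu mf) (push nu mg) =
  ucost_inf tau0 tau1 (fun xy => c (f xy.1, g xy.2)) mu nu.
Proof.
move=> mc c0; apply/le_anti/andP; split.
  exact: (@ucost_inf_push_le R tau0 tau1 _ _ _ _ _ _ _ _ f f' g g'
    mf mf' mg mg' fK gK).
have mc' : measurable_fun setT (fun xy : X * Y => c (f xy.1, g xy.2)).
  exact: (measurableT_comp mc (measurable_map_pair mf mg)).
have := @ucost_inf_push_le R tau0 tau1 _ _ _ _ _ _ _ _ f' f g' g mf' mf mg' mg fK' gK'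
  (fun xy => c (f xy.1, g xy.2)) (push mu mf) (push nu mg) mc' (fun=> c0 _).
rewrite (@ucost_inf_ext _ _ _ _ _ _ _ _ _ mu _ nu); last 2 first.
- by move=> A mA; rewrite /= /push /distribution /pushforward /=; congr (mu _);
    apply/seteqP; split => x /=; rewrite fK.
- by move=> A mA; rewrite /= /push /distribution /pushforward /=; congr (nu _);
    apply/seteqP; split => x /=; rewrite gK.
rewrite (_ : (fun xy => _) = c)//.
by apply/funext => -[x y] /=; rewrite fK' gK'.
Qed.

End unbalanced_cost_push_eq.

Section shape_cost_coupling.
Local Open Scope ereal_scope.
Context {R : realType} (d : nat) (tau0 tau1 : R).
Hypotheses (tau0_ge0 : (0 <= tau0)%R) (tau1_ge0 : (0 <= tau1)%R).
Local Notation X := (d.-tuple R).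
Local Notation sqcost := (fun xy : X * X => sqdist xy.1 xy.2).

Lemma sqdist_ge0 (x y : X) : (0 <= sqdist x y)%R.
Proof. by apply: sumr_ge0 => i _; exact: sqr_ge0. Qed.

Lemma measurable_sqdist : measurable_fun setT sqcost.
Proof.
apply: measurable_sum => i; apply: measurable_funX; apply: measurable_funB.
- exact: (measurableT_comp (measurable_tnth i) measurable_fst).
- exact: (measurableT_comp (measurable_tnth i) measurable_snd).
Qed.

Lemma transport_cost_ge0 (g : {finite_measure set (X * X)%type -> \bar R}) :
  0 <= transport_cost g.
Proof. by apply: integral_ge0 => x _; rewrite lee_fin sqdist_ge0. Qed.

(** The infimum over marginals and the one over their couplings merge into a single infimum over
    plans, so later arguments handle one plan at a time. *)
Lemma shape_costE (mu nu : probability X R) :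
  shape_cost tau0 tau1 mu nu = ucost_inf tau0 tau1 sqcost mu nu.
Proof.
apply/le_anti/andP; split.
  apply: le_ereal_inf_tmp => _ [p _ <-].
  apply: (@le_trans _ _ (W2sq (push p measurable_fst) (push p measurable_snd) +
    tau0%:E * KL (push p measurable_fst) mu + tau1%:E * KL (push p measurable_snd) nu)).
    by apply: ereal_inf_lbound; exists (push p measurable_fst, push p measurable_snd).
  rewrite ucost_probability; apply: leeD => //; apply: leeD => //.
  by apply: ereal_inf_lbound; exists p.
apply: le_ereal_inf_tmp => _ [[p q] _ <-] /=; rewrite -addeA.
set k := _ + _ * KL q nu.
have k0 : 0 <= k by rewrite adde_ge0// mule_ge0 ?lee_fin ?KL_ge0.
have W0 : 0 <= W2sq p q.
  by apply: le_ereal_inf_tmp => _ [g _ <-]; exact: transport_cost_ge0.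
have [koo|kfin] := eqVneq k +oo.
  by rewrite koo addey ?leey// gt_eqF// (lt_le_trans _ W0)// ltNyr.
have kf : k \is a fin_num by rewrite ge0_fin_numE// ltey.
rewrite -leeBlDr//; apply: le_ereal_inf_tmp => _ [g [gp gq] <-].
rewrite leeBlDr//; apply: le_trans (ucost_inf_le tau0 tau1 _ mu nu g) _.
rewrite /ucost -addeA /k (@KL_ext _ _ _ (marginal1 g) p mu mu)//.
by rewrite (@KL_ext _ _ _ (marginal2 g) q nu nu).
Qed.

End shape_cost_coupling.

(** * The optimal total mass of a plan *)

Section optimal_mass.
Context {R : realType} (tau0 tau1 : R).
Hypotheses (tau0_gt0 : 0 < tau0) (tau1_gt0 : 0 < tau1).

(** The part of the two entropies that comes from the total masses alone, when a probability plan is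
    multiplied by [t] and the references by [a] and [b]. *)
Definition mass_penalty (a b t : R) : R :=
  tau0 * (t * ln (t / a) - t + a) + tau1 * (t * ln (t / b) - t + b).

(** The critical point in [t] of [t * A + mass_penalty a b t], namely $a^\theta b^{1-\theta}
    e^{-A/s}$ with $s = \tau_0 + \tau_1$ and $\theta = \tau_0/s$. *)
Definition optimal_mass (a b A : R) : R :=
  expR ((tau0 * ln a + tau1 * ln b - A) / (tau0 + tau1)).

Let s_gt0 : 0 < tau0 + tau1. Proof. exact: addr_gt0. Qed.

Lemma mass_penaltyE (a b t : R) : 0 < a -> 0 < b -> 0 <= t ->
  mass_penalty a b t = (tau0 + tau1) * (t * ln t - t)
    - t * (tau0 * ln a + tau1 * ln b) + (tau0 * a + tau1 * b).
Proof.
move=> a0 b0; rewrite le_eqVlt /mass_penalty => /predU1P[<-|t0]; first by ring.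
by rewrite !ln_div ?posrE//; ring.
Qed.

(** The right-hand side is convex in [t]; the bound is the tangent inequality for [kl_fun] at the
    optimal mass, multiplied by [tau0 + tau1]. *)
Lemma optimal_massP (a b A t : R) : 0 < a -> 0 < b -> 0 <= t ->
  tau0 * a + tau1 * b - (tau0 + tau1) * optimal_mass a b A <=
  t * A + mass_penalty a b t.
Proof.
move=> a0 b0 t0; rewrite mass_penaltyE//.
rewrite /optimal_mass; set u := (_ / _).
have := kl_fun_tangent (expR_gt0 u) t0; rewrite {1}/kl_fun expRK /kl_fun => H.
have uE : tau0 * ln a + tau1 * ln b = (tau0 + tau1) * u + A.
  by rewrite /u [X in X + A]mulrC divfK ?gt_eqF// subrK.
rewrite uE.
have : (tau0 + tau1) * (t * u - expR u) <= (tau0 + tau1) * (t * ln t - t).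
  rewrite ler_pM2l//; lra.
nra.
Qed.

Lemma optimal_massE (a b A : R) : 0 < a -> 0 < b ->
  optimal_mass a b A * A + mass_penalty a b (optimal_mass a b A) =
  tau0 * a + tau1 * b - (tau0 + tau1) * optimal_mass a b A.
Proof.
move=> a0 b0; rewrite mass_penaltyE ?expR_ge0//.
have -> : ln (optimal_mass a b A) = (tau0 * ln a + tau1 * ln b - A) / (tau0 + tau1).
  by rewrite expRK.
have s0 : tau0 + tau1 != 0 by rewrite gt_eqF.
by field.
Qed.

End optimal_mass.

Section normalization.
Context d (T : measurableType d) (R : realType).

Lemma finite_measure_normalize (x0 : T) (g : {finite_measure set T -> \bar R}) :
  exists t (P : probability T R), 0 <= t /\
    forall A, measurable A -> g A = (t%:E * P A)%E.
Proof.
have gf : g setT \is a fin_num by exact: fin_num_measure.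
exists (fine (g setT)), (mnormalize g (dirac x0)).
split => [|A mA]; first exact: fine_ge0.
have [g0|g0] := eqVneq (g setT) 0%E.
  rewrite g0 mul0e; apply/eqP; rewrite eq_le measure_ge0 andbT -g0.
  by apply: le_measure; rewrite ?inE.
rewrite /= /mnormalize (negbTE g0) /=.
have -> : (g setT == +oo%E) = false by apply/negbTE; move: gf; rewrite fin_numE => /andP[].
rewrite muleCA -EFinM divff ?mule1//.
by rewrite fine_eq0.
Qed.

End normalization.

Section unbalanced_transport_value.
Local Open Scope ereal_scope.
Context {R : realType} (tau0 tau1 : R) (d : nat).
Hypotheses (tau0_gt0 : (0 < tau0)%R) (tau1_gt0 : (0 < tau1)%R).
Local Notation X := (d.-tuple R).
Local Notation sqcost := (fun xy : X * X => sqdist xy.1 xy.2).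

Lemma scaledE (c : R) (nu : probability X R) A : (0 < c)%R ->
  scaled c nu A = c%:E * nu A.
Proof.
move=> c0; change (`|c|%:E * nu A = c%:E * nu A).
by rewrite gtr0_norm.
Qed.

Let scaled_costE (t u v p q : R) (I K L : \bar R) :
  (0 <= t)%R -> (0 <= u)%R -> (0 <= v)%R -> 0 <= I -> 0 <= K -> 0 <= L ->
  t%:E * I + u%:E * (t%:E * K + p%:E) + v%:E * (t%:E * L + q%:E) =
  t%:E * (I + u%:E * K + v%:E * L) + (u * p + v * q)%:E.
Proof.
move=> t0 u0 v0 I0 K0 L0.
have uK0 : 0 <= u%:E * K by rewrite mule_ge0.
have vL0 : 0 <= v%:E * L by rewrite mule_ge0.
rewrite (@muleDr _ u%:E)// ?fin_num_adde_defl// (@muleDr _ v%:E)// ?fin_num_adde_defl//.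
rewrite (ge0_muleDr _ _ vL0) ?adde_ge0// (ge0_muleDr _ I0 uK0) EFinD -!EFinM.
rewrite (muleCA u%:E) (muleCA v%:E).
by rewrite -!addeA; congr (_ + (_ + _)); rewrite addeCA.
Qed.

Lemma ucost_scale (mu nu : probability X R) (a b t : R)
    (g : {finite_measure set (X * X)%type -> \bar R})
    (P : probability (X * X)%type R) :
  (0 < a)%R -> (0 < b)%R -> (0 <= t)%R ->
  (forall A, measurable A -> g A = t%:E * P A) ->
  ucost tau0 tau1 sqcost (scaled a mu) (scaled b nu) g =
  t%:E * ucost tau0 tau1 sqcost mu nu P + (mass_penalty tau0 tau1 a b t)%:E.
Proof.
move=> a0 b0 t0 gE; rewrite ucost_probability.
have preim (Z : measurableType (measure_tuple_display default_measure_display)) (f : X * X -> Z) A :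
    measurable_fun setT f ->
    measurable A -> measurable (f @^-1` A).
  by move=> mf mA; rewrite -[X in measurable X]setTI; exact: mf.
have g1E A : measurable A -> marginal1 g A = t%:E * push P measurable_fst A.
  by move=> mA; apply: gE; exact: preim.
have g2E A : measurable A -> marginal2 g A = t%:E * push P measurable_snd A.
  by move=> mA; apply: gE; exact: preim.
have KL1 := KL_scale (eta := scaled a mu) a0 t0 g1E (fun A _ => scaledE mu A a0).
have KL2 := KL_scale (eta := scaled b nu) b0 t0 g2E (fun A _ => scaledE nu A b0).
rewrite /ucost KL1 KL2 (ge0_integral_scale t0 gE); last 2 first.
- by apply/measurable_EFinP; exact: measurable_sqdist.
- by move=> x; rewrite lee_fin sqdist_ge0.
rewrite /mass_penalty.
apply: scaled_costE; rewrite ?KL_ge0 ?(ltW tau0_gt0) ?(ltW tau1_gt0)//.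
by apply: integral_ge0 => x _; rewrite lee_fin sqdist_ge0.
Qed.

(** Every plan is a mass [t] times a probability plan, and by [ucost_scale] its cost is [t] times
    the probability cost plus the mass penalty. The two infima therefore separate. *)
Lemma UOT_scaled (mu nu : probability X R) (a b A : R) :
  (0 < a)%R -> (0 < b)%R -> ucost_inf tau0 tau1 sqcost mu nu = A%:E ->
  UOT tau0 tau1 (scaled a mu) (scaled b nu) =
  (tau0 * a + tau1 * b - (tau0 + tau1) * optimal_mass tau0 tau1 a b A)%:E.
Proof.
move=> a0 b0 AE; apply/le_anti/andP; split; last first.
  apply: le_ereal_inf_tmp => _ [g _ <-].
  have [t [P [t0 gE]]] := finite_measure_normalize (point, point) g.
  apply: le_trans (_ : t%:E * A%:E + (mass_penalty tau0 tau1 a b t)%:E <= _).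
    by rewrite -EFinM -EFinD lee_fin optimal_massP.
  rewrite -/(ucost tau0 tau1 sqcost (scaled a mu) (scaled b nu) g).
  rewrite (ucost_scale mu nu a0 b0 t0 gE) leeD2r// lee_wpmul2l// -AE.
  exact: ucost_inf_le.
set t := optimal_mass tau0 tau1 a b A.
have t0 : (0 < t)%R by exact: expR_gt0.
apply/lee_addgt0Pr => e e0.
(* The slack is [e / t] because the cost of [P] gets multiplied by [t]. *)
have [_ [P _ <-] PA] : exists2 x, range (fun g : probability (X * X)%type R =>
    ucost tau0 tau1 sqcost mu nu g) x & x < A%:E + (e / t)%:E.
  apply/ereal_inf_ltP; rewrite -/(ucost_inf tau0 tau1 sqcost mu nu) AE -EFinD lte_fin.
  by rewrite ltrDl divr_gt0.
pose g : {finite_measure set (X * X)%type -> \bar R} := mscale (NngNum (ltW t0)) P.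
apply: (@le_trans _ _ (ucost tau0 tau1 sqcost (scaled a mu) (scaled b nu) g)).
  by apply: ereal_inf_lbound; exists g.
have gE B : measurable B -> g B = t%:E * P B by [].
rewrite (ucost_scale mu nu a0 b0 (ltW t0) gE).
apply: (@le_trans _ _ (t%:E * (A%:E + (e / t)%:E) + (mass_penalty tau0 tau1 a b t)%:E)).
  by rewrite leeD2r// lee_wpmul2l ?lee_fin ?ltW.
rewrite -(EFinD A) -EFinM -!EFinD lee_fin /t -optimal_massE// -/t mulrDr.
by rewrite mulrCA divff ?gt_eqF// mulr1; lra.
Qed.

End unbalanced_transport_value.

(** * Gibbs conditioning *)

Section density_criterion.
Local Open Scope ereal_scope.
Context d (T : measurableType d) (R : realType).

Lemma has_density_of_integral (rho eta : {measure set T -> \bar R}) (r : T -> R) :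
  measurable_fun setT r -> (forall x, 0 <= r x)%R ->
  (forall f : T -> \bar R, measurable_fun setT f -> (forall x, 0 <= f x) ->
    \int[rho]_x f x = \int[eta]_x (f x * (r x)%:E)) ->
  has_density rho eta r.
Proof.
move=> mr r0 rE; split => // A mA.
have := rE (fun x => (\1_A x)%:E); rewrite integral_indic// setIT => ->.
- rewrite [RHS]integral_mkcond; apply: eq_integral => x _.
  rewrite patchE indicE; case: ifPn => xA; rewrite ?mul1e//.
  by rewrite mul0e.
- by apply/measurable_EFinP.
- by move=> x; rewrite lee_fin.
Qed.

End density_criterion.

Section gibbs_fiber.
Local Open Scope ereal_scope.
Context d (S : measurableType d) (R : realType) (N : probability S R).
Variables (r k V : S -> R) (w c rho : R).
Hypotheses (mr : measurable_fun setT r) (r_ge0 : forall t, (0 <= r t)%R).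
Hypotheses (mk : measurable_fun setT k) (k_gt0 : forall t, (0 < k t)%R).
Hypotheses (mV : measurable_fun setT V) (V_ge0 : forall t, (0 <= V t)%R).
Hypotheses (int_k : \int[N]_t (k t)%:E = 1) (int_r : \int[N]_t (r t)%:E = rho%:E).
Hypotheses (w_ge0 : (0 <= w)%R) (lnk : forall t, ln (k t) = (c - w * V t)%R).

Let integrable_of_fin (f : S -> R) (l : R) : measurable_fun setT f ->
  (forall t, 0 <= f t)%R -> \int[N]_t (f t)%:E = l%:E ->
  N.-integrable setT (EFin \o f).
Proof.
move=> mf f0 fl; apply/integrableP; split; first exact/measurable_EFinP.
by under eq_integral do rewrite /= ger0_norm//; rewrite fl ltry.
Qed.

(** The Gibbs variational principle among densities of mass [rho]: by [lnk], [k] is the normalized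
    [exp (- w V)]. In the tangent inequality at [rho * k] the slope is [ln rho + c - w * V]; its
    last term cancels the linear term in [V], and what is left is a constant times [r - rho * k], of
    integral 0. *)
Lemma gibbs_fiber :
  \int[N]_t (kl_fun (rho * k t) + w * V t * (rho * k t))%:E <=
  \int[N]_t (kl_fun (r t) + w * V t * r t)%:E.
Proof.
have rho0 : (0 <= rho)%R.
  by rewrite -lee_fin -int_r; apply: integral_ge0 => t _; rewrite lee_fin.
have ir := integrable_of_fin mr r_ge0 int_r.
have ik := integrable_of_fin mk (fun t => ltW (k_gt0 t)) int_k.
have nonneg (f : S -> R) t : (forall t, 0 <= f t)%R ->
    0 <= (kl_fun (f t) + w * V t * f t)%:E.
  by move=> f0; rewrite lee_fin addr_ge0 ?kl_fun_ge0// !mulr_ge0.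
have meas (f : S -> R) : measurable_fun setT f ->
    measurable_fun setT (fun t => (kl_fun (f t) + w * V t * f t)%:E).
  move=> mf; apply/measurable_EFinP; apply: measurable_funD.
    exact: measurable_kl_fun.
  by apply: measurable_funM => //; exact: measurable_funM.
have mrk : measurable_fun setT (fun t => rho * k t)%R by exact: measurable_funM.
(* At [rho = 0] the entropy has no tangent; tangents at small [e > 0] give the inequality up to
   [e]. *)
move: rho0; rewrite le_eqVlt => /predU1P[rho0|rho0].
  rewrite [leLHS](@eq_integral _ _ _ _ _ (cst 1)); last first.
    by move=> t _; rewrite -rho0 mul0r mulr0 addr0 /kl_fun mul0r subr0 add0r.
  rewrite (integral_cst_probability N); apply/lee_addgt0Pr => e e0.
  have i1 : N.-integrable setT (EFin \o cst e) by exact: finite_measure_integrable_cst.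
  have irl : N.-integrable setT (fun t => (ln e)%:E * (r t)%:E).
    exact: (integrableZl measurableT _ ir).
  have ih : N.-integrable setT (EFin \o (fun t => ln e * r t - e)%R).
    have -> : EFin \o (fun t => ln e * r t - e)%R =
      (fun t => (ln e)%:E * (r t)%:E) \- (EFin \o cst e).
      by apply/funext => t; rewrite /= EFinB EFinM.
    exact: integrableB.
  have hE : \int[N]_t (ln e * r t - e)%:E = (- e)%:E.
    under eq_integral do rewrite EFinB EFinM.
    rewrite integralB// integralZl// int_r -rho0 mule0 sub0e.
    by rewrite (integral_cst_probability N).
  rewrite -leeBlDr// -EFinN -hE -(integral_cst_probability N 1).
  apply: ge0_integral_ge_addr => //.
  - exact: meas.
  - by move=> x; exact: nonneg.
  - move=> t; rewrite -EFinD lee_fin.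
    have := kl_fun_tangent e0 (r_ge0 t); rewrite {1}/kl_fun.
    have : (0 <= w * V t * r t)%R by rewrite !mulr_ge0.
    by lra.
have irk : N.-integrable setT (fun t => (rho)%:E * (k t)%:E).
  exact: (integrableZl measurableT _ ik).
have irrk : N.-integrable setT (fun t => (r t)%:E - (rho)%:E * (k t)%:E) by exact: integrableB.
have ih : N.-integrable setT (EFin \o (fun t => (ln rho + c) * (r t - rho * k t))%R).
  have -> : EFin \o (fun t => (ln rho + c) * (r t - rho * k t))%R =
    (fun t => (ln rho + c)%:E * ((r t)%:E - (rho)%:E * (k t)%:E)).
    by apply/funext => t; rewrite /= EFinM EFinB EFinM.
  exact: integrableZl.
have hE : \int[N]_t ((ln rho + c) * (r t - rho * k t))%:E = 0.
  under eq_integral do rewrite EFinM EFinB EFinM.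
  rewrite integralZl// integralB// integralZl// int_r int_k mule1 subee//.
  by rewrite mule0.
rewrite -[leLHS]adde0 -hE.
apply: ge0_integral_ge_addr => //.
- exact: meas.
- by move=> x; exact: nonneg.
- exact: meas.
- by move=> x; apply: (nonneg (fun t => rho * k t)%R) => t; rewrite mulr_ge0// ltW.
move=> t; rewrite -EFinD lee_fin.
have rk0 : (0 < rho * k t)%R by rewrite mulr_gt0.
have := kl_fun_tangent rk0 (r_ge0 t); rewrite lnM ?posrE// lnk.
by lra.
Qed.

End gibbs_fiber.

Section gibbs_conditional.
Local Open Scope ereal_scope.
Context d1 d2 (S : measurableType d1) (Y : measurableType d2) (R : realType).
Variables (N : probability S R) (gam : probability Y R) (tau : R).
Variables (F : S * Y -> S) (k V : S * Y -> R) (c : Y -> R).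
Hypotheses (tau_gt0 : (0 < tau)%R).
Hypotheses (mF : measurable_fun setT F).
Hypotheses (mk : measurable_fun setT k) (k_gt0 : forall ty, (0 < k ty)%R).
Hypotheses (mV : measurable_fun setT V) (V_ge0 : forall ty, (0 <= V ty)%R).
Hypothesis lnk : forall ty, ln (k ty) = (c ty.2 - tau^-1 * V ty)%R.
(** The Gibbs law given [y] is realized as the image of [N] under [F (., y)]. The noise thus stays
    explicit and can be shared with another coordinate. *)
Hypothesis Fk : forall (f : S -> \bar R) y, measurable_fun setT f ->
  (forall t, 0 <= f t) ->
  \int[N]_t f (F (t, y)) = \int[N]_t (f t * (k (t, y))%:E).

Let mG : measurable_fun setT (fun ty : S * Y => (F ty, ty.2)).
Proof. exact: measurable_fun_pair. Qed.

(* Keep the second marginal of [p] and redraw the first coordinate [t] from its Gibbs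
   law [k (t, y) N(dt)], [k] being proportional to [exp (- V / tau)]. *)
Definition resample (p : probability (S * Y)%type R) : probability (S * Y)%type R :=
  push (N \x push p measurable_snd) mG.

Variable p : probability (S * Y)%type R.

Let p2 : probability Y R := push p measurable_snd.
Let M : probability (S * Y)%type R := N \x gam.

Let mslice1 (f : S * Y -> \bar R) y :
  measurable_fun setT f -> measurable_fun setT (fun t => f (t, y)).
Proof. by move=> mf; apply: (measurableT_comp mf); exact: measurable_fun_pair. Qed.

Let mslice1R (f : S * Y -> R) y :
  measurable_fun setT f -> measurable_fun setT (fun t => f (t, y)).
Proof. by move=> mf; apply: (measurableT_comp mf); exact: measurable_fun_pair. Qed.

Let integral_M (f : S * Y -> \bar R) : measurable_fun setT f ->
  (forall x, 0 <= f x) -> \int[M]_x f x = \int[gam]_y \int[N]_t f (t, y).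
Proof. by move=> mf f0; rewrite /M [LHS]fubini_tonelli2. Qed.

Let measurable_fiber (f : S * Y -> \bar R) : measurable_fun setT f ->
  (forall x, 0 <= f x) -> measurable_fun setT (fun y => \int[N]_t f (t, y)).
Proof. by move=> mf f0; exact: measurable_fun_fubini_tonelli_G. Qed.

Lemma integral_resample (f : S * Y -> \bar R) : measurable_fun setT f ->
  (forall x, 0 <= f x) ->
  \int[resample p]_x f x = \int[p2]_y \int[N]_t (f (t, y) * (k (t, y))%:E).
Proof.
move=> mf f0; rewrite [LHS](ge0_integral_push _ mG mf f0).
have mfG : measurable_fun setT (fun x : S * Y => f (F x, x.2)).
  exact: (measurableT_comp mf mG).
rewrite [LHS]fubini_tonelli2//; apply: eq_integral => y _.
by rewrite /fubini_G/= (Fk y (mslice1 y mf)).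
Qed.

Section finite_entropy.
Variable r : S * Y -> R.
Hypothesis rr : has_density p M r.

Let mr : measurable_fun setT r. Proof. by case: rr. Qed.
Let r_ge0 x : (0 <= r x)%R. Proof. by case: rr. Qed.
Let mrE : measurable_fun setT (EFin \o r). Proof. exact/measurable_EFinP. Qed.

(** The density of the second marginal of [p] relative to [gam]. It is finite only almost
    everywhere, hence the real version [rho]. *)
Let rho' (y : Y) := \int[N]_t (r (t, y))%:E.
Let rho (y : Y) := fine (rho' y).

Let rho'_ge0 y : 0 <= rho' y.
Proof. by apply: integral_ge0 => t _; rewrite lee_fin. Qed.

Let mrho' : measurable_fun setT rho'.
Proof. by apply: (measurable_fiber mrE) => x; rewrite lee_fin. Qed.

Let mrho : measurable_fun setT rho.
Proof. exact: measurableT_comp. Qed.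

Let rho_ge0 y : (0 <= rho y)%R. Proof. exact: fine_ge0. Qed.

Let rho_ae : {ae gam, forall y, rho' y = (rho y)%:E}.
Proof.
have irho' : gam.-integrable setT rho'.
  apply/integrableP; split => //.
  under eq_integral do rewrite gee0_abs//.
  have <- := @integral_M (EFin \o r) mrE (fun x => r_ge0 x).
  by rewrite (has_density_integral1 rr) ltry.
have := integrable_ae measurableT irho'.
by apply: filterS => y /(_ Logic.I) fy; rewrite /rho fineK.
Qed.

Let integral_p2 (f : Y -> \bar R) : measurable_fun setT f -> (forall y, 0 <= f y) ->
  \int[p2]_y f y = \int[gam]_y (f y * (rho y)%:E).
Proof.
move=> mf f0; rewrite [LHS](ge0_integral_push p measurable_snd mf f0).
have mf2 : measurable_fun setT (fun x : S * Y => f x.2).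
  exact: (measurableT_comp mf measurable_snd).
rewrite (has_density_integral rr mf2 (fun x => f0 _)) integral_M; last 2 first.
- exact: emeasurable_funM.
- by move=> x; rewrite mule_ge0 ?lee_fin.
transitivity (\int[gam]_y (f y * rho' y)).
  apply: eq_integral => y _ /=; rewrite ge0_integralZl//.
    exact: (@mslice1 (EFin \o r) y mrE).
  by move=> t _; rewrite lee_fin.
apply: ge0_ae_eq_integral => //.
- exact: emeasurable_funM.
- by apply: emeasurable_funM => //; exact/measurable_EFinP.
- by move=> y _; rewrite mule_ge0.
- by move=> y _; rewrite mule_ge0 ?lee_fin.
by apply: filterS rho_ae => y -> _.
Qed.

Let mrk : measurable_fun setT (fun x : S * Y => rho x.2 * k x)%R.
Proof. by apply: measurable_funM => //; exact: (measurableT_comp mrho measurable_snd). Qed.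

Let rk_ge0 x : (0 <= rho x.2 * k x)%R. Proof. by rewrite mulr_ge0// ltW. Qed.

Let resample_density : has_density (resample p) M (fun x => rho x.2 * k x)%R.
Proof.
apply: has_density_of_integral => // f mf f0.
have mkE : measurable_fun setT (EFin \o k) by exact/measurable_EFinP.
have mfk : measurable_fun setT (fun x => f x * (k x)%:E) by exact: emeasurable_funM.
have fk0 x : 0 <= f x * (k x)%:E by rewrite mule_ge0// lee_fin ltW.
rewrite [LHS]integral_resample// [LHS]integral_p2; last 2 first.
- exact: (measurable_fiber mfk fk0).
- by move=> y; exact: integral_ge0.
rewrite [RHS]integral_M; last 2 first.
- by apply: emeasurable_funM => //; exact/measurable_EFinP.
- by move=> x; rewrite mule_ge0// lee_fin.
apply: eq_integral => y _ /=; rewrite -ge0_integralZr//; last 2 first.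
- exact: (mslice1 y mfk).
- by rewrite lee_fin.
by apply: eq_integral => t _; rewrite EFinM -muleA (muleC (k _)%:E).
Qed.

(** The reference measure being a product, the free energy is an integral over [y] of the functional
    minimized in [gibbs_fiber]; the restrictions of the density to fibers play the role of a
    disintegration. *)
Let free_energy (q : probability (S * Y)%type R) u : has_density q M u ->
  \int[q]_x (V x)%:E + tau%:E * KL q M =
  tau%:E * \int[gam]_y \int[N]_t (kl_fun (u (t, y)) + tau^-1 * V (t, y) * u (t, y))%:E.
Proof.
move=> uu; have [mu u0 _] := uu.
have mVE : measurable_fun setT (EFin \o V) by exact/measurable_EFinP.
have m1 : measurable_fun setT (fun x => (kl_fun (u x))%:E).
  by apply/measurable_EFinP; exact: measurable_kl_fun.
have m2 : measurable_fun setT (fun x => (tau^-1 * V x * u x)%:E).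
  by apply/measurable_EFinP; apply: measurable_funM => //; exact: measurable_funM.
have n1 x : 0 <= (kl_fun (u x))%:E by rewrite lee_fin kl_fun_ge0.
have n2 x : 0 <= (tau^-1 * V x * u x)%:E.
  by rewrite lee_fin !mulr_ge0// invr_ge0 ltW.
rewrite -[in RHS](@integral_M (fun x => (kl_fun (u x) + tau^-1 * V x * u x)%:E)); last 2 first.
- by under eq_fun do rewrite EFinD; exact: emeasurable_funD.
- by move=> x; rewrite EFinD adde_ge0.
under [in RHS]eq_integral do rewrite EFinD.
rewrite [in RHS]ge0_integralD// ge0_muleDr ?integral_ge0// (KLE uu) addeC; congr (_ + _).
rewrite (has_density_integral uu)//.
rewrite -[RHS]ge0_integralZl_EFin//; last exact: ltW.
apply: eq_integral => x _; rewrite -!EFinM; congr (_%:E).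
by rewrite !mulrA divff ?gt_eqF// mul1r.
Qed.

(** On almost every fiber, [rho y * k (t, y)] has the same mass as [r (t, y)], so the fiberwise
    inequality can be integrated over [y]. *)
Lemma resample_le_density :
  \int[resample p]_x (V x)%:E + tau%:E * KL (resample p) M <=
  \int[p]_x (V x)%:E + tau%:E * KL p M.
Proof.
rewrite (free_energy resample_density) (free_energy rr).
rewrite lee_wpmul2l ?lee_fin ?(ltW tau_gt0)//.
have mfe (u : S * Y -> R) : measurable_fun setT u -> (forall x, 0 <= u x)%R ->
    measurable_fun setT (fun y => \int[N]_t
      (kl_fun (u (t, y)) + tau^-1 * V (t, y) * u (t, y))%:E) /\
    forall y, 0 <= \int[N]_t
      (kl_fun (u (t, y)) + tau^-1 * V (t, y) * u (t, y))%:E.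
  move=> mu u0.
  have nn x : 0 <= (kl_fun (u x) + tau^-1 * V x * u x)%:E.
    by rewrite lee_fin addr_ge0 ?kl_fun_ge0// !mulr_ge0// invr_ge0 ltW.
  split; last by move=> y; apply: integral_ge0.
  apply: (@measurable_fiber (fun x => (kl_fun (u x) + tau^-1 * V x * u x)%:E)) => //.
  apply/measurable_EFinP; apply: measurable_funD; first exact: measurable_kl_fun.
  by apply: measurable_funM => //; exact: measurable_funM.
have [m1 n1] := mfe _ mrk rk_ge0; have [m2 n2] := mfe _ mr r_ge0.
apply: ae_ge0_le_integral => //.
apply: filterS rho_ae => y rhoE _ /=.
apply: (@gibbs_fiber _ S R N (fun t => r (t, y)) (fun t => k (t, y))
  (fun t => V (t, y)) tau^-1 (c y) (rho y)) => //.
- exact: mslice1R.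
- exact: mslice1R.
- exact: mslice1R.
- have := @Fk (cst 1) y; rewrite (integral_cst_probability N) => ->//.
  by apply: eq_integral => t _; rewrite mul1e.
- by rewrite invr_ge0 ltW.
Qed.

End finite_entropy.

Lemma resample_le :
  \int[resample p]_x (V x)%:E + tau%:E * KL (resample p) M <=
  \int[p]_x (V x)%:E + tau%:E * KL p M.
Proof.
have [->|/KL_finite_density[r rr]] := eqVneq (KL p M) +oo; last exact: resample_le_density rr.
rewrite gt0_muley ?lte_fin// addey ?leey//.
have : 0 <= \int[p]_x (V x)%:E by apply: integral_ge0 => x _; rewrite lee_fin.
by case: (integral _ _ _).
Qed.

End gibbs_conditional.

(** * Gaussian estimates *)

Section standard_normal.
Local Open Scope ereal_scope.
Context {R : realType}.
Local Notation leb := (@lebesgue_measure R).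
Local Notation T1 := (measurableTypeR R).
Local Notation N01 := (normal_prob (0 : R) 1 : probability (measurableTypeR R) R).
Local Notation pk := (normal_peak (1 : R)).

Let pk_gt0 : (0 < pk)%R. Proof. by rewrite normal_peak_gt0 ?oner_eq0. Qed.

Lemma measurable_expR_sqr (a b c : R) :
  measurable_fun setT (fun t : T1 => (expR (a * (b * t + c) ^+ 2))%:E).
Proof.
apply/measurable_EFinP; apply: measurableT_comp => //; apply: measurable_funM => //.
by apply: measurable_funX; exact: measurable_affine.
Qed.

Lemma integral_normal (f : T1 -> \bar R) : measurable_fun setT f ->
  (forall t, 0 <= f t) ->
  \int[N01]_t f t = pk%:E * \int[leb]_t (f t * (expR (- t ^+ 2 / 2))%:E).
Proof.
move=> mf f0; rewrite (has_density_integral has_density_normal)//.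
rewrite -ge0_integralZl_EFin ?(ltW pk_gt0)//.
- by apply: eq_integral => t _; rewrite normal_pdf01E EFinM muleCA.
- by move=> t _; rewrite mule_ge0// lee_fin expR_ge0.
- apply: emeasurable_funM => //.
  have := measurable_expR_sqr (- 2^-1) 1 0.
  by under eq_fun do rewrite mul1r addr0 mulNr mulrC -mulNr.
Qed.

(** The weight is the density of N(al, be^2) relative to N(0, 1). *)
Lemma normal_push_density (al be : R) (f : T1 -> \bar R) : (0 < be)%R ->
  measurable_fun setT f -> (forall t, 0 <= f t) ->
  \int[N01]_t f (be * t + al)%R =
  \int[N01]_t (f t *
    (be^-1 * expR (t ^+ 2 / 2 - (t - al) ^+ 2 / (2 * be ^+ 2)))%:E).
Proof.
move=> be0 mf f0.
have me : measurable_fun setT (fun t : T1 =>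
    (be^-1 * expR (t ^+ 2 / 2 - (t - al) ^+ 2 / (2 * be ^+ 2)))%:E).
  apply/measurable_EFinP; apply: measurable_funM => //; apply: measurableT_comp => //.
  apply: measurable_funB; apply: measurable_funM => //; apply: measurable_funX => //.
  exact: measurable_funB.
have e0 t : 0 <= (be^-1 * expR (t ^+ 2 / 2 - (t - al) ^+ 2 / (2 * be ^+ 2)))%:E.
  by rewrite lee_fin mulr_ge0 ?expR_ge0// invr_ge0 ltW.
have mh : measurable_fun setT (fun t : T1 => (expR (- t ^+ 2 / 2))%:E).
  have := measurable_expR_sqr (- 2^-1) 1 0.
  by under eq_fun do rewrite mul1r addr0 mulNr mulrC -mulNr.
rewrite [LHS]integral_normal//; last first.
  by apply: (measurableT_comp mf); exact: measurable_affine.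
rewrite [RHS]integral_normal; last 2 first.
- exact: emeasurable_funM.
- by move=> t; rewrite mule_ge0.
congr (_ * _).
pose H (t : T1) := f t * (be^-1 * expR (t ^+ 2 / 2 - (t - al) ^+ 2 / (2 * be ^+ 2)))%:E *
  (expR (- t ^+ 2 / 2))%:E.
have mH : measurable_fun setT H.
  by apply: emeasurable_funM => //; exact: emeasurable_funM.
have H0 t : 0 <= H t by rewrite !mule_ge0// lee_fin expR_ge0.
have be_neq0 : be != 0%R by rewrite gt_eqF.
rewrite [RHS](@ge0_integral_affine R be al H be_neq0 mH H0).
rewrite gtr0_norm// -ge0_integralZl_EFin ?(ltW be0)//; last first.
  exact: (measurableT_comp mH (measurable_affine be al)).
rewrite /H.
apply: eq_integral => t _; rewrite -muleA -EFinM muleCA -EFinM; congr (_ * _%:E).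
rewrite -mulrA -expRD mulrA divff ?gt_eqF// mul1r; congr expR.
by field; rewrite gt_eqF.
Qed.

Lemma normal_exp_sqr (a : R) : (0 < a)%R ->
  \int[N01]_t (expR ((1 - a ^+ 2) / 2 * t ^+ 2))%:E = (a^-1)%:E.
Proof.
move=> a0; have m (c : R) : measurable_fun setT (fun t : T1 => (expR (c * t ^+ 2))%:E).
  have := measurable_expR_sqr c 1 0.
  by under eq_fun do rewrite mul1r addr0.
rewrite (integral_normal (m _) (fun t => expR_ge0 _)).
have -> : \int[leb]_t ((expR ((1 - a ^+ 2) / 2 * t ^+ 2))%:E * (expR (- t ^+ 2 / 2))%:E) =
    (a^-1)%:E * \int[leb]_t (expR (- t ^+ 2 / 2))%:E.
  rewrite [in RHS](@ge0_integral_affine R a 0) ?gt_eqF//; last first.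
    by under eq_fun do rewrite mulNr mulrC -mulNr; exact: m.
  rewrite muleA -EFinM gtr0_norm// mulVf ?gt_eqF// mul1e.
  apply: eq_integral => t _; rewrite -EFinM -expRD; congr (expR _)%:E.
  by rewrite addr0 exprMn; field.
rewrite integral_expR_half -!EFinM; congr (_%:E).
by rewrite mulrCA divff ?gt_eqF// mulr1.
Qed.

(** Dropping the factor [expR (- t ^+ 2 / 2) <= 1] leaves a Gauss integral over the line. The bound
    is uniform in [e] and decays in [l]; both features are used for coercivity. *)
Lemma normal_exp_shift (e l : R) : (l != 0)%R ->
  \int[N01]_t (expR (- (l * t + e) ^+ 2))%:E <= (pk * Num.sqrt pi / `|l|)%:E.
Proof.
move=> l0; have m : measurable_fun setT (fun t : T1 => (expR (- (l * t + e) ^+ 2))%:E).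
  by have := measurable_expR_sqr (-1) l e; under eq_fun do rewrite mulN1r.
have m1 : measurable_fun setT (fun t : T1 => (expR (- t ^+ 2))%:E).
  have := measurable_expR_sqr (-1) 1 0.
  by under eq_fun do rewrite mulN1r mul1r addr0.
rewrite (integral_normal m (fun t => expR_ge0 _)).
rewrite -mulrA EFinM lee_wpmul2l ?lee_fin ?(ltW pk_gt0)//.
apply: (@le_trans _ _ (\int[leb]_t (expR (- (l * t + e) ^+ 2))%:E)).
  apply: ge0_le_integral => //.
  - apply: emeasurable_funM => //.
    have := measurable_expR_sqr (- 2^-1) 1 0.
    by under eq_fun do rewrite mul1r addr0 mulNr mulrC -mulNr.
  move=> t _; rewrite -EFinM lee_fin ler_piMr ?expR_ge0//.
  by rewrite -expR0 ler_expR mulNr oppr_le0 divr_ge0// sqr_ge0.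
have := @ge0_integral_affine R l e _ l0 m1 (fun=> expR_ge0 _).
have -> : \int[leb]_t (expR (- t ^+ 2))%:E = (Num.sqrt pi)%:E.
  exact: integralT_gauss.
move=> /(congr1 (mule (`|l|^-1)%:E)).
rewrite muleA -EFinM -EFinM mulVf ?normr_eq0// mul1e => <-.
by rewrite mulrC.
Qed.

(** [M] is the variance, of which only finiteness and positivity matter. It is finite as $t^2 \le 4
    e^{t^2/4}$, and positive as $1 \le t^2 + e^{-t^2}$ where the exponential has integral $1/\sqrt 3
    < 1$. Averaging over the sign of [B] removes the cross term. *)
Lemma normal_sqr_moment : exists2 M : R, (0 < M)%R &
  forall A B : R, \int[N01]_t ((A + B * t) ^+ 2)%:E = (A ^+ 2 + B ^+ 2 * M)%:E.
Proof.
have m (A B : R) : measurable_fun setT (fun t : T1 => ((A + B * t) ^+ 2)%:E).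
  apply/measurable_EFinP; apply: measurable_funX.
  by under eq_fun do rewrite addrC; exact: measurable_affine.
have mN (A B : R) : measurable_fun setT (fun t : T1 => ((A - B * t) ^+ 2)%:E).
  by have := m A (- B)%R; under eq_fun do rewrite mulNr.
have m2 : measurable_fun setT (fun t : T1 => (t ^+ 2)%:E).
  by have := m 0%R 1%R; under eq_fun do rewrite add0r mul1r.
pose I := \int[N01]_t (t ^+ 2)%:E.
have I0 : 0 <= I by apply: integral_ge0 => t _; rewrite lee_fin sqr_ge0.
have mexp (c : R) : measurable_fun setT (fun t : T1 => (expR (c * t ^+ 2))%:E).
  have := measurable_expR_sqr c 1 0.
  by under eq_fun do rewrite mul1r addr0.
have s2 : (0 < Num.sqrt (2^-1 : R))%R by rewrite sqrtr_gt0 invr_gt0.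
have s3 : (0 < Num.sqrt (3 : R))%R by rewrite sqrtr_gt0.
have Ilt : I < +oo.
  apply: (@le_lt_trans _ _ (4%:E * (Num.sqrt (2^-1 : R))^-1%:E)); last first.
    by rewrite -EFinM ltry.
  rewrite -(normal_exp_sqr s2) -ge0_integralZl_EFin//.
    apply: ge0_le_integral => //.
    - by move=> t _; rewrite lee_fin sqr_ge0.
    - exact: emeasurable_funM.
    move=> t _; rewrite -EFinM lee_fin sqr_sqrtr ?invr_ge0//.
    have := expR_ge1Dx ((1 - 2^-1) / 2 * t ^+ 2); lra.
have If : I \is a fin_num by rewrite ge0_fin_numE.
exists (fine I).
  rewrite -lte_fin fineK//.
  have le1 : 1 <= I + (Num.sqrt (3 : R))^-1%:E.
    rewrite -(normal_exp_sqr s3) -ge0_integralD//; last first.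
      by move=> t _; rewrite lee_fin sqr_ge0.
    rewrite -(integral_cst_probability N01 1); apply: ge0_le_integral => //.
      exact: emeasurable_funD.
    move=> t _; rewrite -EFinD lee_fin sqr_sqrtr//.
    have := expR_ge1Dx ((1 - 3) / 2 * t ^+ 2); lra.
  have : ((Num.sqrt (3 : R))^-1 < 1)%R.
    by rewrite invf_lt1// -[ltLHS]sqrtr1 ltr_sqrt//; lra.
  move: le1; rewrite -(fineK If) -EFinD !lee_fin lte_fin; lra.
move=> A B.
have sym : \int[N01]_t ((A + B * t) ^+ 2)%:E = \int[N01]_t ((A - B * t) ^+ 2)%:E.
  rewrite (integral_normal (m A B) (fun=> sqr_ge0 _)).
  rewrite (integral_normal (mN A B) (fun=> sqr_ge0 _)).
  congr (_ * _); rewrite [LHS](@ge0_integral_affine R (-1) 0)%R ?oppr_eq0 ?oner_eq0//; last 2 first.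
  - apply: emeasurable_funM => //.
    by under eq_fun do rewrite mulNr mulrC -mulNr; exact: mexp.
  - by move=> t; rewrite mule_ge0// lee_fin ?sqr_ge0 ?expR_ge0.
  rewrite normrN1 mul1e; apply: eq_integral => t _.
  by rewrite mulN1r addr0 mulrN sqrrN.
have : \int[N01]_t ((A + B * t) ^+ 2)%:E + \int[N01]_t ((A - B * t) ^+ 2)%:E =
    (2 * A ^+ 2)%:E + (2 * B ^+ 2)%:E * I.
  rewrite -ge0_integralD//; last 2 first.
  - by move=> t _; rewrite lee_fin sqr_ge0.
  - by move=> t _; rewrite lee_fin sqr_ge0.
  rewrite -(integral_cst_probability N01 (2 * A ^+ 2)%:E) -ge0_integralZl_EFin//; last 2 first.
  - by move=> t _; rewrite lee_fin sqr_ge0.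
  - by rewrite mulr_ge0// sqr_ge0.
  rewrite -ge0_integralD//; last 3 first.
  - by move=> t _; rewrite lee_fin mulr_ge0// sqr_ge0.
  - move=> t _; rewrite -EFinM lee_fin.
    by apply: mulr_ge0; [apply: mulr_ge0 => //|]; exact: sqr_ge0.
  - exact: emeasurable_funM.
  apply: eq_integral => t _; rewrite -EFinM -!EFinD; congr (_%:E).
  by rewrite !expr2; ring.
rewrite -sym -(fineK If) -EFinM -EFinD.
have : 0 <= \int[N01]_t ((A + B * t) ^+ 2)%:E.
  by apply: integral_ge0 => t _; rewrite lee_fin sqr_ge0.
case: (\int[N01]_t _) => [x||]//= _ [] H; congr (_%:E); lra.
Qed.

End standard_normal.

Section squared_norm.
Context {R : realType}.

Definition nsq d (v : 'rV[R]_d) : R := \sum_j v 0 j ^+ 2.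

Definition frob p q (M : 'M[R]_(p, q)) : R := \sum_i \sum_j M i j ^+ 2.

Lemma nsq_ge0 d (v : 'rV[R]_d) : 0 <= nsq v.
Proof. by apply: sumr_ge0 => j _; exact: sqr_ge0. Qed.

Lemma frob_ge0 p q (M : 'M[R]_(p, q)) : 0 <= frob M.
Proof. by apply: sumr_ge0 => i _; apply: sumr_ge0 => j _; exact: sqr_ge0. Qed.

Lemma nsqE d (v : 'rV[R]_d) : nsq v = (v *m v^T) 0 0.
Proof. by rewrite mxE; apply: eq_bigr => j _; rewrite mxE expr2. Qed.

Lemma nsqN d (v : 'rV[R]_d) : nsq (- v) = nsq v.
Proof. by apply: eq_bigr => j _; rewrite mxE sqrrN. Qed.

Lemma nsq0_eq0 d (v : 'rV[R]_d) : (nsq v == 0) = (v == 0).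
Proof.
apply/eqP/eqP => [v0|->]; last by rewrite /nsq big1// => j _; rewrite mxE expr0n.
apply/rowP => j; rewrite mxE; apply/eqP; rewrite -sqrf_eq0; apply/eqP.
by apply: (psumr_eq0P _ v0) => // i _; exact: sqr_ge0.
Qed.

(** The weight [e] keeps the factor of [nsq u] close to 1, as continuity of the cost requires. *)
Lemma nsqD_le d (e : R) (u v : 'rV[R]_d) : 0 < e ->
  nsq (u + v) <= (1 + e) * nsq u + (1 + e^-1) * nsq v.
Proof.
move=> e0; rewrite !mulr_sumr -big_split/=; apply: ler_sum => j _; rewrite mxE.
have H : 0 <= e^-1 * (e * u 0 j - v 0 j) ^+ 2.
  by rewrite mulr_ge0 ?sqr_ge0// invr_ge0 ltW.
have E : e^-1 * (e * u 0 j - v 0 j) ^+ 2 =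
    e * u 0 j ^+ 2 - 2 * (u 0 j * v 0 j) + e^-1 * v 0 j ^+ 2.
  by field; rewrite gt_eqF.
by move: H; rewrite E !expr2; lra.
Qed.

Lemma nsqD2 d (u v : 'rV[R]_d) : nsq (u + v) <= 2 * nsq u + 2 * nsq v.
Proof. by have := nsqD_le u v ltr01; rewrite invr1. Qed.

(** By Lagrange's identity. *)
Lemma sum_cauchy_schwarz (I : finType) (a b : I -> R) :
  (\sum_i a i * b i) ^+ 2 <= (\sum_i a i ^+ 2) * (\sum_i b i ^+ 2).
Proof.
have : 0 <= \sum_i \sum_k (a i * b k - a k * b i) ^+ 2.
  by apply: sumr_ge0 => i _; apply: sumr_ge0 => k _; exact: sqr_ge0.
set A := \sum_i a i ^+ 2; set B := \sum_i b i ^+ 2; set C := \sum_i a i * b i.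
have -> : \sum_i \sum_k (a i * b k - a k * b i) ^+ 2 = 2 * (A * B - C ^+ 2).
  transitivity (\sum_i (a i ^+ 2 * B + b i ^+ 2 * A - 2 * (a i * b i) * C)).
    apply: eq_bigr => i _; rewrite /A /B /C !mulr_sumr -big_split -sumrB /=.
    by apply: eq_bigr => k _; ring.
  rewrite sumrB big_split/= -!mulr_suml -mulr_sumr -/A -/B -/C; ring.
by rewrite pmulr_rge0// subr_ge0.
Qed.

Lemma nsq_mulmx p q (v : 'rV[R]_p) (M : 'M[R]_(p, q)) :
  nsq (v *m M) <= nsq v * frob M.
Proof.
rewrite /frob exchange_big mulr_sumr; apply: ler_sum => j _.
by rewrite mxE; exact: sum_cauchy_schwarz.
Qed.

Lemma sqdist_tv d (u v : 'rV[R]_d) : sqdist (tv u) (tv v) = nsq (u - v).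
Proof. by apply: eq_bigr => j _; rewrite !tnth_mktuple !mxE. Qed.

Lemma measurable_nsq d' (T : measurableType d') d (f : T -> 'rV[R]_d) :
  (forall i, measurable_fun setT (fun x => f x 0 i)) ->
  measurable_fun setT (fun x => nsq (f x)).
Proof. by move=> mf; apply: measurable_sum => i; exact: measurable_funX. Qed.

Lemma nsq_tcons d t (y : d.-tuple R) :
  nsq (rv (tcons t y)) = t ^+ 2 + nsq (rv y).
Proof.
rewrite /nsq big_ord_recl; congr (_ + _); first by rewrite mxE.
by apply: eq_bigr => j _; rewrite !mxE tnthS.
Qed.

End squared_norm.

Section stdgauss_integrals.
Local Open Scope ereal_scope.
Context {R : realType}.
Local Notation T1 := (measurableTypeR R).
Local Notation N01 := (normal_prob (0 : R) 1 : probability (measurableTypeR R) R).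

Lemma ge0_integral_stdgauss_tcons2 d (f : d.+1.-tuple R -> \bar R) :
  measurable_fun setT f -> (forall x, 0 <= f x)%E ->
  (\int[stdgauss d.+1]_x f x =
   \int[stdgauss d]_y \int[N01]_t f (tcons t y))%E.
Proof.
move=> mf f0; have mfc : measurable_fun setT
    (fun xy : measurableTypeR R * d.-tuple R => f (tcons xy.1 xy.2)).
  exact: (measurableT_comp mf (@measurable_tcons R d)).
rewrite [LHS](ge0_integral_stdgauss_tcons mf f0).
have := @fubini_tonelli2 _ _ _ _ R N01 (stdgauss d) _ mfc (fun x => f0 _).
by have -> := @fubini_tonelli1 _ _ _ _ R N01 (stdgauss d) _ mfc (fun x => f0 _).
Qed.

Lemma integral_stdgauss0 (f : 0.-tuple R -> \bar R) :
  \int[stdgauss 0]_x f x = f [tuple].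
Proof.
rewrite (_ : f = cst (f [tuple])); last by apply/funext => x; rewrite (tuple0 x).
exact: integral_cst_probability.
Qed.

Lemma stdgauss_exp_nsq d : exists C : R,
  \int[stdgauss d]_x (expR (nsq (rv x) / 4))%:E = C%:E.
Proof.
elim: d => [|d [C CE]]; first by eexists; rewrite integral_stdgauss0.
have m e : measurable_fun setT (fun x : e.-tuple R => (expR (nsq (rv x) / 4))%:E).
  apply/measurable_EFinP; apply: measurableT_comp => //; apply: measurable_funM => //.
  by apply: measurable_nsq => i; exact: measurable_rv.
have s2 : (0 < Num.sqrt (2^-1 : R))%R by rewrite sqrtr_gt0 invr_gt0.
exists ((Num.sqrt (2^-1))^-1 * C)%R.
rewrite [LHS](ge0_integral_stdgauss_tcons (m _) (fun=> expR_ge0 _)).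
rewrite EFinM -(normal_exp_sqr s2) -ge0_integralZr; last 4 first.
- by [].
- have := measurable_expR_sqr ((1 - Num.sqrt (2^-1 : R) ^+ 2) / 2) 1 0.
  by under eq_fun do rewrite mul1r addr0.
- by move=> t _; rewrite lee_fin expR_ge0.
- by rewrite -CE; apply: integral_ge0 => x _; rewrite lee_fin expR_ge0.
apply: eq_integral => t _; rewrite -CE -ge0_integralZl_EFin ?expR_ge0//.
- apply: eq_integral => y _; rewrite nsq_tcons -EFinM -expRD; congr (expR _)%:E.
  by rewrite sqr_sqrtr ?invr_ge0//; lra.
- exact: m.
Qed.

Let C1 : R := (normal_peak (1 : R) * Num.sqrt pi)%R.

(** Only coordinate [k] is integrated with [normal_exp_shift]. The others enter through the shift,
    on which that bound does not depend. *)
Lemma stdgauss_exp_linear d (l : 'cV[R]_d) (e : R) (k : 'I_d) : l k 0%R != 0%R ->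
  \int[stdgauss d]_x (expR (- (e + (rv x *m l) 0 0) ^+ 2))%:E <=
  (C1 / `|l k 0%R|)%:E.
Proof.
elim: d l e k => [l e []//|d IH l e k].
have m (e' : R) p (l' : 'cV[R]_p) : measurable_fun setT
    (fun x : p.-tuple R => (expR (- (e' + (rv x *m l') 0 0) ^+ 2))%:E).
  apply/measurable_EFinP; apply: measurableT_comp => //; apply: measurableT_comp => //.
  apply: measurable_funX; apply: measurable_funD => //.
  by apply: measurable_mulmx => i; exact: measurable_rv.
have lE t (y : d.-tuple R) : ((rv (tcons t y) *m l) 0 0 =
    l 0 0 * t + (rv y *m \col_j l (lift 0 j) 0) 0 0)%R.
  rewrite !mxE big_ord_recl; congr (_ + _)%R; first by rewrite mxE mulrC.
  by apply: eq_bigr => j _; rewrite !mxE tnthS.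
case: (unliftP 0%R k) => [j ->|-> l0].
  move=> lj; rewrite [leLHS](ge0_integral_stdgauss_tcons (m _ _ _) (fun=> expR_ge0 _)).
  rewrite -[leRHS](integral_cst_probability N01); apply: ge0_le_integral => //.
  - by move=> t _; apply: integral_ge0 => y _; rewrite lee_fin expR_ge0.
  - have mc : measurable_fun setT (fun ty : T1 * d.-tuple R =>
        (expR (- (e + (rv (tcons ty.1 ty.2) *m l) 0 0) ^+ 2))%:E).
      exact: (measurableT_comp (m e _ l) (@measurable_tcons R d)).
    exact: (@measurable_fun_fubini_tonelli_F _ _ _ _ R (stdgauss d) _ mc (fun=> expR_ge0 _)).
  move=> t _; under eq_integral do rewrite lE addrA.
  have := IH (\col_j l (lift 0%R j) 0%R) (e + l 0 0 * t)%R j.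
  by rewrite mxE; exact.
rewrite [leLHS](ge0_integral_stdgauss_tcons2 (m _ _ _) (fun=> expR_ge0 _)).
rewrite -[leRHS](integral_cst_probability (stdgauss d)); apply: ge0_le_integral => //.
- by move=> t _; apply: integral_ge0 => y _; rewrite lee_fin expR_ge0.
- have mc : measurable_fun setT (fun ty : T1 * d.-tuple R =>
      (expR (- (e + (rv (tcons ty.1 ty.2) *m l) 0 0) ^+ 2))%:E).
    exact: (measurableT_comp (m e _ l) (@measurable_tcons R d)).
  exact: (@measurable_fun_fubini_tonelli_G _ _ _ _ R N01 _ mc (fun=> expR_ge0 _)).
move=> y _; under eq_integral do rewrite lE addrCA.
exact: normal_exp_shift.
Qed.

(** [KL_young] with [g = nsq / 4] and [h = 0]; the factor 1/4 lies below 1/2, so that the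
    exponential is integrable against the Gaussian. *)
Lemma KL_stdgauss_moment d : exists2 C : R, (0 <= C)%R &
  forall q : probability (d.-tuple R) R,
  \int[q]_x (nsq (rv x))%:E <= 4%:E * KL q (stdgauss d) + C%:E.
Proof.
have [C CE] := stdgauss_exp_nsq d.
have C0 : (0 <= C)%R.
  by rewrite -lee_fin -CE; apply: integral_ge0 => x _; rewrite lee_fin expR_ge0.
exists (4 * C)%R; first by rewrite mulr_ge0.
move=> q; have mn : measurable_fun setT (fun x : d.-tuple R => nsq (rv x)).
  by apply: measurable_nsq => i; exact: measurable_rv.
have mn4 : measurable_fun setT (fun x : d.-tuple R => nsq (rv x) / 4)%R.
  exact: measurable_funM.
have n0 (x : d.-tuple R) : (0 <= nsq (rv x) / 4)%R by rewrite divr_ge0// nsq_ge0.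
have := KL_young q (stdgauss d) mn4 n0 (measurable_cst (0%R : R)) (fun=> lexx _).
rewrite integral0 adde0; under [X in _ <= _ + X -> _]eq_integral do rewrite subr0.
rewrite CE => H.
rewrite EFinM -muleDr ?fin_num_adde_defl//.
apply: le_trans (lee_wpmul2l _ H); rewrite ?lee_fin//.
rewrite -ge0_integralZl_EFin//.
- rewrite le_eqVlt; apply/orP; left; apply/eqP; apply: eq_integral => x _.
  by rewrite -EFinM mulrCA divff// mulr1.
- by move=> x _; rewrite lee_fin.
- exact/measurable_EFinP.
Qed.

(** [KL_young] with [g] constant and [h] the squared affine form. If [c] exceeds the entropy plus
    the second moment, the last term is bounded below, which bounds the entry of [l]: a law of
    finite entropy cannot concentrate near a hyperplane. *)
Lemma KL_stdgauss_linear d (q : probability (d.-tuple R) R) (l : 'cV[R]_d)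
    (e c : R) (k : 'I_d) : (0 <= c)%R -> l k 0%R != 0%R ->
  c%:E <= KL q (stdgauss d) + \int[q]_x ((e + (rv x *m l) 0 0) ^+ 2)%:E +
    (expR c * (C1 / `|l k 0%R|))%:E.
Proof.
move=> c0 lk0; have ml : measurable_fun setT (fun x : d.-tuple R => e + (rv x *m l) 0 0)%R.
  by apply: measurable_funD => //; apply: measurable_mulmx => i; exact: measurable_rv.
have ml2 : measurable_fun setT (fun x : d.-tuple R => (e + (rv x *m l) 0 0) ^+ 2)%R.
  exact: measurable_funX.
have := KL_young q (stdgauss d) (measurable_cst c) (fun=> c0) ml2 (fun=> sqr_ge0 _).
have -> : \int[q]_x (cst c x)%:E = c%:E by exact: (integral_cst_probability q c%:E).
move=> /le_trans; apply; rewrite leeD2l//.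
under eq_integral do rewrite /cst/= expRD EFinM.
rewrite ge0_integralZl_EFin ?expR_ge0//; last first.
  by apply/measurable_EFinP; apply: measurableT_comp => //; exact: measurableT_comp.
by rewrite EFinM lee_wpmul2l ?lee_fin ?expR_ge0//; exact: stdgauss_exp_linear.
Qed.

End stdgauss_integrals.

(** * The cost in mean--factor coordinates *)

Section gaussian_cost.
Context {R : realType} (d : nat) (tau0 tau1 : R).
Hypotheses (tau0_gt0 : 0 < tau0) (tau1_gt0 : 0 < tau1).
Local Notation X := (d.-tuple R).
Local Notation gam := (stdgauss d : probability (d.-tuple R) R).
Implicit Types (m : 'rV[R]_d) (L : 'M[R]_d).

(* [N(m, L^T L)] is the law of [m + z *m L] for [z] standard normal. The cost below
   is defined for every [L]; for singular [L] it need not be a [shape_cost]. *)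
Definition qcost m1 L1 m L (xy : X * X) : R :=
  nsq ((m1 + rv xy.1 *m L1) - (m + rv xy.2 *m L)).

Definition gcostE m1 L1 m L : \bar R :=
  ucost_inf tau0 tau1 (qcost m1 L1 m L) gam gam.

Definition gcost m1 L1 m L : R := fine (gcostE m1 L1 m L).

Lemma measurable_rv1 i : measurable_fun setT (fun xy : X * X => rv xy.1 0 i).
Proof. by apply: measurable_rv; exact: measurable_fst. Qed.

Lemma measurable_rv2 i : measurable_fun setT (fun xy : X * X => rv xy.2 0 i).
Proof. by apply: measurable_rv; exact: measurable_snd. Qed.

Lemma measurable_qcost m1 L1 m L : measurable_fun setT (qcost m1 L1 m L).
Proof.
apply: measurable_nsq; apply: measurable_addv => i.
  by apply: measurable_addv => // j; apply: measurable_mulmx; exact: measurable_rv1.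
under eq_fun do rewrite mxE; apply: measurableT_comp => //.
by apply: measurable_addv => // j; apply: measurable_mulmx; exact: measurable_rv2.
Qed.

Lemma qcost_ge0 m1 L1 m L xy : 0 <= qcost m1 L1 m L xy.
Proof. exact: nsq_ge0. Qed.

Lemma shape_cost_gaussian m1 L1 m L : L1 \in unitmx -> L \in unitmx ->
  shape_cost tau0 tau1 (gaussian m1 (L1^T *m L1)) (gaussian m (L^T *m L)) =
  gcostE m1 L1 m L.
Proof.
move=> uL1 uL; rewrite (shape_costE (ltW tau0_gt0) (ltW tau1_gt0)).
rewrite (ucost_inf_ext _ _ _ (gaussian_push m1 uL1) (gaussian_push m uL)).
pose inv v M (x : X) : X := tv ((rv x - v) *m invmx M).
have minv v M : measurable_fun setT (inv v M).
  apply: measurable_tv; apply: measurable_mulmx; apply: measurable_addv => // i.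
  exact: measurable_rv.
have K1 v M : M \in unitmx -> cancel (affine v M) (inv v M).
  by move=> uM x; rewrite /inv /affine tvK addrC addKr mulmxK// rvK.
have K2 v M : M \in unitmx -> cancel (inv v M) (affine v M).
  by move=> uM x; rewrite /inv /affine tvK mulmxKV// addrC subrK rvK.
rewrite (ucost_inf_push tau0 tau1 (measurable_affine_tuple m1 L1)
  (minv m1 L1) (measurable_affine_tuple m L) (minv m L) (K1 _ _ uL1) (K1 _ _ uL)
  (K2 _ _ uL1) (K2 _ _ uL)); last 2 first.
- exact: measurable_sqdist.
- by move=> xy; exact: sqdist_ge0.
rewrite /gcostE (_ : (fun xy => _) = qcost m1 L1 m L)//.
by apply/funext => xy; rewrite sqdist_tv.
Qed.

(** Rotation invariance of the standard normal law; the argument also covers singular factors, for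
    which it is needed to bring a kernel vector to the first coordinate axis. *)
Lemma gcostE_orthogonal m1 L1 m L (U W : 'M[R]_d) :
  U^T *m U = 1%:M -> W^T *m W = 1%:M ->
  gcostE m1 (U *m L1) m (W *m L) = gcostE m1 L1 m L.
Proof.
move=> UU WW; rewrite [RHS]/gcostE.
rewrite (ucost_inf_ext _ _ _ (stdgauss_orthogonal UU) (stdgauss_orthogonal WW)).
have K1 (M : 'M[R]_d) : M^T *m M = 1%:M -> cancel (affine 0 M) (affine 0 M^T).
  move=> MM x; rewrite /affine !add0r tvK -mulmxA.
  by have [_ uM] := mulmx1_unit MM; rewrite (mulmx1C MM) mulmx1 rvK.
have K2 (M : 'M[R]_d) : M^T *m M = 1%:M -> cancel (affine 0 M^T) (affine 0 M).
  by move=> MM x; rewrite /affine !add0r tvK -mulmxA MM mulmx1 rvK.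
rewrite (ucost_inf_push tau0 tau1 (measurable_affine_tuple 0 U)
  (measurable_affine_tuple 0 U^T) (measurable_affine_tuple 0 W)
  (measurable_affine_tuple 0 W^T) (K1 _ UU) (K1 _ WW)
  (K2 _ UU) (K2 _ WW)); last 2 first.
- exact: measurable_qcost.
- exact: qcost_ge0.
rewrite /gcostE [in RHS](_ : (fun xy => _) = qcost m1 (U *m L1) m (W *m L))//.
by apply/funext => xy; rewrite /qcost /affine !add0r !tvK !mulmxA.
Qed.

Section plans.
Local Open Scope ereal_scope.

(** Real bounds on the three terms of the cost of a plan, so that estimates can be carried out in
    [R]. *)
Definition plan_bound (c : X * X -> R) (p : probability (X * X)%type R) (i k0 k1 : R) :=
  [/\ \int[p]_xy (c xy)%:E <= i%:E, KL (push p measurable_fst) gam <= k0%:E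
    & KL (push p measurable_snd) gam <= k1%:E].

Lemma ucost_plan_bound c p i k0 k1 : plan_bound c p i k0 k1 ->
  ucost tau0 tau1 c gam gam p <= (i + tau0 * k0 + tau1 * k1)%:E.
Proof.
move=> [ci c0 c1]; rewrite ucost_probability !EFinD !EFinM.
apply: leeD; [apply: leeD => //|];
  by apply: lee_wpmul2l => //; rewrite lee_fin ltW.
Qed.

Lemma gcostE_ge0 m1 L1 m L : 0 <= gcostE m1 L1 m L.
Proof.
by apply: ucost_inf_ge0 => [||xy]; [exact: ltW|exact: ltW|exact: qcost_ge0].
Qed.

Lemma gcostE_le m1 L1 m L p i k0 k1 : plan_bound (qcost m1 L1 m L) p i k0 k1 ->
  gcostE m1 L1 m L <= (i + tau0 * k0 + tau1 * k1)%:E.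
Proof. by move=> /ucost_plan_bound; apply: le_trans; exact: ucost_inf_le. Qed.

Lemma push_moment1 (p : probability (X * X)%type R) :
  \int[p]_xy (nsq (rv xy.1))%:E = \int[push p measurable_fst]_x (nsq (rv x))%:E.
Proof.
rewrite [RHS](ge0_integral_push p measurable_fst)//.
  by apply/measurable_EFinP; apply: measurable_nsq => i; exact: measurable_rv.
by move=> x; rewrite lee_fin nsq_ge0.
Qed.

Lemma push_moment2 (p : probability (X * X)%type R) :
  \int[p]_xy (nsq (rv xy.2))%:E = \int[push p measurable_snd]_x (nsq (rv x))%:E.
Proof.
rewrite [RHS](ge0_integral_push p measurable_snd)//.
  by apply/measurable_EFinP; apply: measurable_nsq => i; exact: measurable_rv.
by move=> x; rewrite lee_fin nsq_ge0.
Qed.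

Lemma integral_plan_le (p : probability (X * X)%type R) (c e f : X * X -> R)
    (al be ga i j : R) :
  measurable_fun setT c -> (forall x, 0 <= c x)%R ->
  measurable_fun setT e -> (forall x, 0 <= e x)%R ->
  measurable_fun setT f -> (forall x, 0 <= f x)%R ->
  (0 <= al)%R -> (0 <= be)%R -> (0 <= ga)%R ->
  (forall x, c x <= al + be * e x + ga * f x)%R ->
  \int[p]_x (e x)%:E <= i%:E -> \int[p]_x (f x)%:E <= j%:E ->
  \int[p]_x (c x)%:E <= (al + be * i + ga * j)%:E.
Proof.
move=> mc c0 me e0 mf f0 al0 be0 ga0 cle ei fj.
have meE : measurable_fun setT (EFin \o e) by exact/measurable_EFinP.
have mfE : measurable_fun setT (EFin \o f) by exact/measurable_EFinP.
apply: (@le_trans _ _ (\int[p]_x (al%:E + be%:E * (e x)%:E + ga%:E * (f x)%:E))).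
  apply: ge0_le_integral => //.
  - by move=> x _; rewrite lee_fin.
  - exact/measurable_EFinP.
  - apply: emeasurable_funD; first apply: emeasurable_funD => //; exact: emeasurable_funM.
  - by move=> x _; rewrite -!EFinM -!EFinD lee_fin.
have n1 x : 0 <= be%:E * (e x)%:E by rewrite mule_ge0 ?lee_fin.
have n2 x : 0 <= ga%:E * (f x)%:E by rewrite mule_ge0 ?lee_fin.
have n3 x : 0 <= al%:E + be%:E * (e x)%:E by apply: adde_ge0.
have m1 : measurable_fun setT (fun x => be%:E * (e x)%:E) by exact: emeasurable_funM.
have m2 : measurable_fun setT (fun x => ga%:E * (f x)%:E) by exact: emeasurable_funM.
rewrite ge0_integralD//; last exact: emeasurable_funD.
rewrite ge0_integralD// (integral_cst_probability p).
have e0E x : [set: X * X] x -> 0 <= (e x)%:E by rewrite lee_fin.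
have f0E x : [set: X * X] x -> 0 <= (f x)%:E by rewrite lee_fin.
rewrite (ge0_integralZl_EFin _ _ e0E)// (ge0_integralZl_EFin _ _ f0E)//.
rewrite !EFinD !EFinM; apply: leeD; last exact: lee_wpmul2l.
by apply: leeD => //; exact: lee_wpmul2l.
Qed.

Lemma measurable_moment1 : measurable_fun setT (fun xy : X * X => nsq (rv xy.1)).
Proof. by apply: measurable_nsq => i; exact: measurable_rv1. Qed.

Lemma measurable_moment2 : measurable_fun setT (fun xy : X * X => nsq (rv xy.2)).
Proof. by apply: measurable_nsq => i; exact: measurable_rv2. Qed.

Lemma qcost_le m1 L1 m L (x y : X) : (qcost m1 L1 m L (x, y) <=
  4 * nsq m1 + 4 * nsq m + 4 * frob L1 * nsq (rv x) + 4 * frob L * nsq (rv y))%R.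
Proof.
rewrite /qcost/=; apply: le_trans (nsqD2 _ _) _; rewrite nsqN.
have := nsqD2 m1 (rv x *m L1); have := nsqD2 m (rv y *m L).
have := nsq_mulmx (rv x) L1; have := nsq_mulmx (rv y) L.
lra.
Qed.

Lemma gcostE_fin m1 L1 m L : gcostE m1 L1 m L \is a fin_num.
Proof.
rewrite ge0_fin_numE ?gcostE_ge0//.
have [C C0 momC] := @KL_stdgauss_moment R d.
(* The independent coupling has zero entropies and finite second moments. *)
pose p : probability (X * X)%type R := gam \x gam.
have p1 A : measurable A -> push p measurable_fst A = gam A.
  move=> mA; rewrite -[RHS]mule1 -[in RHS](probability_setT gam).
  rewrite -(@product_measure1E _ _ _ _ R gam gam A setT mA measurableT).
  by congr (p _); apply/seteqP; split => x //= [].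
have p2 A : measurable A -> push p measurable_snd A = gam A.
  move=> mA; rewrite -[RHS]mul1e -[in RHS](probability_setT gam).
  rewrite -(@product_measure1E _ _ _ _ R gam gam setT A measurableT mA).
  by congr (p _); apply/seteqP; split => x //= [].
have KL1 : KL (push p measurable_fst) gam = 0.
  by rewrite -(KL_self gam); exact: KL_ext.
have KL2 : KL (push p measurable_snd) gam = 0.
  by rewrite -(KL_self gam); exact: KL_ext.
suff : plan_bound (qcost m1 L1 m L) p
    (4 * nsq m1 + 4 * nsq m + (4 * frob L1) * C + (4 * frob L) * C)%R 0 0.
  by move=> /gcostE_le /le_lt_trans; apply; rewrite ltry.
split; [|by rewrite KL1|by rewrite KL2].
apply: (integral_plan_le (measurable_qcost _ _ _ _) (qcost_ge0 _ _ _ _)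
  measurable_moment1 (fun=> nsq_ge0 _) measurable_moment2 (fun=> nsq_ge0 _)).
- by rewrite addr_ge0// mulr_ge0// nsq_ge0.
- by rewrite mulr_ge0// frob_ge0.
- by rewrite mulr_ge0// frob_ge0.
- by move=> [x y]; exact: qcost_le.
- by rewrite push_moment1; have := momC (push p measurable_fst); rewrite KL1 mule0 add0e.
- by rewrite push_moment2; have := momC (push p measurable_snd); rewrite KL2 mule0 add0e.
Qed.

Lemma gcostE_EFin m1 L1 m L : gcostE m1 L1 m L = (gcost m1 L1 m L)%:E.
Proof. by rewrite fineK// gcostE_fin. Qed.

Lemma gcost_ge0 m1 L1 m L : (0 <= gcost m1 L1 m L)%R.
Proof. by rewrite -lee_fin -gcostE_EFin gcostE_ge0. Qed.

Lemma gcost_le m1 L1 m L p i k0 k1 : plan_bound (qcost m1 L1 m L) p i k0 k1 ->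
  (gcost m1 L1 m L <= i + tau0 * k0 + tau1 * k1)%R.
Proof. by move=> /gcostE_le; rewrite gcostE_EFin lee_fin. Qed.

Lemma gcost_plan m1 L1 m L e : (0 < e)%R ->
  exists (p : probability (X * X)%type R) (i k0 k1 : R),
  [/\ plan_bound (qcost m1 L1 m L) p i k0 k1,
    0 <= i, 0 <= k0, 0 <= k1 & i + tau0 * k0 + tau1 * k1 < gcost m1 L1 m L + e]%R.
Proof.
move=> e0; have : gcostE m1 L1 m L < (gcost m1 L1 m L + e)%:E.
  by rewrite gcostE_EFin lte_fin ltrDl.
move=> /ereal_inf_lt[_ [p _ <-]]; rewrite ucost_probability.
have : 0 <= \int[p]_xy (qcost m1 L1 m L xy)%:E.
  by apply: integral_ge0 => x _; rewrite lee_fin qcost_ge0.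
have := KL_ge0 (push p measurable_fst) gam.
have := KL_ge0 (push p measurable_snd) gam.
case E1 : (KL (push p measurable_snd) gam) => [k1||]// k10; last first.
  rewrite (gt0_muley (x := tau1%:E)) ?lte_fin//.
  case E0 : (KL _ _) => [k0||]// k00; case: (\int[p]_xy _) => [i||]// i0;
    by rewrite ?gt0_muley ?lte_fin.
case E0 : (KL (push p measurable_fst) gam) => [k0||]// k00; last first.
  rewrite (gt0_muley (x := tau0%:E)) ?lte_fin//.
  by case: (\int[p]_xy _) => [i||]// i0.
case I : (\int[p]_xy _) => [i||]// i0; rewrite -!EFinM -!EFinD lte_fin => lt.
exists p, i, k0, k1; split => //.
by split; rewrite ?I ?E0 ?E1.
Qed.

End plans.

End gaussian_cost.

(** * Continuity and coercivity of the cost in (m, L) *)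

Section gaussian_cost_regularity.
Context {R : realType} (d : nat) (tau0 tau1 : R).
Hypotheses (tau0_gt0 : 0 < tau0) (tau1_gt0 : 0 < tau1).
Variables (m1 : 'rV[R]_d) (L1 : 'M[R]_d).
Implicit Types (m : 'rV[R]_d) (L : 'M[R]_d).
Local Notation gcost := (gcost tau0 tau1 m1 L1).

Let qcost_perturb m L m' L' e x y : 0 < e ->
  qcost m1 L1 m' L' (x, y) <=
  (1 + e^-1) * (2 * nsq (m - m')) + (1 + e) * qcost m1 L1 m L (x, y) +
  ((1 + e^-1) * (2 * frob (L - L'))) * nsq (rv y).
Proof.
move=> e0; rewrite /qcost/=.
have -> : m1 + rv x *m L1 - (m' + rv y *m L') =
    (m1 + rv x *m L1 - (m + rv y *m L)) + ((m - m') + rv y *m (L - L')).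
  by rewrite mulmxBr [(m - m') + _]addrACA -opprD addrA subrK.
apply: le_trans (nsqD_le _ _ e0) _.
have H : nsq (m - m' + rv y *m (L - L')) <=
    2 * nsq (m - m') + 2 * (nsq (rv y) * frob (L - L')).
  by have := nsqD2 (m - m') (rv y *m (L - L')); have := nsq_mulmx (rv y) (L - L'); lra.
have k0 : 0 <= 1 + e^-1 by rewrite addr_ge0// invr_ge0 ltW.
have := ler_wpM2l k0 H; lra.
Qed.

(** A near-optimal plan for (m, L) is reused for (m', L'): its entropies are unchanged, and the
    quadratic cost changes by terms in the second moment of its second marginal. Entropy bounds that
    moment, and the cost divided by [tau1] bounds the entropy. *)
Lemma gcost_perturb : exists2 K : R, 0 < K & forall m L m' L' e, 0 < e ->
  gcost m' L' <= gcost m L + e * gcost m L +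
    (1 + e^-1) * (nsq (m - m') + frob (L - L')) * (K * (1 + gcost m L)).
Proof.
have [C C0 momC] := @KL_stdgauss_moment R d.
(* 8 is 2 from [qcost_perturb] times 4 from the moment bound; the division by [tau1] turns a bound
   on [tau1 * k1] into one on [k1]. *)
pose v := 8 / tau1; have v0 : 0 <= v by rewrite divr_ge0// ltW.
exists (2 + 2 * C + v); first by lra.
move=> m L m' L' e e0; set g := gcost m L.
have g0 : 0 <= g by exact: gcost_ge0.
set A := nsq (m - m'); set B := frob (L - L').
have A0 : 0 <= A by exact: nsq_ge0.
have B0 : 0 <= B by exact: frob_ge0.
set u := 1 + e^-1; have u0 : 0 <= u by rewrite addr_ge0// invr_ge0 ltW.
set coef := (1 + e) + u * B * v.
have uBv : 0 <= u * B * v by rewrite mulr_ge0// mulr_ge0.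
have coef0 : 0 < coef by rewrite /coef; lra.
suff key : forall h, 0 < h -> gcost m' L' <= coef * (g + h) + u * (2 * A) + u * (2 * B) * C.
  have {}key : gcost m' L' <= coef * g + u * (2 * A) + u * (2 * B) * C.
    apply/ler_addgt0Pr => h h0; have := key (h / coef) (divr_gt0 h0 coef0).
    by rewrite mulrDr [coef * (h / _)]mulrC divfK ?gt_eqF//; lra.
  apply: (le_trans key); rewrite /coef.
  have : 0 <= u * A * (2 * C + v + (2 + 2 * C + v) * g).
    by rewrite !mulr_ge0// addr_ge0 ?mulr_ge0//; lra.
  have : 0 <= u * B * (2 + v + (2 + 2 * C) * g).
    by rewrite !mulr_ge0// addr_ge0 ?mulr_ge0//; lra.
  by lra.
move=> h h0; have [p [i [k0 [k1 [pb i0 k00 k10 ilt]]]]] :=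
  gcost_plan tau0_gt0 tau1_gt0 m1 L1 m L h0.
have [pc p0 p1] := pb.
have mom : (\int[p]_xy (nsq (rv xy.2))%:E <= (4 * k1 + C)%:E)%E.
  rewrite push_moment2; apply: le_trans (momC _) _.
  rewrite [leRHS](_ : _ = (4%:E * k1%:E + C%:E)%E)//.
  by rewrite leeD2r// lee_wpmul2l ?lee_fin.
have pb' : plan_bound (qcost m1 L1 m' L') p
    (u * (2 * A) + (1 + e) * i + u * (2 * B) * (4 * k1 + C)) k0 k1.
  split; [|exact: p0|exact: p1].
  apply: (@integral_plan_le R d p (qcost m1 L1 m' L') (qcost m1 L1 m L)
    (fun xy => nsq (rv xy.2)) (u * (2 * A)) (1 + e) (u * (2 * B)) i (4 * k1 + C)
    (measurable_qcost _ _ _ _) (qcost_ge0 _ _ _ _)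
    (measurable_qcost _ _ _ _) (qcost_ge0 _ _ _ _)
    (@measurable_moment2 R d) (fun=> nsq_ge0 _)) => //.
  - by apply: mulr_ge0 => //; exact: mulr_ge0.
  - by rewrite addr_ge0// ltW.
  - by apply: mulr_ge0 => //; exact: mulr_ge0.
  - by move=> [x y]; exact: qcost_perturb.
apply: le_trans (gcost_le tau0_gt0 tau1_gt0 pb') _.
have H1 : (1 + e) * (i + tau0 * k0 + tau1 * k1) <= (1 + e) * (g + h).
  by apply: ler_wpM2l; [rewrite addr_ge0// ltW|exact: ltW].
have H2 : u * B * v * (tau1 * k1) <= u * B * v * (g + h).
  apply: ler_wpM2l => //; apply/ltW/(le_lt_trans _ ilt).
  by rewrite lerDr addr_ge0// mulr_ge0// ltW.
have E : u * B * v * (tau1 * k1) = u * B * (8 * k1).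
  by rewrite /v; field; rewrite gt_eqF.
have H3 : 0 <= e * (tau0 * k0 + tau1 * k1).
  by rewrite mulr_ge0 ?(ltW e0)// addr_ge0// mulr_ge0// ltW.
move: H1 H2 H3; rewrite E /coef; lra.
Qed.

Let le_via_product (n f g u w P : R) : n * f <= n * P -> g <= n * f ->
  u <= 2 * w + 2 * g -> u <= 2 * w + 2 * P * n.
Proof. lra. Qed.

(** A plan of bounded cost has bounded entropies, hence bounded second moments, and so has the image
    m + y L of its second marginal. [KL_stdgauss_linear], applied to the columns of [L], then bounds
    its entries, and m = (m + y L) - y L is bounded in turn. *)
Lemma gcost_coercive (b : R) : exists2 K : R, 0 <= K & forall m L,
  gcost m L <= b -> (forall j, `|m 0 j| <= K) /\ (forall k j, `|L k j| <= K).
Proof.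
have [C C0 momC] := @KL_stdgauss_moment R d.
pose C1 : R := normal_peak 1 * Num.sqrt pi.
have C10 : 0 <= C1 by rewrite mulr_ge0 ?sqrtr_ge0// normal_peak_ge0.
pose k0 := (`|b| + 1) / tau0; pose k1 := (`|b| + 1) / tau1.
have k00 : 0 <= k0 by rewrite divr_ge0 ?(ltW tau0_gt0)// addr_ge0.
have k10 : 0 <= k1 by rewrite divr_ge0 ?(ltW tau1_gt0)// addr_ge0.
pose K2 := 4 * nsq m1 + 2 * (`|b| + 1) + 4 * frob L1 * (4 * k0 + C).
have K20 : 0 <= K2.
  rewrite /K2 !addr_ge0 ?mulr_ge0 ?nsq_ge0 ?frob_ge0 ?addr_ge0//.
  by rewrite mulr_ge0.
(* One more than the entropy and moment bounds together, so that the last term of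
   [KL_stdgauss_linear] is at least 1. *)
pose c := k1 + K2 + 1; have c0 : 0 <= c by rewrite /c; lra.
(* From here on [KL] is a real number, the bound on the entries of [L]. *)
pose KL := expR c * C1.
have KL0 : 0 <= KL by rewrite mulr_ge0// expR_ge0.
pose KM := 2 * K2 + 2 * (d%:R * d%:R * KL ^+ 2) * (4 * k1 + C).
have k1C0 : 0 <= 4 * k1 + C by lra.
have dKL0 : 0 <= 2 * (d%:R * d%:R * KL ^+ 2).
  by rewrite mulr_ge0// mulr_ge0 ?sqr_ge0// mulr_ge0.
have KM0 : 0 <= KM.
  by rewrite /KM; have := mulr_ge0 dKL0 k1C0; lra.
exists (KL + KM + 1); first by lra.
move=> m L gb.
have [p [i [l0 [l1 [[pc p0 p1] i0 l00 l10 ilt]]]]] :=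
  gcost_plan tau0_gt0 tau1_gt0 m1 L1 m L ltr01.
have lt1 : i + tau0 * l0 + tau1 * l1 < `|b| + 1.
  by apply: (lt_le_trans ilt); rewrite lerD2r (le_trans gb)// ler_norm.
have t00 : 0 <= tau0 * l0 by rewrite mulr_ge0// ltW.
have t10 : 0 <= tau1 * l1 by rewrite mulr_ge0// ltW.
have le0 : l0 <= k0 by rewrite /k0 ler_pdivlMr// mulrC; lra.
have le1 : l1 <= k1 by rewrite /k1 ler_pdivlMr// mulrC; lra.
have mom1 : (\int[p]_xy (nsq (rv xy.1))%:E <= (4 * k0 + C)%:E)%E.
  rewrite push_moment1; apply: le_trans (momC _) _.
  rewrite [leRHS](_ : _ = (4%:E * k0%:E + C%:E)%E)//.
  rewrite leeD2r// lee_wpmul2l ?lee_fin//.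
  by apply: le_trans p0 _; rewrite lee_fin.
have mom2 : (\int[p]_xy (nsq (rv xy.2))%:E <= (4 * k1 + C)%:E)%E.
  rewrite push_moment2; apply: le_trans (momC _) _.
  rewrite [leRHS](_ : _ = (4%:E * k1%:E + C%:E)%E)//.
  rewrite leeD2r// lee_wpmul2l ?lee_fin//.
  by apply: le_trans p1 _; rewrite lee_fin.
pose Y (xy : d.-tuple R * d.-tuple R) := m + rv xy.2 *m L.
have mY : measurable_fun setT (fun xy => nsq (Y xy)).
  apply: measurable_nsq; apply: measurable_addv => // j.
  by apply: measurable_mulmx; exact: measurable_rv2.
have momY : (\int[p]_xy (nsq (Y xy))%:E <= K2%:E)%E.
  have pc' : (\int[p]_xy (qcost m1 L1 m L xy)%:E <= (`|b| + 1)%:E)%E.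
    by apply: le_trans pc _; rewrite lee_fin; lra.
  apply: (@integral_plan_le R d p (fun xy => nsq (Y xy)) (qcost m1 L1 m L)
    (fun xy => nsq (rv xy.1)) (4 * nsq m1) 2 (4 * frob L1) (`|b| + 1) (4 * k0 + C)
    mY (fun=> nsq_ge0 _) (measurable_qcost m1 L1 m L) (qcost_ge0 _ _ _ _)
    (@measurable_moment1 R d) (fun=> nsq_ge0 _) _ _ _ _ pc' mom1) => //.
  - by rewrite mulr_ge0// nsq_ge0.
  - by rewrite mulr_ge0// frob_ge0.
  move=> [x y]; rewrite /qcost /Y/=.
  set v := m + _; set w := m1 + _.
  have := nsqD2 w (- (w - v)); rewrite nsqN opprB addrCA subrr addr0.
  have := nsqD2 m1 (rv x *m L1); have := nsq_mulmx (rv x) L1; rewrite -/w.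
  by lra.
have Lle k j : `|L k j| <= KL.
  have [->|Lkj] := eqVneq (L k j) 0; first by rewrite normr0.
  have colkj : col j L k 0 != 0 by rewrite mxE.
  have := KL_stdgauss_linear (push p measurable_snd) (m 0 j) c0 colkj.
  have mcol : measurable_fun setT (fun x : d.-tuple R => (m 0 j + (rv x *m col j L) 0 0) ^+ 2).
    apply: measurable_funX; apply: measurable_funD => //.
    by apply: measurable_mulmx => s; exact: measurable_rv.
  have -> : (\int[push p measurable_snd]_x ((m 0 j + (rv x *m col j L) 0 0) ^+ 2)%:E =
      \int[p]_xy ((Y xy 0 j) ^+ 2)%:E)%E.
    rewrite (ge0_integral_push p measurable_snd)//; last first.
    - by move=> x; rewrite lee_fin sqr_ge0.
    - exact/measurable_EFinP.
    apply: eq_integral => xy _; rewrite /Y !mxE; congr ((_ + _) ^+ 2)%:E.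
    by apply: eq_bigr => s _; rewrite !mxE.
  have YK : (\int[p]_xy ((Y xy 0 j) ^+ 2)%:E <= K2%:E)%E.
    apply: le_trans momY; apply: ge0_le_integral => //.
    - by move=> xy _; rewrite lee_fin sqr_ge0.
    - apply/measurable_EFinP; apply: measurable_funX; apply: measurable_addv => // s.
      by apply: measurable_mulmx; exact: measurable_rv2.
    - exact/measurable_EFinP.
    - move=> xy _; rewrite lee_fin /nsq (bigD1 j)//= lerDl.
      by apply: sumr_ge0 => s _; exact: sqr_ge0.
  rewrite mxE => H.
  have : (c%:E <= (k1 + K2 + expR c * (C1 / `|L k j|))%:E)%E.
    apply: le_trans H _; rewrite !EFinD leeD2r// leeD//.
    by apply: le_trans p1 _; rewrite lee_fin.
  rewrite lee_fin {1}/c => Hc.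
  have : 1 <= expR c * (C1 / `|L k j|) by move: Hc; lra.
  by rewrite mulrA ler_pdivlMr ?normr_gt0// mul1r.
split=> [j|k j]; last by apply: le_trans (Lle k j) _; lra.
have frobL : frob L <= d%:R * d%:R * KL ^+ 2.
  have -> : d%:R * d%:R * KL ^+ 2 = \sum_(i < d) \sum_(j < d) KL ^+ 2.
    rewrite sumr_const card_ord -[RHS]mulr_natl sumr_const card_ord.
    by rewrite -[X in _ = _ * X]mulr_natl mulrA.
  apply: ler_sum => s _; apply: ler_sum => t _.
  by have := Lle s t; rewrite ler_norml => /andP[? ?]; rewrite !expr2; nra.
have frob0 := frob_ge0 L.
have : ((m 0 j ^+ 2)%:E <= KM%:E)%E.
  rewrite -(integral_cst_probability p (m 0 j ^+ 2)%:E).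
  have -> : KM = 0 + 2 * K2 + 2 * (d%:R * d%:R * KL ^+ 2) * (4 * k1 + C) by rewrite add0r.
  apply: (@integral_plan_le R d p (fun=> m 0 j ^+ 2) (fun xy => nsq (Y xy))
    (fun xy => nsq (rv xy.2)) 0 2 (2 * (d%:R * d%:R * KL ^+ 2)) K2 (4 * k1 + C)
    (measurable_cst _) (fun=> sqr_ge0 _) mY (fun=> nsq_ge0 _)
    (@measurable_moment2 R d) (fun=> nsq_ge0 _) _ _ _ _ momY mom2) => //.
  - move=> [x y]; rewrite add0r.
    have mj : m 0 j ^+ 2 <= nsq m.
      by rewrite /nsq (bigD1 j)//= lerDl; apply: sumr_ge0 => s _; exact: sqr_ge0.
    apply: (le_trans mj); rewrite /Y /=.
    have := nsqD2 (Y (x, y)) (- (rv y *m L)); rewrite nsqN /Y/= addrK.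
    exact: le_via_product (ler_wpM2l (nsq_ge0 (rv y)) frobL) (nsq_mulmx (rv y) L).
rewrite lee_fin => mK.
(* Only the square of [m 0 j] has been bounded, by [KM]; a number larger than 1 is at most its
   square, which explains the [+ 1] in the final bound. *)
have [|m1'] := lerP `|m 0 j| 1; first by lra.
have : `|m 0 j| <= `|m 0 j| ^+ 2 by rewrite expr2 ler_peMr// ltW.
by rewrite -normrX (ger0_norm (sqr_ge0 _)); lra.
Qed.

End gaussian_cost_regularity.

(** * First-order gain at a singular factor *)

Section product_push.
Local Open Scope ereal_scope.
Context d1 d2 d3 (S : measurableType d1) (Y : measurableType d2)
  (Z : measurableType d3) (R : realType).
Variables (N : probability S R) (p : probability Y R) (g : Y -> Z).
Hypothesis mg : measurable_fun setT g.

Lemma ge0_integral_prod_push (f : S * Z -> \bar R) : measurable_fun setT f ->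
  (forall x, 0 <= f x) ->
  \int[N \x push p mg]_x f x = \int[N \x p]_x f (x.1, g x.2).
Proof.
move=> mf f0; have mfg : measurable_fun setT (fun x : S * Y => f (x.1, g x.2)).
  apply: (measurableT_comp mf); apply: measurable_fun_pair => //.
  exact: (measurableT_comp mg measurable_snd).
rewrite fubini_tonelli1// fubini_tonelli1//; apply: eq_integral => s _.
rewrite /fubini_F [LHS](ge0_integral_push p mg)//.
by apply: (measurableT_comp mf); exact: measurable_fun_pair.
Qed.

End product_push.

Section stdgauss_resample.
Local Open Scope ereal_scope.
Context {R : realType} (d : nat) (tau kap : R) (e : d.-tuple R -> R).
Hypotheses (tau_gt0 : (0 < tau)%R) (me : measurable_fun setT e).
Local Notation T1 := (measurableTypeR R).
Local Notation N01 := (normal_prob (0 : R) 1 : probability (measurableTypeR R) R).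
Local Notation X := (d.+1.-tuple R).
Local Notation Y := (d.-tuple R).

(* The density of [N(0, 1)] times [exp (- (kap t + e y)^2 / tau)] is, up to a factor,
   that of [N(- gibbs_slope * e y, gibbs_var)]. *)
Definition gibbs_var : R := (tau / (tau + 2 * kap ^+ 2))%R.
Definition gibbs_dev : R := Num.sqrt gibbs_var.
Definition gibbs_slope : R := (2 * kap / tau * gibbs_var)%R.

Let den_gt0 : (0 < tau + 2 * kap ^+ 2)%R.
Proof. by rewrite ltr_pwDl// mulr_ge0// sqr_ge0. Qed.

Lemma gibbs_var_gt0 : (0 < gibbs_var)%R. Proof. exact: divr_gt0. Qed.

Lemma gibbs_dev_gt0 : (0 < gibbs_dev)%R.
Proof. by rewrite sqrtr_gt0 gibbs_var_gt0. Qed.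

Lemma gibbs_dev_sqr : (gibbs_dev ^+ 2 = gibbs_var)%R.
Proof. by rewrite sqr_sqrtr// ltW// gibbs_var_gt0. Qed.

Definition gibbs_map (ty : T1 * Y) : T1 :=
  (gibbs_dev * ty.1 - gibbs_slope * e ty.2)%R.

Lemma measurable_gibbs_map : measurable_fun setT gibbs_map.
Proof.
apply: measurable_funB; apply: measurable_funM => //.
exact: (measurableT_comp me measurable_snd).
Qed.

Definition potential (x : X) : R := ((kap * thead x + e (tbehead x)) ^+ 2)%R.

Lemma measurable_potential : measurable_fun setT potential.
Proof.
apply: measurable_funX; apply: measurable_funD.
  by apply: measurable_funM => //; exact: measurable_thead.
exact: (measurableT_comp me (@measurable_tbehead R d)).
Qed.

(** The weight of [normal_push_density] for mean [- gibbs_slope * e y] and deviation [gibbs_dev];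
    completing the square in [lnk] shows that it is the Gibbs density of [V / tau]. *)
Let k (ty : T1 * Y) : R := (gibbs_dev^-1 *
  expR (ty.1 ^+ 2 / 2 - (ty.1 - - (gibbs_slope * e ty.2)) ^+ 2 / (2 * gibbs_dev ^+ 2)))%R.

Let V (ty : T1 * Y) : R := ((kap * ty.1 + e ty.2) ^+ 2)%R.

Let c (y : Y) : R := (ln gibbs_dev^-1 + e y ^+ 2 / tau -
  (gibbs_slope * e y) ^+ 2 / (2 * gibbs_dev ^+ 2))%R.

Let me2 : measurable_fun setT (fun ty : T1 * Y => e ty.2).
Proof. exact: (measurableT_comp me measurable_snd). Qed.

Let m1 : measurable_fun setT (fun ty : T1 * Y => ty.1 : T1).
Proof. exact: measurable_fst. Qed.

Let mk : measurable_fun setT k.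
Proof.
apply: measurable_funM => //; apply: measurableT_comp => //.
apply: measurable_funB; apply: measurable_funM => //; apply: measurable_funX => //.
by apply: measurable_funB => //; apply: measurableT_comp => //; exact: measurable_funM.
Qed.

Let k_gt0 ty : (0 < k ty)%R.
Proof. by rewrite mulr_gt0 ?expR_gt0// invr_gt0 gibbs_dev_gt0. Qed.

Let mV : measurable_fun setT V.
Proof. by apply: measurable_funX; apply: measurable_funD => //; exact: measurable_funM. Qed.

Let V_ge0 ty : (0 <= V ty)%R. Proof. exact: sqr_ge0. Qed.

Let lnk ty : ln (k ty) = (c ty.2 - tau^-1 * V ty)%R.
Proof.
rewrite lnM ?posrE ?invr_gt0 ?gibbs_dev_gt0 ?expR_gt0// expRK /c /V gibbs_dev_sqr.
rewrite /gibbs_slope /gibbs_var; field.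
by rewrite !gt_eqF.
Qed.

Let Fk (f : T1 -> \bar R) y : measurable_fun setT f -> (forall t, 0 <= f t) ->
  \int[N01]_t f (gibbs_map (t, y)) = \int[N01]_t (f t * (k (t, y))%:E).
Proof.
by move=> mf f0; exact: (normal_push_density (- (gibbs_slope * e y)) gibbs_dev_gt0 mf f0).
Qed.

Definition tuncons (x : X) : T1 * Y := (thead x, tbehead x).

Lemma measurable_tuncons : measurable_fun setT tuncons.
Proof.
apply: measurable_fun_pair; [exact: measurable_thead|exact: measurable_tbehead].
Qed.

Let mtcons := @measurable_tcons R d.

Local Notation M := (N01 \x stdgauss d : probability (T1 * d.-tuple R)%type R).

Definition gauss_resample (q : probability X R) : probability X R :=
  push (resample N01 measurable_gibbs_map (push q measurable_tuncons)) mtcons.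

Lemma integral_gauss_resample (q : probability X R) (f : X -> \bar R) :
  measurable_fun setT f -> (forall x, 0 <= f x) ->
  \int[gauss_resample q]_x f x =
  \int[N01 \x q]_x f (tcons (gibbs_map (x.1, tbehead x.2)) (tbehead x.2)).
Proof.
move=> mf f0; rewrite [LHS](ge0_integral_push _ mtcons mf f0).
have mG : measurable_fun setT (fun ty : T1 * Y => (gibbs_map ty, ty.2)).
  by apply: measurable_fun_pair => //; exact: measurable_gibbs_map.
have mf' : measurable_fun setT (fun ty : T1 * Y => f (tcons ty.1 ty.2)).
  exact: (measurableT_comp mf mtcons).
have mf'' : measurable_fun setT (fun ty : T1 * Y => f (tcons (gibbs_map ty) ty.2)).
  exact: (measurableT_comp mf' mG).
rewrite [LHS](ge0_integral_push _ _ mf' (fun=> f0 _)).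
rewrite [LHS](ge0_integral_prod_push _ _ _ mf'' (fun=> f0 _)).
have mf3 : measurable_fun setT (fun ty : T1 * (T1 * Y) =>
    f (tcons (gibbs_map (ty.1, ty.2.2)) ty.2.2)).
  apply: (measurableT_comp mf''); apply: measurable_fun_pair => //.
  exact: (measurableT_comp measurable_snd measurable_snd).
by rewrite [LHS](ge0_integral_prod_push _ _ _ mf3 (fun=> f0 _)).
Qed.

(** [resample_le] read through the splitting of a tuple into head and tail, which turns the standard
    normal law into a product and preserves divergences. *)
Lemma gauss_resample_le (q : probability X R) :
  \int[gauss_resample q]_x (potential x)%:E +
    tau%:E * KL (gauss_resample q) (stdgauss d.+1) <=
  \int[q]_x (potential x)%:E + tau%:E * KL q (stdgauss d.+1).
Proof.
have mpot : measurable_fun setT (EFin \o potential).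
  by apply/measurable_EFinP; exact: measurable_potential.
have := @resample_le _ _ T1 Y R N01 (stdgauss d) tau gibbs_map k V c tau_gt0
  measurable_gibbs_map mk k_gt0 mV V_ge0 lnk Fk (push q measurable_tuncons).
have -> : \int[push q measurable_tuncons]_x (V x)%:E = \int[q]_x (potential x)%:E.
  rewrite [LHS](ge0_integral_push q measurable_tuncons)//.
  exact/measurable_EFinP.
have -> : KL (push q measurable_tuncons) M = KL q (stdgauss d.+1).
  rewrite -(KL_push q (stdgauss d.+1) measurable_tuncons mtcons (@tcons_thead R d)).
  apply: KL_ext => // A mA.
  have mA' : measurable (tuncons @^-1` A).
    by rewrite -[X in measurable X]setTI; exact: measurable_tuncons.
  rewrite [RHS](stdgauss_tcons mA'); congr ((N01 \x stdgauss d) _).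
  by apply/seteqP; split => -[t y]; rewrite /preimage/= /tuncons tbehead_tcons.
move=> H; apply: le_trans H; rewrite /gauss_resample.
set r := resample _ _ _; apply: leeD.
  rewrite [leLHS](ge0_integral_push r mtcons mpot (fun=> sqr_ge0 _)).
  rewrite le_eqVlt; apply/orP; left; apply/eqP; apply: eq_integral => -[t y] _ /=.
  by rewrite /potential tbehead_tcons.
rewrite lee_wpmul2l ?lee_fin ?(ltW tau_gt0)//.
have tunconsK : cancel (fun xy : T1 * Y => tcons xy.1 xy.2) tuncons.
  by move=> [t y]; rewrite /tuncons tbehead_tcons.
rewrite -(KL_push r M mtcons measurable_tuncons tunconsK).
rewrite le_eqVlt; apply/orP; left; apply/eqP; apply: KL_ext => // A mA.
exact: stdgauss_tcons.
Qed.

End stdgauss_resample.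

Lemma fin_of_sum_le (R : realType) (a k b : \bar R) (x t y : R) :
  (0 <= a)%E -> (0 <= k)%E -> (0 <= b)%E -> 0 < t ->
  (a + x%:E + t%:E * k + b <= y%:E)%E ->
  exists a' k' b', [/\ a = a'%:E, k = k'%:E, b = b'%:E & a' + x + t * k' + b' <= y].
Proof.
case: a => [a||]//; case: b => [b||]//; case: k => [k||]// _ _ _ t0;
  rewrite ?gt0_muley ?lte_fin//.
by rewrite -EFinM -!EFinD lee_fin => H; exists a, k, b.
Qed.

Section gaussian_cost_improvement.
Context {R : realType} (d : nat) (tau0 tau1 : R).
Hypotheses (tau0_gt0 : 0 < tau0) (tau1_gt0 : 0 < tau1).
Local Notation T1 := (measurableTypeR R).
Local Notation N01 := (normal_prob (0 : R) 1 : probability (measurableTypeR R) R).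
Local Notation X := (d.+1.-tuple R).
Local Notation Y := (d.-tuple R).
Variables (m1 m : 'rV[R]_d.+1) (L1 L : 'M[R]_d.+1) (u : 'rV[R]_d.+1) (kap : R).
Local Notation e0 := (delta_mx 0 0 : 'rV[R]_d.+1).
Hypotheses (u_unit : nsq u = 1) (e0L1 : e0 *m L1 = kap *: u).
Hypotheses (e0L : e0 *m L = 0) (Lu : L *m u^T = 0) (kap_gt0 : 0 < kap).

Let rv_split (x : X) : rv x = thead x *: e0 + rv (tcons 0 (tbehead x)).
Proof.
apply/rowP => j; rewrite !mxE; case: (unliftP 0 j) => [k ->|->].
  rewrite tnthS (_ : (lift 0 k == 0) = false) ?andbF ?mulr0 ?add0r; last first.
    by apply/negbTE; rewrite eq_sym neq_lift.
  by rewrite [in LHS](tuple_eta x) tnthS.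
by rewrite !eqxx mulr1 [X in _ + X](_ : _ = 0) ?addr0.
Qed.

Let rv_e0 (y : X) : rv y *m e0^T = (thead y)%:M.
Proof.
apply/matrixP => i j; rewrite !mxE !ord1 eqxx mulr1n.
rewrite (bigD1 0)//= !mxE !eqxx mulr1 big1 ?addr0// => k k0.
by rewrite !mxE (negbTE k0) andbF mulr0.
Qed.

Let w (xy : X * X) : 'rV[R]_d.+1 := (m1 + rv xy.1 *m L1) - (m + rv xy.2 *m L).

Let dot_u (v : 'rV[R]_d.+1) : R := (v *m u^T) 0 0.

Let e (y : Y) : R := dot_u (m1 - m + rv (tcons 0 y) *m L1).

Let Q (xy : X * X) : R := nsq (w xy - dot_u (w xy) *: u).

Let dot_uD v v' : dot_u (v + v') = dot_u v + dot_u v'.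
Proof. by rewrite /dot_u mulmxDl mxE. Qed.

Let dot_uZ a v : dot_u (a *: v) = a * dot_u v.
Proof. by rewrite /dot_u -scalemxAl mxE. Qed.

Let dot_uu : dot_u u = 1.
Proof. by rewrite /dot_u -nsqE. Qed.

(** The head of [x] contributes through [e0 L1 = kap u]; the point [y] does not contribute, because
    [L u^T = 0]. *)
Let dot_w x y : dot_u (w (x, y)) = kap * thead x + e (tbehead x).
Proof.
rewrite /w /= (rv_split x) mulmxDl -scalemxAl e0L1 opprD.
have -> : dot_u (m1 + (thead x *: (kap *: u) + rv (tcons 0 (tbehead x)) *m L1) +
      (- m - rv y *m L)) =
    dot_u ((m1 - m + rv (tcons 0 (tbehead x)) *m L1) + (thead x *: (kap *: u) - rv y *m L)).
  by congr dot_u; apply/rowP => j; rewrite !mxE; ring.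
rewrite dot_uD addrC; congr (_ + _); rewrite dot_uD !dot_uZ dot_uu mulr1 mulrC.
by rewrite /dot_u mulNmx -mulmxA Lu mulmx0 oppr0 mxE addr0.
Qed.

(** Changing the head of [x] moves the displacement along [u] only, and changing that of [y] does
    not move it, as [e0 L = 0]. Both heads can therefore be redrawn at no expense in [Q]. *)
Let Q_tcons t s x y : Q (tcons t (tbehead x), tcons s (tbehead y)) = Q (x, y).
Proof.
have wE x' y' : w (x', y') = (thead x' * kap) *: u +
    w (tcons 0 (tbehead x'), tcons 0 (tbehead y')).
  rewrite /w /= (rv_split x') (rv_split y') !mulmxDl -!scalemxAl e0L1 e0L scaler0 add0r scalerA.
  by apply/rowP => j; rewrite !mxE; ring.
have QE x' y' : Q (x', y') = Q (tcons 0 (tbehead x'), tcons 0 (tbehead y')).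
  rewrite /Q; set v := w (tcons 0 _, _); rewrite (wE x' y') -/v.
  rewrite dot_uD dot_uZ dot_uu mulr1 scalerDl; congr nsq.
  by apply/rowP => j; rewrite !mxE; ring.
by rewrite QE [RHS]QE !tbehead_tcons.
Qed.

Let nsq_split v : nsq v = dot_u v ^+ 2 + nsq (v - dot_u v *: u).
Proof.
have dE : dot_u v = \sum_j v 0 j * u 0 j.
  by rewrite /dot_u mxE; apply: eq_bigr => j _; rewrite mxE.
have -> : nsq (v - dot_u v *: u) =
    nsq v - 2 * dot_u v * (\sum_j v 0 j * u 0 j) + dot_u v ^+ 2 * nsq u.
  rewrite /nsq !mulr_sumr -sumrB -big_split/=; apply: eq_bigr => j _.
  by rewrite !mxE; ring.
by rewrite -dE u_unit; ring.
Qed.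

Let qcost_split x y : qcost m1 L1 m L (x, y) =
  (kap * thead x + e (tbehead x)) ^+ 2 + Q (x, y).
Proof. by rewrite /qcost -/(w (x, y)) nsq_split -/(Q (x, y)) dot_w. Qed.

Let Leps (eps : R) : 'M[R]_d.+1 := L + eps *: (e0^T *m u).

Let qcost_eps eps x y : qcost m1 L1 m (Leps eps) (x, y) =
  (kap * thead x + e (tbehead x) - eps * thead y) ^+ 2 + Q (x, y).
Proof.
have wE : m1 + rv x *m L1 - (m + rv y *m Leps eps) = w (x, y) - (eps * thead y) *: u.
  rewrite /w /Leps /= mulmxDr -scalemxAr mulmxA rv_e0 mul_scalar_mx scalerA.
  by apply/rowP => j; rewrite !mxE; ring.
rewrite /qcost /= wE nsq_split -(dot_w x y) -scaleNr dot_uD dot_uZ dot_uu mulr1; congr (_ + _).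
by rewrite /Q; congr nsq; apply/rowP => j; rewrite !mxE; ring.
Qed.

Let measurable_w i : measurable_fun setT (fun xy : X * X => w xy 0 i).
Proof.
move: i; apply: measurable_addv => i.
  by apply: measurable_addv => // j; apply: measurable_mulmx; exact: measurable_rv1.
under eq_fun do rewrite mxE; apply: measurableT_comp => //.
by apply: measurable_addv => // j; apply: measurable_mulmx; exact: measurable_rv2.
Qed.

Let mQ : measurable_fun setT Q.
Proof.
apply: measurable_nsq; apply: measurable_addv => // i.
under eq_fun do rewrite !mxE; apply: measurableT_comp => //; apply: measurable_funM => //.
exact: measurable_mulmx.
Qed.

Let Q_ge0 xy : 0 <= Q xy. Proof. exact: nsq_ge0. Qed.

Let me : measurable_fun setT e.
Proof.
apply: measurable_mulmx; apply: measurable_addv => // i; apply: measurable_mulmx => j.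
by apply: measurable_rv; exact: measurable_tcons_comp.
Qed.

Local Open Scope ereal_scope.

(** The noise [z.1] is independent of the plan and centered, so averaging over it first only adds
    its variance [B ^+ 2 * M]. *)
Let integral_shift (M : R) (p : probability (X * X)%type R) (A P : X * X -> R) (B : R) :
  (forall a b : R, \int[N01]_t ((a + b * t) ^+ 2)%:E = (a ^+ 2 + b ^+ 2 * M)%:E) ->
  (0 <= M)%R ->
  measurable_fun setT A -> measurable_fun setT P -> (forall x, 0 <= P x)%R ->
  \int[N01 \x p]_z ((A z.2 + B * z.1) ^+ 2 + P z.2)%:E =
  \int[p]_x (A x ^+ 2)%:E + (B ^+ 2 * M)%:E + \int[p]_x (P x)%:E.
Proof.
move=> ME M0 mA mP P0.
have m2 : measurable_fun setT (fun z : T1 * (X * X) => ((A z.2 + B * z.1) ^+ 2)%:E).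
  apply/measurable_EFinP; apply: measurable_funX; apply: measurable_funD.
    exact: (measurableT_comp mA measurable_snd).
  by apply: measurable_funM => //; exact: measurable_fst.
have m3 : measurable_fun setT (fun z : T1 * (X * X) => (P z.2)%:E).
  by apply/measurable_EFinP; exact: (measurableT_comp mP measurable_snd).
have BM0 : (0 <= B ^+ 2 * M)%R by rewrite mulr_ge0// sqr_ge0.
have mA2 : measurable_fun setT (fun x => (A x ^+ 2)%:E).
  by apply/measurable_EFinP; exact: measurable_funX.
under eq_integral do rewrite EFinD.
have n2 (z : T1 * (X * X)) : 0 <= ((A z.2 + B * z.1) ^+ 2)%:E by exact: sqr_ge0.
have n3 (z : T1 * (X * X)) : 0 <= (P z.2)%:E by exact: P0.
have nA x : 0 <= (A x ^+ 2)%:E by exact: sqr_ge0.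
rewrite ge0_integralD// fubini_tonelli2// fubini_tonelli2//; congr (_ + _); last first.
  by apply: eq_integral => x _; exact: (integral_cst_probability N01 (P x)%:E).
under eq_integral do rewrite /fubini_G /= ME EFinD.
rewrite ge0_integralD//.
by rewrite (integral_cst_probability p).
Qed.

(** Without a potential the Gibbs law is N(0, 1) itself: resampling puts the bare noise in the first
    coordinate. *)
Let gmap0 t (y : Y) : gibbs_map tau1 0 (cst (0%R : R)) (t, y) = t.
Proof.
rewrite /gibbs_map /gibbs_slope /gibbs_dev /gibbs_var /= mulr0 subr0.
by rewrite expr0n mulr0 addr0 divff ?gt_eqF// sqrtr1 mul1r.
Qed.

(** A single noise [z.1] drives both heads. Each marginal of the image is still the resampling of
    the corresponding marginal of the plan, so the entropy bounds do not see the correlation. *)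
Let Phi (z : T1 * (X * X)) : X * X :=
  (tcons (gibbs_map tau0 kap e (z.1, tbehead z.2.1)) (tbehead z.2.1),
   tcons z.1 (tbehead z.2.2)).

Let measurable_z21 : measurable_fun setT (fun z : T1 * (X * X) => z.2.1).
Proof. exact: (measurableT_comp measurable_fst measurable_snd). Qed.

Let measurable_z22 : measurable_fun setT (fun z : T1 * (X * X) => z.2.2).
Proof. exact: (measurableT_comp measurable_snd measurable_snd). Qed.

Let mPhi : measurable_fun setT Phi.
Proof.
have mb : measurable_fun setT (fun z : T1 * (X * X) => tbehead z.2.1).
  exact: (measurableT_comp (@measurable_tbehead R d) measurable_z21).
apply: measurable_fun_pair; apply: measurable_tcons_comp => //.
- apply: (measurableT_comp (measurable_gibbs_map tau0 kap me)).
  by apply: measurable_fun_pair => //; exact: measurable_fst.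
- exact: (measurableT_comp (@measurable_tbehead R d) measurable_z22).
Qed.

Let Pi (p : probability (X * X)%type R) : probability (X * X)%type R :=
  push (N01 \x p) mPhi.

Let marginal1_Pi p A : measurable A ->
  push (Pi p) measurable_fst A =
  gauss_resample tau0 kap me (push p measurable_fst) A.
Proof.
apply: eq_measure_ge0_integral => f mf f0.
have mf1 : measurable_fun setT (fun x : X * X => f x.1).
  exact: (measurableT_comp mf measurable_fst).
rewrite [LHS](ge0_integral_push _ measurable_fst mf f0).
rewrite [LHS](ge0_integral_push _ mPhi mf1 (fun=> f0 _)).
rewrite [RHS](integral_gauss_resample _ _ me _ mf f0).
have mg : measurable_fun setT (fun x : T1 * X =>
    f (tcons (gibbs_map tau0 kap e (x.1, tbehead x.2)) (tbehead x.2))).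
  have mb : measurable_fun setT (fun z : T1 * X => tbehead z.2).
    exact: (measurableT_comp (@measurable_tbehead R d) measurable_snd).
  apply: (measurableT_comp mf); apply: measurable_tcons_comp => //.
  apply: (measurableT_comp (measurable_gibbs_map tau0 kap me)).
  by apply: measurable_fun_pair => //; exact: measurable_fst.
by rewrite [RHS](ge0_integral_prod_push _ _ _ mg (fun=> f0 _)).
Qed.

Let marginal2_Pi p A : measurable A ->
  push (Pi p) measurable_snd A =
  gauss_resample tau1 0 (measurable_cst (0%R : R)) (push p measurable_snd) A.
Proof.
apply: eq_measure_ge0_integral => f mf f0.
have mf1 : measurable_fun setT (fun x : X * X => f x.2).
  exact: (measurableT_comp mf measurable_snd).
rewrite [LHS](ge0_integral_push _ measurable_snd mf f0).
rewrite [LHS](ge0_integral_push _ mPhi mf1 (fun=> f0 _)).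
rewrite [RHS](integral_gauss_resample _ _ _ _ mf f0).
have mg : measurable_fun setT (fun x : T1 * X =>
    f (tcons (gibbs_map tau1 0 (cst (0%R : R)) (x.1, tbehead x.2)) (tbehead x.2))).
  under eq_fun do rewrite gmap0.
  apply: (measurableT_comp mf); apply: measurable_tcons_comp => //.
  exact: (measurableT_comp (@measurable_tbehead R d) measurable_snd).
rewrite [RHS](ge0_integral_prod_push _ _ _ mg (fun=> f0 _)).
by apply: eq_integral => z _; rewrite gmap0.
Qed.

(* Since [e0 L = 0] and [L u^T = 0], the cost sees the first coordinate of the
   first marginal only through the component along [u], and does not see the first
   coordinate of the second marginal at all. After Gibbs resampling the former is
   [b xi + ...] with [xi] a fresh standard normal; taking [xi] as the latter, the
   perturbation [eps e0^T u] of [L] removes part of the noise. *)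
Lemma gcost_improve : exists c M : R, [/\ 0 < c, 0 < M & forall eps,
  gcost tau0 tau1 m1 L1 m (L + eps *: (e0^T *m u)) <=
  gcost tau0 tau1 m1 L1 m L + (eps ^+ 2 - 2 * c * eps) * M]%R.
Proof.
have [M M0 ME] := @normal_sqr_moment R.
have dev0 := gibbs_dev_gt0 kap tau0_gt0.
set be := gibbs_dev tau0 kap in dev0.
(* After resampling, the component along [u] carries the noise [kap * be * z.1]; the perturbation
   changes its coefficient to [kap * be - eps]. The difference of the two variances is the claimed
   change. *)
exists (kap * be)%R, M; split => //; first exact: mulr_gt0.
move=> eps; apply/ler_addgt0Pr => h h0.
have [p [i [k0 [k1 [[pc p0 p1] i0 k00 k10 ilt]]]]] :=
  gcost_plan tau0_gt0 tau1_gt0 m1 L1 m L h0.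
(* The noise-free part of the component along [u] once the head of the first point has been
   redrawn. *)
pose A (xy : X * X) : R := ((1 - kap * gibbs_slope tau0 kap) * e (tbehead xy.1))%R.
have mA : measurable_fun setT A.
  apply: measurable_funM => //; apply: (measurableT_comp me).
  exact: (measurableT_comp (@measurable_tbehead R d) measurable_fst).
pose E2 := \int[p]_x (A x ^+ 2)%:E; pose IQ := \int[p]_x (Q x)%:E.
have E20 : 0 <= E2 by apply: integral_ge0 => x _; exact: sqr_ge0.
have IQ0 : 0 <= IQ by apply: integral_ge0 => x _; exact: Q_ge0.
pose q0 := gauss_resample tau0 kap me (push p measurable_fst).
(* With zero potential the resampling inequality says that replacing the head by an independent
   standard normal does not raise the entropy. *)
pose q1 := gauss_resample tau1 0 (measurable_cst (0%R : R)) (push p measurable_snd).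
have mpot : measurable_fun setT (EFin \o potential kap e).
  by apply/measurable_EFinP; exact: measurable_potential.
have potE : \int[q0]_x (potential kap e x)%:E = E2 + ((kap * be) ^+ 2 * M)%:E.
  rewrite [LHS](integral_gauss_resample _ _ me _ mpot (fun=> sqr_ge0 _)).
  rewrite [LHS](@ge0_integral_prod_push _ _ _ _ _ _ R N01 p fst measurable_fst
    (fun x => (potential kap e (tcons (gibbs_map tau0 kap e (x.1, tbehead x.2))
      (tbehead x.2)))%:E)); last 2 first.
  - have mb : measurable_fun setT (fun z : T1 * X => tbehead z.2).
      exact: (measurableT_comp (@measurable_tbehead R d) measurable_snd).
    apply: (measurableT_comp mpot); apply: measurable_tcons_comp => //.
    apply: (measurableT_comp (measurable_gibbs_map tau0 kap me)).
    by apply: measurable_fun_pair => //; exact: measurable_fst.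
  - by move=> x; exact: sqr_ge0.
  have := @integral_shift M p A (cst (0%R : R)) (kap * be)%R ME (ltW M0) mA
    (measurable_cst _) (fun=> lexx _).
  rewrite [X in _ = _ + X](integral_cst_probability p 0) adde0 => <-.
  apply: eq_integral => z _; rewrite /potential tbehead_tcons /gibbs_map /A /= addr0.
  by congr (_ ^+ 2)%:E; rewrite thead_tcons -/be; ring.
have costE : \int[Pi p]_xy (qcost m1 L1 m (Leps eps) xy)%:E =
    E2 + ((kap * be - eps) ^+ 2 * M)%:E + IQ.
  rewrite [LHS](ge0_integral_push _ mPhi); last 2 first.
  - by apply/measurable_EFinP; exact: measurable_qcost.
  - by move=> x; exact: qcost_ge0.
  rewrite -(@integral_shift M p A Q (kap * be - eps)%R ME (ltW M0) mA mQ Q_ge0).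
  apply: eq_integral => -[t [x y]] _; rewrite /Phi /= qcost_eps !tbehead_tcons Q_tcons.
  by congr ((_ ^+ 2 + _)%:E); rewrite !thead_tcons /A /gibbs_map /= -/be; ring.
have cost0 : \int[push p measurable_fst]_x (potential kap e x)%:E + IQ <= i%:E.
  rewrite (ge0_integral_push _ measurable_fst mpot (fun=> sqr_ge0 _)) -ge0_integralD//.
  - apply: le_trans pc; rewrite le_eqVlt; apply/orP; left; apply/eqP.
    by apply: eq_integral => -[x y] _; rewrite qcost_split.
  - by move=> x _; exact: sqr_ge0.
  - exact: (measurableT_comp mpot measurable_fst).
  - by move=> x _; exact: Q_ge0.
  - exact/measurable_EFinP.
have KL0 := KL_ge0 q0 (stdgauss d.+1); have KL1 := KL_ge0 q1 (stdgauss d.+1).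
have H0 : E2 + ((kap * be) ^+ 2 * M)%:E + tau0%:E * KL q0 (stdgauss d.+1) + IQ <=
    (i + tau0 * k0)%:E.
  have := gauss_resample_le kap tau0_gt0 me (push p measurable_fst).
  rewrite -/q0 potE => H; apply: (le_trans (leeD2r IQ H)).
  rewrite addeAC EFinD EFinM; apply: leeD; first exact: cost0.
  by apply: lee_wpmul2l; [rewrite lee_fin ltW|exact: p0].
have H1 : KL q1 (stdgauss d.+1) <= k1%:E.
  have := gauss_resample_le 0 tau1_gt0 (measurable_cst (0%R : R)) (push p measurable_snd).
  have pot0 (q : probability X R) : \int[q]_x (potential 0 (cst (0%R : R)) x)%:E = 0.
    rewrite -[RHS](integral_cst_probability q); apply: eq_integral => x _.
    by rewrite /potential mul0r addr0 expr0n.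
  rewrite !pot0 !add0e lee_pmul2l ?lte_fin// => KLle.
  exact: le_trans KLle p1.
have K0 : KL (push (Pi p) measurable_fst) (stdgauss d.+1) = KL q0 (stdgauss d.+1).
  by apply: KL_ext => [B mB|B _]; [exact: marginal1_Pi|].
have K1 : KL (push (Pi p) measurable_snd) (stdgauss d.+1) = KL q1 (stdgauss d.+1).
  by apply: KL_ext => [B mB|B _]; [exact: marginal2_Pi|].
have [e2 [kq [iq [E2E KE IE {}H0]]]] := fin_of_sum_le E20 KL0 IQ0 tau0_gt0 H0.
have pb : plan_bound (qcost m1 L1 m (Leps eps)) (Pi p)
    (e2 + (kap * be - eps) ^+ 2 * M + iq)%R kq k1.
  split.
  - by rewrite costE E2E IE.
  - by rewrite K0 KE.
  - by rewrite K1.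
apply: le_trans (gcost_le tau0_gt0 tau1_gt0 pb) _.
have -> : ((kap * be - eps) ^+ 2 * M = (kap * be) ^+ 2 * M +
    (eps ^+ 2 - 2 * (kap * be) * eps) * M)%R.
  by ring.
by move: H0 ilt; lra.
Qed.

End gaussian_cost_improvement.

(** * Factorizations of matrices *)

Section linear_algebra.
Context {R : realType}.

Lemma nsqZ d (a : R) (v : 'rV[R]_d) : nsq (a *: v) = a ^+ 2 * nsq v.
Proof. by rewrite /nsq mulr_sumr; apply: eq_bigr => j _; rewrite mxE exprMn. Qed.

Lemma nsq_gt0 d (v : 'rV[R]_d) : (0 < nsq v) = (v != 0).
Proof. by rewrite lt_neqAle nsq_ge0 andbT eq_sym nsq0_eq0. Qed.

Lemma nsq_normalize d (v : 'rV[R]_d) : v != 0 -> nsq ((Num.sqrt (nsq v))^-1 *: v) = 1.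
Proof.
rewrite -nsq_gt0 => v0; rewrite nsqZ exprVn sqr_sqrtr ?mulVf ?gt_eqF//.
exact: ltW.
Qed.

Lemma nsq_delta d : nsq (delta_mx 0 0 : 'rV[R]_d.+1) = 1.
Proof.
rewrite /nsq (bigD1 0)//= big1 ?addr0 => [|j j0]; rewrite mxE ?eqxx ?expr1n//.
by rewrite (negbTE j0) andbF expr0n.
Qed.

Lemma dot_sym d (u v : 'rV[R]_d) : u *m v^T = v *m u^T.
Proof.
apply/matrixP => i j; rewrite !ord1 !mxE; apply: eq_bigr => k _.
by rewrite !mxE mulrC.
Qed.

(** The reflection along v = e0 - w. Since e0 and w are unit vectors, the product of e0 and v is
    half of [nsq v], so e0 is sent to e0 - v = w. *)
Lemma householder d (w : 'rV[R]_d.+1) : nsq w = 1 ->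
  exists U : 'M[R]_d.+1, U^T *m U = 1%:M /\ delta_mx 0 0 *m U = w.
Proof.
move=> w1; set e0 : 'rV[R]_d.+1 := delta_mx 0 0.
have [v vE] : exists v, v = e0 - w by exists (e0 - w).
have [v0|v0] := eqVneq v 0.
  exists 1%:M; rewrite trmx1 mulmx1; split => //.
  by rewrite mulmx1; apply/eqP; rewrite -subr_eq0 -vE v0.
have vvE : v *m v^T = (nsq v)%:M by rewrite [LHS]mx11_scalar -nsqE.
have vn0 : nsq v != 0 by rewrite gt_eqF// nsq_gt0.
have e0v : e0 *m v^T = (nsq v / 2)%:M.
  have e0e0 : e0 *m e0^T = 1%:M by rewrite [LHS]mx11_scalar -nsqE nsq_delta.
  have ww : w *m w^T = 1%:M by rewrite [LHS]mx11_scalar -nsqE w1.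
  have : (nsq v)%:M = 2 *: (e0 *m v^T).
    rewrite -vvE vE linearB/= !mulmxBl !mulmxBr e0e0 ww (dot_sym w e0).
    by apply/matrixP => i j; rewrite !mxE; ring.
  move=> /(congr1 (fun A : 'M[R]_1 => 2^-1 *: A)); rewrite scalerA mulVf// scale1r => <-.
  by rewrite scale_scalar_mx mulrC.
pose U := 1%:M - (2 / nsq v) *: (v^T *m v); exists U.
have UT : U^T = U.
  by rewrite /U linearB/= linearZ/= trmx_mul trmxK trmx1.
split.
  rewrite UT /U mulmxBl mul1mx mulmxBr mulmx1 -!scalemxAl -!scalemxAr.
  have -> : v^T *m v *m (v^T *m v) = nsq v *: (v^T *m v).
    by rewrite mulmxA -(mulmxA v^T) vvE mul_mx_scalar -scalemxAl.
  rewrite !scalerA; apply/matrixP => i j; rewrite !mxE; field.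
  by rewrite vn0.
rewrite /U mulmxBr mulmx1 -scalemxAr mulmxA e0v mul_scalar_mx scalerA.
have -> : 2 / nsq v * (nsq v / 2) = 1 by field; rewrite vn0.
by rewrite scale1r vE opprB addrC subrK.
Qed.

Lemma spd_mulmx d (L : 'M[R]_d) : spd (L^T *m L) <-> L \in unitmx.
Proof.
have quad (x : 'rV[R]_d) : (x *m (L^T *m L) *m x^T) 0 0 = nsq (x *m L^T).
  by rewrite nsqE trmx_mul trmxK !mulmxA.
split=> [[_ pos]|uL].
  rewrite -unitmx_tr unitmxE unitfE; apply/negP => /det0P[x x0 xL].
  by have := pos x x0; rewrite quad xL /nsq big1 ?ltxx// => j _; rewrite mxE expr0n.
split=> [|x x0]; first by rewrite trmx_mul trmxK.
rewrite quad nsq_gt0; apply: contra_neq x0 => xL.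
by rewrite -(mulmxK (_ : L^T \in unitmx) x) ?unitmx_tr// xL mul0mx.
Qed.

(** Induction on the Schur complement of the corner entry, which is again symmetric positive
    definite. *)
Lemma cholesky d (S : 'M[R]_d) : spd S -> exists2 L, L \in unitmx & S = L^T *m L.
Proof.
elim: d S => [|d IH] S [symS posS].
  exists 1%:M; first by rewrite unitmx1.
  by apply/matrixP => -[].
pose a := S 0 0; pose b : 'rV[R]_d := ursubmx (S : 'M[R]_(1 + d)).
pose D : 'M[R]_d := drsubmx (S : 'M[R]_(1 + d)).
have SE : S = block_mx a%:M b b^T D :> 'M[R]_(1 + d).
  rewrite -[LHS](@submxK _ 1 d 1 d); congr block_mx.
    rewrite [LHS]mx11_scalar !mxE; congr ((S _ _)%:M); exact/val_inj.
  by rewrite -[dlsubmx _]trmxK trmx_dlsub symS.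
have a0 : 0 < a.
  have e0 : delta_mx 0 0 != 0 :> 'rV[R]_d.+1.
    by rewrite -nsq_gt0 nsq_delta.
  have := posS _ e0; rewrite -rowE.
  suff -> : (row 0 S *m (delta_mx 0 0 : 'rV[R]_d.+1)^T) 0 0 = a by [].
  by rewrite trmx_delta -colE !mxE.
have DT : D^T = D by rewrite /D trmx_drsub symS.
pose D' := D - a^-1 *: (b^T *m b).
have spdD' : spd D'.
  split=> [|y y0]; first by rewrite /D' linearB/= linearZ/= trmx_mul trmxK DT.
  (* The first coordinate minimizing the quadratic form for given [y]; the minimum is the form of
     the Schur complement. *)
  pose t := - a^-1 * (y *m b^T) 0 0.
  pose x : 'rV[R]_(1 + d) := row_mx t%:M y.
  have x0 : x != 0.
    apply: contra_neq y0 => x0; have := congr1 rsubmx x0.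
    by rewrite row_mxKr linear0.
  have := posS x x0; rewrite SE /x (@mul_row_block _ 1 1 d 1 d) (@tr_row_mx _ 1 1 d).
  rewrite (@mul_row_col _ 1 1 d 1) tr_scalar_mx.
  suff -> : ((t%:M *m a%:M + y *m b^T) *m t%:M + (t%:M *m b + y *m D) *m y^T) =
    y *m D' *m y^T by [].
  have ybE : y *m b^T = (- (a * t))%:M.
    by rewrite [LHS]mx11_scalar /t mulrA mulrN divff ?gt_eqF// mulN1r opprK.
  have byE : b *m y^T = (- (a * t))%:M by rewrite dot_sym.
  rewrite /D' mulmxBr mulmxBl -scalemxAr -scalemxAl mulmxA ybE.
  rewrite mulmxDl !mul_scalar_mx -!scalemxAl mulmxDl -!scalemxAl byE mul_scalar_mx.
  move: (y *m D *m y^T) => Z.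
  apply/matrixP => i j; rewrite !ord1 !mxE eqxx !mulr1n; field.
  by rewrite gt_eqF.
have [L' uL' D'E] := IH _ spdD'.
have [r r0 ss] : exists2 r : R, 0 < r & r ^+ 2 = a.
  by exists (Num.sqrt a); rewrite ?sqrtr_gt0// sqr_sqrtr// ltW.
pose L : 'M[R]_(1 + d) := block_mx r%:M (r^-1 *: b) 0 L'.
have uL : L \in unitmx.
  by rewrite unitmxE det_ublock det_scalar1 unitrM unitfE gt_eqF//= -unitmxE.
exists L; first exact: uL.
have rn0 : r != 0 by rewrite gt_eqF.
rewrite SE /L (@tr_block_mx _ 1 d 1 d) (@mulmx_block _ 1 d 1 d 1 d).
rewrite !trmx0 tr_scalar_mx !mulmx0 !mul0mx !addr0.
have -> : r%:M *m r%:M = a%:M :> 'M[R]_1 by rewrite -scalar_mxM -expr2 ss.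
have -> : r%:M *m (r^-1 *: b) = b by rewrite mul_scalar_mx scalerA divff// scale1r.
have bT : (r^-1 *: b)^T = r^-1 *: b^T by rewrite linearZ.
have -> : (r^-1 *: b)^T *m r%:M = b^T.
  by rewrite bT mul_mx_scalar scalerA divff// scale1r.
have -> : (r^-1 *: b)^T *m (r^-1 *: b) + L'^T *m L' = D; last by [].
by rewrite -D'E /D' bT -scalemxAl -scalemxAr scalerA -invfM -expr2 ss addrC subrK.
Qed.

End linear_algebra.

Section singular_factor.
Context {R : realType} (tau0 tau1 : R).
Hypotheses (tau0_gt0 : 0 < tau0) (tau1_gt0 : 0 < tau1).

Lemma gcost_orthogonal d m1 L1 m L (U W : 'M[R]_d) :
  U^T *m U = 1%:M -> W^T *m W = 1%:M ->
  gcost tau0 tau1 m1 (U *m L1) m (W *m L) = gcost tau0 tau1 m1 L1 m L.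
Proof. by move=> UU WW; rewrite /gcost gcostE_orthogonal. Qed.

(** [D] is chosen before [m1], [L1] and [m]: the null vectors of [L] on both sides determine it. One
    direction therefore lowers the costs of all the components at once, with constants that may
    vary. *)
Lemma gcost_singular d (L : 'M[R]_d) : L \notin unitmx ->
  exists D : 'M[R]_d, forall m1 L1 m, L1 \in unitmx ->
  exists c M : R, [/\ 0 < c, 0 < M & forall eps,
    gcost tau0 tau1 m1 L1 m (L + eps *: D) <=
    gcost tau0 tau1 m1 L1 m L + (eps ^+ 2 - 2 * c * eps) * M].
Proof.
case: d L => [|d] L; first by rewrite unitmxE det_mx00 unitr1.
move=> nuL.
have kernel (A : 'M[R]_d.+1) : A \notin unitmx -> exists2 w : 'rV_d.+1, nsq w = 1 & w *m A = 0.
  rewrite unitmxE unitfE negbK => /det0P[x x0 xA].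
  exists ((Num.sqrt (nsq x))^-1 *: x); first exact: nsq_normalize.
  by rewrite -scalemxAl xA scaler0.
have [w w1 wL] := kernel L nuL.
have [u u1 uL] : exists2 u : 'rV_d.+1, nsq u = 1 & u *m L^T = 0.
  by apply: kernel; rewrite unitmx_tr.
have Lu : L *m u^T = 0 by rewrite -[LHS]trmxK trmx_mul trmxK uL trmx0.
exists (w^T *m u) => m1 L1 m uL1.
have [H [HH e0H]] := householder w1.
(* Rotating e0 to the normalized [v] makes e0 U L1 a positive multiple of [u], with [kap] the
   inverse of the norm of [v]. *)
pose v := u *m invmx L1.
have v0 : v != 0.
  apply/negP => /eqP v0; have := mulmxKV uL1 u; rewrite -/v v0 mul0mx => u0.
  by move: u1; rewrite -u0 /nsq big1 => [/eqP|j _]; rewrite ?mxE ?expr0n// eq_sym oner_eq0.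
have [U [UU e0U]] := householder (nsq_normalize v0).
have k0 : 0 < (Num.sqrt (nsq v))^-1 by rewrite invr_gt0 sqrtr_gt0 nsq_gt0.
have e0L1 : (delta_mx 0 0 : 'rV_d.+1) *m (U *m L1) = (Num.sqrt (nsq v))^-1 *: u.
  by rewrite mulmxA e0U -scalemxAl /v mulmxKV.
have e0L : (delta_mx 0 0 : 'rV_d.+1) *m (H *m L) = 0 by rewrite mulmxA e0H.
have HLu : H *m L *m u^T = 0 by rewrite -mulmxA Lu mulmx0.
have [c [M [c0 M0 cM]]] := gcost_improve tau0_gt0 tau1_gt0 m1 m u1 e0L1 e0L HLu k0.
exists c, M; split=> [||eps]; [exact: c0|exact: M0|have := cM eps].
have -> : H *m L + eps *: ((delta_mx 0 0)^T *m u) = H *m (L + eps *: (w^T *m u)).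
  by rewrite mulmxDr -scalemxAr mulmxA -e0H trmx_mul mulmxA (mulmx1C HH) mul1mx.
by rewrite !gcost_orthogonal.
Qed.

End singular_factor.

(** * Maximization *)

Section continuity.
Context {R : realType}.

Lemma continuous_sumR (T : topologicalType) (I : finType) (F : I -> T -> R) :
  (forall i, continuous (F i)) -> continuous (fun x => \sum_i F i x).
Proof.
move=> cF; apply: (@continuous_big R I +%R 0 predT) => [|i _]; last exact: cF.
exact: add_continuous.
Qed.

Lemma continuous_mx (T : topologicalType) p q (f : T -> 'M[R]_(p, q)) :
  (forall i j, continuous (fun x => f x i j)) -> continuous f.
Proof.
move=> cf x A [P fxP sPA].
suff : nbhs x [set y | forall i j, P i j (f y i j)].
  by apply: filterS => y Py; exact: sPA.
apply: filter_forall => i; apply: filter_forall => j.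
exact: (cf i j x _ (fxP i j)).
Qed.

(** The superlevel set of [f v0] lies in a box, so a maximum over the box is global. The set of
    maximizers is a closed superlevel set inside the box. *)
Lemma compact_maximizers p (f : 'rV[R]_p -> R) (v0 : 'rV_p) (K : R) :
  continuous f -> (forall v, f v0 <= f v -> forall j, `|v 0 j| <= K) ->
  let V := [set v | forall w, f w <= f v] in V !=set0 /\ compact V.
Proof.
move=> cf bf V.
pose B := [set v : 'rV[R]_p | forall j, `[- K, K]%classic (v 0 j)].
have cB : compact B.
  by apply: (@rV_compact R p (fun=> `[- K, K]%classic)) => _; exact: segment_compact.
have sB v : f v0 <= f v -> B v.
  by move=> /bf vK j; rewrite /= in_itv/= -ler_norml; exact: vK.
have [v Bv vmax] : exists2 v, v \in B & forall w, w \in B -> f w <= f v.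
  apply: compact_EVT_max => //; last exact: continuous_subspaceT.
  by exists v0; exact: sB.
have {}vmax w : f w <= f v.
  have [wv0|/ltW v0w] := leP (f w) (f v0).
    by apply: (le_trans wv0); apply: vmax; rewrite inE; exact: sB.
  by apply: vmax; rewrite inE; exact: sB.
split; first by exists v.
apply: (@subclosed_compact _ V B) => [|//|w Vw]; last by apply: sB; exact: Vw.
have -> : V = f @^-1` [set x | f v <= x].
  apply/seteqP; split=> w /= Vw; first exact: Vw.
  by move=> u; exact: (le_trans (vmax u)).
apply: preimage_closed; last exact: closed_ge.
by move=> w _; exact: cf.
Qed.

End continuity.

Section mass_objective.
Context {R : realType} (tau0 tau1 : R).
Hypotheses (tau0_gt0 : 0 < tau0) (tau1_gt0 : 0 < tau1).
Let s := tau0 + tau1.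
Let s_gt0 : 0 < s. Proof. exact: addr_gt0. Qed.

(** With [u] the weighted mean, the difference of the two sides is [expR u] times a positive
    combination of [expR z - 1 - z] at [z = x - u] and [z = y - u], the linear terms cancelling.
    Such a term vanishes only at [z = 0]. *)
Lemma expR_convex_strict (x y : R) :
  s * expR ((tau0 * x + tau1 * y) / s) <= tau0 * expR x + tau1 * expR y
    ?= iff (x == y).
Proof.
set u := _ / s.
have su : tau0 * x + tau1 * y = s * u by rewrite /u [RHS]mulrC divfK ?gt_eqF.
have E : tau0 * expR x + tau1 * expR y - s * expR u =
    expR u * (tau0 * (expR (x - u) - 1 - (x - u)) + tau1 * (expR (y - u) - 1 - (y - u))).
  have -> : expR x = expR u * expR (x - u) by rewrite -expRD addrC subrK.
  have -> : expR y = expR u * expR (y - u) by rewrite -expRD addrC subrK.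
  have -> : tau0 * (expR (x - u) - 1 - (x - u)) + tau1 * (expR (y - u) - 1 - (y - u)) =
    tau0 * (expR (x - u) - 1) + tau1 * (expR (y - u) - 1) - (tau0 * x + tau1 * y - s * u).
    by rewrite /s; ring.
  by rewrite su /s; ring.
have ge0 z : 0 <= expR z - 1 - z.
  by rewrite -addrA -opprD subr_ge0 expR_ge1Dx.
have [xy|xy] := eqVneq x y.
  have ux : u = x.
    by rewrite /u xy -mulrDl -/s [_ * y]mulrC mulfK ?gt_eqF.
  by rewrite /Order.leif ux xy -mulrDl lexx eqxx.
apply/leifP; rewrite -subr_gt0 E mulr_gt0 ?expR_gt0//.
apply: ltr_wpDr; first by rewrite mulr_ge0 ?ge0 ?ltW.
rewrite mulr_gt0// -addrA -opprD subr_gt0 expR_gt1Dx// subr_eq0.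
apply: contra_neq xy => xu; apply/(mulfI (lt0r_neq0 tau1_gt0))/(addrI (tau0 * x)).
by rewrite -mulrDl su -xu.
Qed.

(** Weighted arithmetic-geometric mean inequality for [b] and [p], the power of [z] with exponent
    $1/\theta$: their geometric mean is $b^{1-\theta} z$, because $p^\theta = z$. *)
Lemma mass_optimum (b z : R) : 0 < b -> 0 < z ->
  - (tau0 * z `^ (tau0 / s)^-1) <= tau1 * b - s * (expR (tau1 / s * ln b) * z)
    ?= iff (b == z `^ (tau0 / s)^-1).
Proof.
move=> b0 z0; set p := z `^ _.
have p0 : 0 < p by exact: powR_gt0.
have := expR_convex_strict (ln p) (ln b); rewrite !lnK ?posrE//.
have -> : (ln p == ln b) = (b == p).
  by rewrite eq_sym; apply/eqP/eqP => [/ln_inj|->//]; apply; rewrite posrE.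
have -> : expR ((tau0 * ln p + tau1 * ln b) / s) = expR (tau1 / s * ln b) * z.
  rewrite -[in RHS](lnK z0) -expRD; congr expR.
  by rewrite /p ln_powR; field; rewrite !gt_eqF.
move=> H; rewrite leifBRL [X in X <= _ ?= iff _]addrC leifBLR.
by rewrite [X in _ <= X ?= iff _]addrC.
Qed.

End mass_objective.

(** The perturbation bound is used from [v] to [w] for the upper estimate and from [w] to [v] for
    the lower one; [e] is fixed first and [N v w] is then made small. *)
Lemma continuous_of_perturb {R : realType} (T : topologicalType) (g : T -> R)
    (N : T -> T -> R) (K : R) : 0 < K -> (forall v, 0 <= g v) ->
  (forall v w, 0 <= N v w) -> (forall v, N v v = 0) -> (forall v w, N v w = N w v) ->
  (forall v, continuous (N v)) ->
  (forall v w e, 0 < e ->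
    g w <= g v + (e * g v + (1 + e^-1) * N v w * (K * (1 + g v)))) ->
  continuous g.
Proof.
move=> K0 g0 N0 Nvv NC cN HK v.
apply: (iffRL (@cvgrPdist_le _ _ _ (nbhs v) (nbhs_filter v) g (g v))) => eps eps0.
(* Large enough for the bound starting from [w] as well: [g w <= g v + h] with [h <= 1] gives
   [1 + g w <= M]. The choices of [e] and [del] below make each of the two error terms at most
   [h / 2]. *)
pose M := 2 + g v.
have M0 : 0 < M by rewrite ltr_wpDr.
have [h [h0 h1 heps]] : exists h, [/\ 0 < h, h <= 1 & h <= eps].
  by exists (Num.min 1 eps); rewrite lt_min ltr01 eps0 ge_min lexx ge_min lexx orbT.
pose e := h / (2 * M).
have e0 : 0 < e by rewrite divr_gt0// mulr_gt0.
pose del := h / (2 * ((1 + e^-1) * (K * M))).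
have q0 : 0 < 1 + e^-1 by rewrite addr_gt0// invr_gt0.
have del0 : 0 < del by rewrite divr_gt0// !mulr_gt0.
have bound v' w : 1 + g v' <= M -> N v' w <= del -> g w <= g v' + h.
  move=> gM ND; apply: (le_trans (HK v' w e e0)); rewrite lerD2l.
  have -> : h = e * M + (1 + e^-1) * del * (K * M).
    rewrite /del; move: (1 + e^-1) q0 => q q0; rewrite /e; field.
    by rewrite !gt_eqF.
  apply: lerD.
    rewrite ler_pM2l//; apply: le_trans gM; by rewrite lerDr.
  apply: ler_pM; first by rewrite mulr_ge0// ltW.
  - by rewrite mulr_ge0 ?addr_ge0// ltW.
  - by rewrite ler_pM2l.
  - by rewrite ler_pM2l.
have : \forall w \near v, N v w < del.
  apply: (@cvgr_lt _ _ (nbhs v) (nbhs_filter v) (N v) (N v v) (cN v v)).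
  by rewrite Nvv.
apply: filterS => w /ltW Nw.
have gw : g w <= g v + h by apply: bound => //; rewrite /M lerD2r ler1n.
have gv : g v <= g w + h.
  apply: bound; last by rewrite NC.
  by rewrite /M -[2]/(1 + 1) -addrA lerD2l (le_trans gw)// [leRHS]addrC lerD2l.
by rewrite ler_norml lerNl opprB !lerBlDl (le_trans gw) ?(le_trans gv) ?lerD2l.
Qed.

Section gaussian_score.
Context {R : realType} (d n : nat) (tau0 tau1 : R).
Hypotheses (tau0_gt0 : 0 < tau0) (tau1_gt0 : 0 < tau1) (n_gt0 : (0 < n)%N).
Variables (lambda a : 'I_n -> R).
Hypotheses (lambda_gt0 : forall i, 0 < lambda i) (a_gt0 : forall i, 0 < a i).
Variables (m1 : 'I_n -> 'rV[R]_d) (L1 : 'I_n -> 'M[R]_d).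
Hypothesis L1_unit : forall i, L1 i \in unitmx.

Let s := tau0 + tau1.
Let s_gt0 : 0 < s. Proof. exact: addr_gt0. Qed.
Let theta := mass_exponent tau0 tau1.
Let mu i := gaussian (m1 i) ((L1 i)^T *m L1 i).

Definition gscore (m : 'rV[R]_d) (L : 'M[R]_d) : R :=
  \sum_(i < n) lambda i * a i `^ mass_exponent tau0 tau1 *
    expR (- (gcost tau0 tau1 (m1 i) (L1 i) m L / (tau0 + tau1))).

Let weight_gt0 i : 0 < lambda i * a i `^ theta.
Proof. by rewrite mulr_gt0// powR_gt0. Qed.

Lemma gscore_lt m L m' L' :
  (forall i, gcost tau0 tau1 (m1 i) (L1 i) m' L' < gcost tau0 tau1 (m1 i) (L1 i) m L) ->
  gscore m L < gscore m' L'.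
Proof.
move=> H; apply: ltr_sum => [|i _].
  by apply/hasP; exists (Ordinal n_gt0); rewrite ?mem_index_enum.
by rewrite ltr_pM2l// ltr_expR ltrN2 ltr_pM2r ?invr_gt0.
Qed.

Lemma gscore_gt0 m L : 0 < gscore m L.
Proof.
rewrite /gscore (bigD1 (Ordinal n_gt0))//= ltr_pwDl//.
  by rewrite mulr_gt0// expR_gt0.
by apply: sumr_ge0 => i _; rewrite mulr_ge0 ?expR_ge0// ltW.
Qed.

Lemma shape_score_gaussian m L : L \in unitmx ->
  shape_score tau0 tau1 lambda a mu (gaussian m (L^T *m L)) = gscore m L.
Proof.
move=> uL; apply: eq_bigr => i _; congr (_ * _).
rewrite /mu shape_cost_gaussian; [|exact: tau0_gt0|exact: tau1_gt0|exact: L1_unit|exact: uL].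
by rewrite gcostE_EFin.
Qed.

Lemma barycenter_obj_gaussian b m L : 0 < b -> L \in unitmx ->
  \sum_(i < n) lambda i = 1 ->
  barycenter_obj tau0 tau1 lambda a mu b (gaussian m (L^T *m L)) =
  (tau0 * (\sum_(i < n) lambda i * a i) +
   (tau1 * b - s * (expR (tau1 / s * ln b) * gscore m L)))%:E.
Proof.
move=> b0 uL l1.
pose t i := optimal_mass tau0 tau1 (a i) b (gcost tau0 tau1 (m1 i) (L1 i) m L).
have uotE i : UOT tau0 tau1 (scaled (a i) (mu i)) (scaled b (gaussian m (L^T *m L))) =
    (tau0 * a i + tau1 * b - s * t i)%:E.
  apply: UOT_scaled => //.
  rewrite -shape_costE; [|exact: ltW|exact: ltW].
  rewrite shape_cost_gaussian; [|exact: tau0_gt0|exact: tau1_gt0|exact: L1_unit|exact: uL].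
  exact: gcostE_EFin.
have tE i : t i = expR (tau1 / s * ln b) *
    (a i `^ theta * expR (- (gcost tau0 tau1 (m1 i) (L1 i) m L / s))).
  rewrite /t /optimal_mass /powR gt_eqF// -!expRD; congr expR.
  by rewrite /theta /mass_exponent -/s; field; rewrite gt_eqF.
rewrite /barycenter_obj; under eq_bigr do rewrite uotE -EFinM.
rewrite sumEFin; congr EFin.
under eq_bigr do rewrite tE.
have tb : tau1 * b = \sum_(i < n) lambda i * (tau1 * b) by rewrite -mulr_suml l1 mul1r.
rewrite /gscore -/theta -/s [in RHS]tb !mulr_sumr -sumrB -big_split/=; apply: eq_bigr => i _.
by ring.
Qed.

Lemma gscore_improve m L : L \notin unitmx ->
  exists L', gscore m L < gscore m L'.
Proof.
move=> /(gcost_singular tau0_gt0 tau1_gt0)[D HD].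
have {HD} /choice[cM HcM] : forall i, exists cM : R * R, [/\ 0 < cM.1, 0 < cM.2 &
    forall eps, gcost tau0 tau1 (m1 i) (L1 i) m (L + eps *: D) <=
    gcost tau0 tau1 (m1 i) (L1 i) m L + (eps ^+ 2 - 2 * cM.1 * eps) * cM.2].
  by move=> i; have [c [M H]] := HD (m1 i) (L1 i) m (L1_unit i); exists (c, M).
(* Every [eps] strictly between 0 and twice the i-th constant lowers the i-th cost; the minimum of
   the constants works for all [i]. *)
pose e := \big[Num.min/1]_i (cM i).1.
have e0 : 0 < e.
  by apply/bigmin_gtP; split=> [|i _]; [exact: ltr01|have [] := HcM i].
exists (L + e *: D); apply: gscore_lt => i; have [c0 M0 H] := HcM i.
apply: (le_lt_trans (H e)); rewrite gtrDl pmulr_llt0// subr_lt0 expr2 ltr_pM2r//.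
have : e <= (cM i).1 by exact: bigmin_le.
by move=> /le_lt_trans; apply; rewrite mulr_natl mulr2n ltrDl.
Qed.

(** The pair (m, L) is flattened into one row vector, the space in which [compact_maximizers]
    works. *)
Lemma gcost_continuous m0 L0 :
  continuous (fun v : 'rV[R]_(d + d * d) =>
    gcost tau0 tau1 m0 L0 (lsubmx v) (vec_mx (rsubmx v))).
Proof.
pose N (v w : 'rV[R]_(d + d * d)) :=
  nsq (lsubmx v - lsubmx w) + frob (vec_mx (rsubmx v) - vec_mx (rsubmx w) : 'M[R]_d).
have NC v w : N v w = N w v.
  rewrite /N /nsq /frob; congr (_ + _).
    by apply: eq_bigr => j _; rewrite !mxE -sqrrN opprB.
  by do 2!(apply: eq_bigr => ? _); rewrite !mxE -sqrrN opprB.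
have cN v : continuous (N v).
  have cc (c : R) k : continuous (fun w : 'rV[R]_(d + d * d) => (c - w 0 k) * (c - w 0 k)).
    have cB : continuous (fun w : 'rV[R]_(d + d * d) => c - w 0 k).
      by move=> x; apply: continuousB; [exact: cst_continuous|exact: coord_continuous].
    by move=> x; exact: (continuousM (cB x) (cB x)).
  have c1 : continuous (fun w : 'rV[R]_(d + d * d) => nsq (lsubmx v - lsubmx w)).
    apply: continuous_sumR => j x.
    under eq_fun do rewrite !mxE expr2.
    exact: cc.
  have c2 : continuous (fun w : 'rV[R]_(d + d * d) =>
      frob (vec_mx (rsubmx v) - vec_mx (rsubmx w) : 'M[R]_d)).
    apply: continuous_sumR => i; apply: continuous_sumR => j x.
    under eq_fun do rewrite !mxE expr2.
    exact: cc.
  by move=> w; exact: (continuousD (c1 w) (c2 w)).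
have [K K0 HK] := gcost_perturb tau0_gt0 tau1_gt0 m0 L0.
pose g (v : 'rV[R]_(d + d * d)) := gcost tau0 tau1 m0 L0 (lsubmx v) (vec_mx (rsubmx v)).
have g0 v : 0 <= g v by exact: gcost_ge0.
have {}HK v w e : 0 < e -> g w <= g v + (e * g v + (1 + e^-1) * N v w * (K * (1 + g v))).
  by move=> e0; rewrite addrA; exact: HK.
apply: (@continuous_of_perturb _ _ g N K) => //.
- move=> v w; rewrite addr_ge0 ?nsq_ge0// sumr_ge0// => i _.
  by rewrite sumr_ge0// => j _; exact: sqr_ge0.
- move=> v; rewrite /N /nsq /frob !subrr big1 => [|j _]; last by rewrite mxE expr0n.
  by rewrite add0r big1// => i _; rewrite big1// => j _; rewrite mxE expr0n.
Qed.

Lemma gscore_continuous :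
  continuous (fun v : 'rV[R]_(d + d * d) => gscore (lsubmx v) (vec_mx (rsubmx v))).
Proof.
apply: continuous_sumR => i v.
apply: (@continuousM _ _ (fun=> _)
  (fun v => expR (- (gcost tau0 tau1 (m1 i) (L1 i) (lsubmx v) (vec_mx (rsubmx v)) / s)))).
  exact: cst_continuous.
apply: (@continuous_comp _ _ _
  (fun v => - (gcost tau0 tau1 (m1 i) (L1 i) (lsubmx v) (vec_mx (rsubmx v)) / s)) expR).
  apply: continuousN; apply: continuousM; last exact: cst_continuous.
  exact: gcost_continuous.
exact: continuous_expR.
Qed.

(** If every cost exceeded [b], hence its own value at (m0, L0), the score would be smaller. So some
    cost is at most [b], and the coercivity of that single cost bounds (m, L); summing the bounds
    over [i] covers whichever index it is. *)
Lemma gscore_coercive m0 L0 : exists K, forall v : 'rV[R]_(d + d * d),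
  gscore m0 L0 <= gscore (lsubmx v) (vec_mx (rsubmx v)) -> forall j, `|v 0 j| <= K.
Proof.
pose b := \sum_i gcost tau0 tau1 (m1 i) (L1 i) m0 L0.
have /choice[K HK] : forall i, exists K, 0 <= K /\ forall m L,
    gcost tau0 tau1 (m1 i) (L1 i) m L <= b ->
    (forall j, `|m 0 j| <= K) /\ (forall k j, `|L k j| <= K).
  move=> i; have [K K0 H] := gcost_coercive tau0_gt0 tau1_gt0 (m1 i) (L1 i) b.
  by exists K.
exists (\sum_i K i) => v v0.
have [i gi] : exists i, gcost tau0 tau1 (m1 i) (L1 i) (lsubmx v) (vec_mx (rsubmx v)) <= b.
  apply: contrapT => /forallNP H; move: v0; apply/negP; rewrite -ltNge.
  apply: gscore_lt => i; have /negP := H i; rewrite -ltNge; apply: le_lt_trans.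
  rewrite /b (bigD1 i)//= lerDl; apply: sumr_ge0 => k _; exact: gcost_ge0.
have [_ /(_ _ _ gi)[mK LK]] := HK i.
have KK : K i <= \sum_i K i.
  by rewrite (bigD1 i)//= lerDl; apply: sumr_ge0 => k _; have [] := HK k.
move=> j; apply: le_trans KK; rewrite -[v]hsubmxK.
case: (split_ordP j) => k ->; first by rewrite row_mxEl.
rewrite row_mxEr -[rsubmx v]vec_mxK; case/mxvec_indexP: k => x y; rewrite mxvecE.
exact: LK.
Qed.

Let Z (nu : 'rV[R]_d * 'M[R]_d) := shape_score tau0 tau1 lambda a mu (gaussian_of nu).

(** The argmax is the continuous image under [psi] of the compact set of maximizers over all
    factors. These are nonsingular by [gscore_improve], so there the score of the factor is [Z] of
    its image. *)
Lemma argmax_shape_score :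
  argmax (@gauss_params R d) Z !=set0 /\ compact (argmax (@gauss_params R d) Z).
Proof.
pose f (v : 'rV[R]_(d + d * d)) := gscore (lsubmx v) (vec_mx (rsubmx v)).
have fE m L : f (row_mx m (mxvec L)) = gscore m L.
  by rewrite /f row_mxKl row_mxKr mxvecK.
have ZE m L : L \in unitmx -> Z (m, L^T *m L) = gscore m L.
  exact: shape_score_gaussian.
have [K HK] := gscore_coercive 0 1%:M.
have [] := @compact_maximizers R _ f (row_mx 0 (mxvec 1%:M)) K gscore_continuous.
  by move=> v; rewrite fE; exact: HK.
set V := [set v | _] => V0 cV.
pose psi (v : 'rV[R]_(d + d * d)) : 'rV[R]_d * 'M[R]_d :=
  (lsubmx v, (vec_mx (rsubmx v))^T *m vec_mx (rsubmx v)).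
suff -> : argmax (@gauss_params R d) Z = psi @` V.
  split; first by case: V0 => v Vv; exists (psi v); exists v.
  apply: continuous_compact cV; apply: continuous_subspaceT.
  have c1 : continuous (fun v : 'rV[R]_(d + d * d) => lsubmx v).
    apply: continuous_mx => i j x; under eq_fun do rewrite mxE.
    exact: coord_continuous.
  have c2 : continuous (fun v : 'rV[R]_(d + d * d) =>
      (vec_mx (rsubmx v))^T *m (vec_mx (rsubmx v) : 'M[R]_d)).
    have ce k j : continuous (fun v : 'rV[R]_(d + d * d) =>
        (vec_mx (rsubmx v) : 'M[R]_d) k j).
      by move=> x; under eq_fun do rewrite !mxE; exact: coord_continuous.
    apply: continuous_mx => i j x; under eq_fun do rewrite mxE.
    apply: continuous_sumR => k y; under eq_fun do rewrite [_^T _ _]mxE.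
    exact: (continuousM (ce _ _ y) (ce _ _ y)).
  move=> v.
  exact: (@cvg_pair _ _ _ _ _ _ (nbhs_filter v) (nbhs_filter (lsubmx v))
    (nbhs_filter _) _ _ (c1 v) (c2 v)).
have V_unit v : V v -> vec_mx (rsubmx v) \in unitmx.
  move=> Vv; apply: contrapT => /negP /(gscore_improve (lsubmx v))[L' L'gt].
  have := Vv (row_mx (lsubmx v) (mxvec L')); rewrite fE /f.
  by rewrite leNgt L'gt.
apply/seteqP; split=> [[m S] [/= spdS Smax]|_ [v Vv <-]]; last first.
  have uL := V_unit v Vv; split; first exact/spd_mulmx.
  move=> [m S] spdS; have [L uL' ->] := cholesky (spdS : spd S).
  rewrite (ZE _ _ uL') /psi (ZE _ _ uL).
  by have := Vv (row_mx m (mxvec L)); rewrite fE.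
have [L uL SE] := cholesky (spdS : spd S); exists (row_mx m (mxvec L)); last first.
  by rewrite /psi row_mxKl row_mxKr mxvecK -SE.
(* A maximizer [v] over all factors, being nonsingular, is an admissible competitor for [Z]; so a
   maximizer of [Z] does at least as well as any factor, singular ones included. *)
move=> w; have [v Vv] := V0; apply: (le_trans (Vv w)).
rewrite fE -(ZE _ _ uL) -SE /f -(ZE _ _ (V_unit _ Vv)).
by apply: Smax; exact/spd_mulmx/V_unit.
Qed.

End gaussian_score.

Lemma argmax_eq {disp : Order.disp_t} (T : Type) (Y : porderType disp) (D : set T)
    (f : T -> Y) (x y : T) : argmax D f x -> argmax D f y -> f x = f y.
Proof. by move=> [Dx Hx] [Dy Hy]; apply: le_anti; rewrite Hx ?Hy. Qed.

(** * Elimination of the total mass from an objective of the given form *)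

Section profile.
Context {R : realType} (T : Type) (tau0 tau1 c : R) (G : set T).
Hypotheses (tau0_gt0 : 0 < tau0) (tau1_gt0 : 0 < tau1).
Variables (Z : T -> R) (F : R -> T -> \bar R).
Let s := tau0 + tau1.
Let theta := tau0 / s.
Hypothesis Z_gt0 : forall nu, G nu -> 0 < Z nu.
Hypothesis FE : forall b nu, 0 < b -> G nu ->
  F b nu = (c + (tau1 * b - s * (expR (tau1 / s * ln b) * Z nu)))%:E.

Let invtheta_gt0 : 0 < theta^-1.
Proof. by rewrite invr_gt0 divr_gt0// addr_gt0. Qed.

Let best nu := Z nu `^ theta^-1.

Let best_gt0 nu : G nu -> 0 < best nu.
Proof. by move=> /Z_gt0; exact: powR_gt0. Qed.

Let F_best nu : G nu -> F (best nu) nu = (c - tau0 * best nu)%:E.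
Proof.
move=> Gnu; rewrite FE ?best_gt0//; congr (_ + _)%:E; apply/esym/eqP.
by have [_ ->] := mass_optimum tau0_gt0 tau1_gt0 (best_gt0 Gnu) (Z_gt0 Gnu).
Qed.

Let F_ge b nu : 0 < b -> G nu -> ((c - tau0 * best nu)%:E <= F b nu)%E.
Proof.
move=> b0 Gnu; rewrite FE// lee_fin lerD2l.
by have [] := mass_optimum tau0_gt0 tau1_gt0 b0 (Z_gt0 Gnu).
Qed.

Let F_eq b nu : 0 < b -> G nu -> (F b nu <= (c - tau0 * best nu)%:E)%E -> b = best nu.
Proof.
move=> b0 Gnu le; have [H E] := mass_optimum tau0_gt0 tau1_gt0 b0 (Z_gt0 Gnu).
apply/eqP; rewrite -E eq_le H/=; move: le.
by rewrite FE// lee_fin lerD2l.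
Qed.

Let best_le nu nu' : G nu -> G nu' -> (best nu <= best nu') = (Z nu <= Z nu').
Proof.
move=> /Z_gt0/ltW z0 /Z_gt0/ltW z0'.
have [zz|zz] := leP (Z nu) (Z nu').
  by apply: ge0_ler_powR; rewrite ?nnegrE// ltW.
by apply/negbTE; rewrite -ltNge; apply: gt0_ltr_powR; rewrite ?nnegrE.
Qed.

Let value_le nu nu' : G nu -> G nu' ->
  ((c - tau0 * best nu)%:E <= (c - tau0 * best nu')%:E)%E = (Z nu' <= Z nu).
Proof. by move=> Gnu Gnu'; rewrite lee_fin lerD2l lerN2 ler_pM2l// best_le. Qed.

Lemma profile_value nu : G nu ->
  ereal_inf [set F b nu | b in [set b : R | 0 < b]] = (c - tau0 * best nu)%:E.
Proof.
move=> Gnu; apply/eqP; rewrite eq_le; apply/andP; split.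
  by apply: ereal_inf_lbound; exists (best nu); [exact: best_gt0|exact: F_best].
by apply: le_ereal_inf_tmp => _ [b b0 <-]; exact: F_ge.
Qed.

Lemma argmin_profile :
  argmin G (fun nu => ereal_inf [set F b nu | b in [set b : R | 0 < b]]) = argmax G Z.
Proof.
apply/seteqP; split=> nu [Gnu H]; split => // nu' Gnu'.
  by have := H nu' Gnu'; rewrite !profile_value// value_le.
by rewrite !profile_value// value_le//; exact: H.
Qed.

Lemma argmin_joint :
  argmin ([set b : R | 0 < b] `*` G) (fun bnu => F bnu.1 bnu.2) =
  [set (Z nu `^ theta^-1, nu) | nu in argmax G Z].
Proof.
apply/seteqP; split=> [[b nu] [[/= b0 Gnu] H]|_ [nu [Gnu H] <-]].
  have bE : b = best nu.
    apply: F_eq => //; rewrite -F_best//.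
    by apply: (H (best nu, nu)); split=> //=; exact: best_gt0.
  exists nu; last by rewrite bE.
  split => // nu' Gnu'; rewrite -value_le// -F_best// -bE -F_best//.
  by apply: (H (best nu', nu')); split=> //=; exact: best_gt0.
split=> [|[b nu'] [/= b0 Gnu']]; first by split=> //=; exact: best_gt0.
rewrite F_best//; apply: le_trans (F_ge b0 Gnu').
by rewrite value_le//; exact: H.
Qed.

End profile.

Theorem theorem3p8 (R : realType) (d n : nat) (tau0 tau1 : R)
    (lambda a : 'I_n -> R) (m : 'I_n -> 'rV[R]_d) (Sigma : 'I_n -> 'M[R]_d)
    (tau0_gt0 : 0 < tau0) (tau1_gt0 : 0 < tau1) (n_gt0 : (0 < n)%N)
    (lambda_gt0 : forall i, 0 < lambda i)
    (lambda_sum1 : \sum_(i < n) lambda i = 1)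
    (a_gt0 : forall i, 0 < a i)
    (Sigma_spd : forall i, spd (Sigma i)) :
  let mu i := gaussian (m i) (Sigma i) in
  let theta := mass_exponent tau0 tau1 in
  let F (bnu : R * ('rV[R]_d * 'M[R]_d)) :=
    barycenter_obj tau0 tau1 lambda a mu bnu.1 (gaussian_of bnu.2) in
  let Phi (nu : 'rV[R]_d * 'M[R]_d) :=
    profile_obj tau0 tau1 lambda a mu (gaussian_of nu) in
  let Z (nu : 'rV[R]_d * 'M[R]_d) :=
    shape_score tau0 tau1 lambda a mu (gaussian_of nu) in
  let G := @gauss_params R d in
  let argmin_F := argmin ([set b : R | 0 < b] `*` G) F in
  [/\ argmin G Phi !=set0 /\ argmax G Z !=set0,
      argmin G Phi = argmax G Z,
      argmin_F !=set0,
      argmin_F = [set (Z nu `^ theta^-1, nu) | nu in argmax G Z] &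
      compact (argmax G Z) /\ compact argmin_F].
Proof.
have /choice[L1 HL1] : forall i, exists L, L \in unitmx /\ Sigma i = L^T *m L.
  by move=> i; have [L] := cholesky (Sigma_spd i); exists L.
have uL1 i : L1 i \in unitmx by have [] := HL1 i.
have SE : Sigma = fun i => (L1 i)^T *m L1 i by apply/funext => i; have [] := HL1 i.
rewrite {}SE {Sigma Sigma_spd HL1} => mu theta F Phi Z G argmin_F.
have [Z0 cZ] : argmax G Z !=set0 /\ compact (argmax G Z).
  exact: (argmax_shape_score tau0_gt0 tau1_gt0 n_gt0 lambda_gt0 a_gt0 m uL1).
have Z_gt0 nu : G nu -> 0 < Z nu.
  case: nu => m' S spdS; have [L uL ->] := cholesky (spdS : spd S).
  rewrite /Z /gaussian_of [X in _ < X](shape_score_gaussian tau0_gt0 tau1_gt0 lambda a m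
    uL1 m' uL).
  exact: gscore_gt0.
have FE b nu : 0 < b -> G nu -> F (b, nu) =
    (tau0 * (\sum_(i < n) lambda i * a i) +
     (tau1 * b - (tau0 + tau1) * (expR (tau1 / (tau0 + tau1) * ln b) * Z nu)))%:E.
  case: nu => m' S b0 spdS; have [L uL ->] := cholesky (spdS : spd S).
  rewrite /Z /gaussian_of [X in expR _ * X](shape_score_gaussian tau0_gt0 tau1_gt0 lambda a m
    uL1 m' uL).
  exact: (barycenter_obj_gaussian tau0_gt0 tau1_gt0 a_gt0 m uL1 m' b0 uL lambda_sum1).
have PhiE : argmin G Phi = argmax G Z.
  exact: (argmin_profile tau0_gt0 tau1_gt0 Z_gt0 FE).
have FE' : argmin_F = [set (Z nu `^ theta^-1, nu) | nu in argmax G Z].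
  by rewrite -(argmin_joint tau0_gt0 tau1_gt0 Z_gt0 FE) /argmin_F; congr argmin.
clear Z_gt0 FE; clearbody argmin_F Phi Z; have [nu0 nu0max] := Z0.
split=> //; first by rewrite PhiE.
  by rewrite FE'; exists (Z nu0 `^ theta^-1, nu0); exists nu0.
split=> //.
(* [Z] is constant on its argmax, so all minimizers have the same mass and the minimizer set is the
   product of a point and a compact set. *)
have -> : argmin_F = [set Z nu0 `^ theta^-1] `*` argmax G Z.
  have ZE nu : argmax G Z nu -> Z nu = Z nu0 by move=> H; exact: (argmax_eq H nu0max).
  rewrite FE'; apply/seteqP; split=> [_ [nu numax <-]|[b nu] [/= -> numax]].
    by rewrite (ZE _ numax).
  by exists nu; rewrite ?(ZE _ numax).
apply: compact_setX; [exact: compact_set1|exact: cZ].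
Qed.
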